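(* Let $n$ be a positive integer, let $\alpha\in FT_1$ and let $y(z)=\int_{-\infty}^{+\infty}\frac{\alpha(dw)}{w-z}$ (for $\Im z>0$) be its Stieltjes transform. Then $\mu(n\alpha)=\alpha$ if and only if $$n\,y(z)\,y^{(n-1)}(z)=y^{(n)}(z)\quad\text{for all } z \text{ with } \Im z>0.$$ In particular, for $n=1$ and for $n=2$, $\mu(n\alpha)=\alpha$ implies that $\alpha$ is Cauchy or Dirac. Moreover, let $d\ge1$ and $\alpha\in FT_d$. Then $\mu(\alpha)=\alpha$ if and only if $\alpha$ is Cauchy in $\mathbb{R}^d$; likewise $\mu(2\alpha)=\alpha$ if and only if $\alpha$ is Cauchy in $\mathbb{R}^d$.
   Context: $FT_d$ is the set of probabilities $\alpha$ on $\mathbb{R}^d$ with $\int\log(1+\|x\|)\alpha(dx)<\infty$. For $\alpha\in FT_d$ and $t>0$, let $B_1,Y_1,B_2,Y_2,\ldots$ be independent with $B_n\sim\alpha$ and $Y_n\sim\beta(1,t)$ (density $t(1-y)^{t-1}$ on $(0,1)$), and put $W_1=Y_1$, $W_n=Y_n(1-Y_{n-1})\cdots(1-Y_1)$ for $n>1$. The series $X_t=\sum_{n\ge1}W_nB_n$ converges absolutely almost surely, and $\mu(t\alpha)$ denotes its distribution (it is the law of $\int x\,P_t(dx)$ for a Dirichlet random probability $P_t=\sum_n W_n\delta_{B_n}\sim\mathcal{D}(t\alpha)$). We write $\mu(\alpha)$ for $\mu(1\cdot\alpha)$. On $\mathbb{R}$, ''Cauchy'' means $\alpha=c_{a+ib}$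 with $c_{a+ib}(dx)=\frac1\pi\frac{b\,dx}{(x-a)^2+b^2}$ for some $a\in\mathbb{R}$, $b>0$, and ''Dirac'' means $\alpha=\delta_a$ for some $a\in\mathbb{R}$. A Cauchy distribution in $\mathbb{R}^d$ is the law of a random vector $X$ such that for every $f\in\mathbb{R}^d$ the real random variable $\langle f,X\rangle$ either is Dirac (almost surely constant) or has a one-dimensional Cauchy distribution (so Dirac masses are included in this definition). *)

(* Defs.v *)
From mathcomp Require Import all_boot all_order all_algebra finmap.
From mathcomp Require Import complex.
From mathcomp Require Import all_classical all_reals all_analysis.

Set Implicit Arguments.
Unset Strict Implicit.
Unset Printing Implicit Defensive.

Import Order.TTheory GRing.Theory Num.Theory.
Import numFieldNormedType.Exports.

Local Open Scope classical_set_scope.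
Local Open Scope ring_scope.
Local Open Scope complex_scope.

(* R^d is d.-tuple (measurableTypeR R): the product sigma-algebra of the Borel
   sigma-algebra of R, which is the Borel sigma-algebra of R^d. *)

Definition inner {R : realType} {d : nat} (f x : d.-tuple (measurableTypeR R)) : R :=
  \sum_(i < d) (tnth f i : R) * tnth x i.

Definition norm2 {R : realType} {d : nat} (x : d.-tuple (measurableTypeR R)) : R :=
  Num.sqrt (inner x x).

Definition eq_law {R : realType} {dE : measure_display} {E : measurableType dE}
    (m1 m2 : set E -> \bar R) : Prop :=
  forall A, measurable A -> m1 A = m2 A.

Definition FT1 {R : realType} (alpha : probability (measurableTypeR R) R) : Prop :=
  (\int[alpha]_x (ln (1 + `|x : R|))%:E < +oo)%E.

Definition FT {R : realType} {d : nat}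
    (alpha : probability (d.-tuple (measurableTypeR R)) R) : Prop :=
  (\int[alpha]_x (ln (1 + norm2 x))%:E < +oo)%E.

(* The law with density t (1 - y)^(t - 1) on (0, 1); the library's [beta_prob]
   only has natural parameters. *)
Definition beta1 {R : realType} (t : R) (A : set (measurableTypeR R)) : \bar R :=
  (\int[lebesgue_measure]_(y in A `&` `]0%R, 1%R[)
     (t * (1 - y) `^ (t - 1))%:E)%E.

Definition cauchy_law {R : realType} (a b : R) (A : set (measurableTypeR R)) : \bar R :=
  (\int[lebesgue_measure]_(x in A)
     (pi^-1 * (b / ((x - a) ^+ 2 + b ^+ 2)))%:E)%E.

Definition is_cauchy {R : realType} (m : set (measurableTypeR R) -> \bar R) : Prop :=
  exists a b : R, 0 < b /\ eq_law m (cauchy_law a b).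

Definition is_dirac {R : realType} (m : set (measurableTypeR R) -> \bar R) : Prop :=
  exists a : R, eq_law m (\d_(a : measurableTypeR R)).

Definition is_cauchy_vector {R : realType} {d : nat}
    (m : set (d.-tuple (measurableTypeR R)) -> \bar R) : Prop :=
  forall f : d.-tuple (measurableTypeR R),
    let mf := pushforward m (inner f : _ -> measurableTypeR R) in
    is_dirac mf \/ is_cauchy mf.

(* Mutual independence of a family of classes of events. *)
Definition mutual_independence {R : realType} {dT : measure_display}
    {T : measurableType dT} (P : probability T R) {I : choiceType}
    (G : I -> set (set T)) : Prop :=
  forall (J : {fset I}) (A : I -> set T),
    (forall i, i \in J -> G i (A i)) ->
    P (\bigcap_(i in [set` J]) A i) = (\prod_(i <- J) P (A i))%E.

(* B and Y are indexed from 0: B_(n+1) and Y_(n+1) are [B n] and [Y n]. The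
   index set of the whole family B_1, Y_1, B_2, Y_2, ... is nat + nat. *)
Record stick_breaking {R : realType} {dT dE : measure_display}
    {T : measurableType dT} {E : measurableType dE} (t : R)
    (alpha : probability E R) (P : probability T R)
    (B : nat -> {RV P >-> E}) (Y : nat -> {RV P >-> measurableTypeR R}) : Prop :=
  StickBreaking {
    sb_indep : mutual_independence P (fun i : nat + nat =>
      match i with
      | inl n => preimage_set_system setT (B n) measurable
      | inr n => preimage_set_system setT (Y n) measurable
      end);
    sb_B : forall n, eq_law (distribution P (B n)) alpha;
    sb_Y : forall n, eq_law (distribution P (Y n)) (beta1 t) }.

Arguments stick_breaking {R dT dE T E} t alpha P B Y.

Definition weight {R : realType} {T : Type} (Y : nat -> T -> R) (n : nat) (w : T) : R :=
  Y n w * \prod_(k < n) (1 - Y k w).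

(* Where the series diverges (a null event for alpha in FT) the sum is 0, the
   default value of [limn]. *)
Definition series_sum {R : realType} (u : R^nat) : R := limn (series u).

(* mu(t alpha), as the law of X_t = sum_n W_n B_n, for alpha on R *)
Definition mu1 {R : realType} {dT : measure_display} {T : measurableType dT}
    (P : probability T R) (B Y : nat -> {RV P >-> measurableTypeR R}) :
    set (measurableTypeR R) -> \bar R :=
  pushforward P (fun w =>
    series_sum (fun n => weight Y n w * B n w) : measurableTypeR R).

Arguments mu1 {R dT T} P B Y.

(* the same for alpha on R^d *)
Definition mu {R : realType} {d : nat} {dT : measure_display} {T : measurableType dT}
    (P : probability T R) (B : nat -> {RV P >-> d.-tuple (measurableTypeR R)})
    (Y : nat -> {RV P >-> measurableTypeR R}) :
    set (d.-tuple (measurableTypeR R)) -> \bar R :=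
  pushforward P (fun w =>
    [tuple series_sum (fun n => weight Y n w * tnth (B n w) i) : measurableTypeR R
      | i < d]).

Arguments mu {R d dT T} P B Y.

Definition stieltjes {R : realType} (alpha : probability (measurableTypeR R) R)
    (z : R[i]) : R[i] :=
  (\int[alpha]_w complex.Re (((w : R)%:C - z)^-1))%R
    +i* (\int[alpha]_w complex.Im (((w : R)%:C - z)^-1))%R.

(* Complex derivatives: R[i] is a normed module over itself. *)
Definition stieltjes_n {R : realType} (alpha : probability (measurableTypeR R) R)
    (n : nat) : R[i] -> R[i] :=
  @derive1n (R[i] : numFieldType) (R[i] : numFieldType) n (stieltjes alpha).

(* Main.v *)
(* Write S_m for the partial sums of X and R_m for the residual masses, and let
   T f x be the expectation of f (Y B + (1 - Y) x). By independence
   E f (S_m + R_m x) = T^m f x, which converges to E f (X); hence alpha is the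
   law of X if and only if alpha is T-invariant. For f w = (w - z)^-(n+1) the
   beta identity gives T f x = y(z) (x - z)^-n, so with Phi_k(z) the integral
   of (w - z)^-k the invariance reads Phi_(n+1) = Phi_1 Phi_n, and
   k! Phi_(k+1) is the k-th derivative of y. Conversely the functions
   Phi_(n+1) determine the law, by integrating down to the Poisson integrals.
   For n = 2, (Phi_2 - Phi_1^2)' = 2 (Phi_3 - Phi_1 Phi_2) = 0 gives the
   equation y' = y^2 of n = 1, so y(z) = 1 / (c - z) with Im c <= 0: a Cauchy
   or Dirac law. In dimension d all of this is applied to the projections on
   f, and the Cramer-Wold theorem recovers the law from its projections. *)
Require Import Defs.
From HB Require Import structures.
From mathcomp Require Import all_boot all_order all_algebra finmap.
From mathcomp Require Import complex.
From mathcomp Require Import all_classical all_reals all_analysis.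
From mathcomp Require Import measurable_realfun ring lra.

Set Implicit Arguments.
Unset Strict Implicit.
Unset Printing Implicit Defensive.

Import Order.TTheory GRing.Theory Num.Theory.
Import numFieldNormedType.Exports.

Local Open Scope classical_set_scope.
Local Open Scope ring_scope.
Local Open Scope complex_scope.

(** Complex analysis is reduced to one estimate: on a half-plane [q <= Im z] the increment of
    [Phi k] has linear part h k Phi_(k+1)(z), with a remainder of at most M |h|^2 where M depends on
    the measure, q and k only. A combination whose linear parts cancel has quadratic increments,
    hence is constant along segments; its value is read off far up in the half-plane or at a base
    point. This takes the place of holomorphy and of path integrals. On the probability side the
    test functions (powers of the kernel, cosines, indicators) are bounded, so Fubini and dominated
    convergence apply at once. The logarithmic moment enters only through the almost sure
    convergence of the series. A single uniqueness theorem serves everywhere, the one for Poisson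
    integrals. The functions Phi_k are brought down to it, and so are characteristic functions,
    because the Poisson kernel is an exponential mixture of cosines. *)

Local Notation normc := ComplexField.Normc.normc.
Local Notation Re := complex.Re.
Local Notation Im := complex.Im.

(** * Integrals of bounded measurable functions, product laws and independence *)

Section BoundedMeasurable.
Context {d : measure_display} {X : measurableType d} {R : realType}.
Implicit Types (f g : X -> R).

Definition bmeas f := measurable_fun setT f /\ exists M, forall x, `|f x| <= M.

Lemma bmeas_measurable f : bmeas f -> measurable_fun setT f.
Proof. by case. Qed.

Lemma bmeas_cst (c : R) : bmeas (fun _ : X => c).
Proof. by split => //; exists `|c|. Qed.

Lemma bmeasD f g : bmeas f -> bmeas g -> bmeas (fun x => f x + g x).
Proof.
move=> [mf [M fM]] [mg [N gN]]; split; first exact: measurable_funD.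
by exists (M + N) => x; rewrite (le_trans (ler_normD _ _))// lerD.
Qed.

Lemma bmeasM f g : bmeas f -> bmeas g -> bmeas (fun x => f x * g x).
Proof.
move=> [mf [M fM]] [mg [N gN]]; split; first exact: measurable_funM.
by exists (M * N) => x; rewrite normrM ler_pM.
Qed.

Lemma bmeasN f : bmeas f -> bmeas (fun x => - f x).
Proof.
move=> [mf [M fM]]; split; first exact: measurableT_comp.
by exists M => x; rewrite normrN.
Qed.

Lemma bmeasB f g : bmeas f -> bmeas g -> bmeas (fun x => f x - g x).
Proof. by move=> bf bg; apply: bmeasD => //; exact: bmeasN. Qed.

Lemma bmeas_indic (A : set X) : measurable A -> bmeas (\1_A : X -> R).
Proof.
move=> mA; split; first exact: measurable_indic.
by exists 1 => x; rewrite indicE ger0_norm//; case: (_ \in _).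
Qed.

Lemma bmeas_comp {d' : measure_display} {Y : measurableType d'} (h : Y -> R)
  (phi : X -> Y) : measurable_fun setT phi ->
  measurable_fun setT h -> (exists M, forall y, `|h y| <= M) ->
  bmeas (h \o phi).
Proof.
move=> mphi mh [M hM]; split; first exact: measurableT_comp.
by exists M => x /=.
Qed.

Variable m : {finite_measure set X -> \bar R}.

Lemma bmeas_integrable f : bmeas f -> m.-integrable setT (EFin \o f).
Proof.
move=> [mf [M fM]]; apply: measurable_bounded_integrable => //.
  by rewrite -ge0_fin_numE// fin_num_measure.
exists M; split; first exact: num_real.
by move=> N MN x _ /=; rewrite (le_trans (fM x))// ltW.
Qed.

Lemma bintD f g : bmeas f -> bmeas g ->
  (\int[m]_x (f x + g x) = \int[m]_x f x + \int[m]_x g x)%R.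
Proof. by move=> bf bg; rewrite RintegralD//; exact: bmeas_integrable. Qed.

Lemma bintB f g : bmeas f -> bmeas g ->
  (\int[m]_x (f x - g x) = \int[m]_x f x - \int[m]_x g x)%R.
Proof. by move=> bf bg; rewrite RintegralB//; exact: bmeas_integrable. Qed.

Lemma bintZ (c : R) f : bmeas f -> (\int[m]_x (c * f x) = c * \int[m]_x f x)%R.
Proof. by move=> bf; rewrite RintegralZl//; exact: bmeas_integrable. Qed.

Lemma bintE f : bmeas f ->
  (\int[m]_x (f x)%:E)%E = (\int[m]_x f x)%R%:E.
Proof.
move=> bf; rewrite /Rintegral fineK//.
exact: (integrable_fin_num measurableT (bmeas_integrable bf)).
Qed.

Lemma bint_le f g : bmeas f -> bmeas g -> (forall x, f x <= g x) ->
  (\int[m]_x f x <= \int[m]_x g x)%R.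
Proof. by move=> bf bg fg; apply: le_Rintegral => //; exact: bmeas_integrable. Qed.

Lemma bint_norm_le f (M : R) : measurable_fun setT f -> (forall x, `|f x| <= M) ->
  `| (\int[m]_x f x)%R | <= M * fine (m setT).
Proof.
move=> mf fM; have bf : bmeas f by split => //; exists M.
rewrite (le_trans (le_normr_Rintegral _ _))//; first exact: bmeas_integrable.
rewrite -Rintegral_cst//; apply: bint_le => //.
  by split; [exact: measurableT_comp|exists M => x; rewrite normr_id].
exact: bmeas_cst.
Qed.

Lemma bint_cvg (f_ : nat -> X -> R) f (M : R) :
  (forall n, measurable_fun setT (f_ n)) -> measurable_fun setT f ->
  (forall n x, `|f_ n x| <= M) ->
  {ae m, forall x, f_ ^~ x @ \oo --> f x} ->
  (fun n => (\int[m]_x f_ n x)%R) @ \oo --> (\int[m]_x f x)%R.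
Proof.
move=> mf_ mf fM cf.
have bf_ n : bmeas (f_ n) by split => //; exists M.
have [] := @dominated_convergence _ _ _ m setT measurableT
  (fun n => EFin \o f_ n) (EFin \o f) (EFin \o cst M).
- by move=> n; exact/measurable_EFinP.
- exact/measurable_EFinP.
- case: cf => N [mN N0 sN]; exists N; split => // x /= xN; apply: sN => /= h.
  by apply: xN => _; apply: cvg_EFin => //; near=> n.
- by apply: bmeas_integrable; exact: bmeas_cst.
- by apply: aeW => x n _ /=; rewrite lee_fin.
move=> ifn _ c; apply: fine_cvg.
rewrite /Rintegral fineK//.
exact: (integrable_fin_num measurableT ifn).
Unshelve. all: by end_near. Qed.

End BoundedMeasurable.

#[global] Hint Resolve bmeas_measurable : core.

Definition pack_mfun {d d'} {X : measurableType d} {Y : measurableType d'}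
  (phi : X -> Y) (mphi : measurable_fun setT phi) : {mfun X >-> Y} :=
  HB.pack phi (isMeasurableFun.Build _ _ _ _ phi mphi).

Section BoundedTransfer.
Context {d d' : measure_display} {X : measurableType d} {Y : measurableType d'}.
Context {R : realType}.

Lemma bint_distribution (P : probability X R) (phi : {mfun X >-> Y})
  (f : Y -> R) : bmeas f ->
  (\int[distribution P phi]_y f y = \int[P]_x f (phi x))%R.
Proof.
move=> [mf [M fM]]; rewrite /Rintegral integral_distribution//.
- exact/measurable_EFinP.
- apply: (@bmeas_integrable _ _ _ P (f \o phi)).
  by apply: bmeas_comp => //; exists M.
Qed.

Lemma bint_eq_law (m1 m2 : {measure set X -> \bar R}) (f : X -> R) :
  eq_law m1 m2 -> (\int[m1]_x f x = \int[m2]_x f x)%R.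
Proof.
by move=> m12; rewrite /Rintegral (@eq_measure_integral _ _ _ _ m2)// => A mA _;
  exact: m12.
Qed.

Lemma bmeas_pair1 (f : X * Y -> R) (x : X) : bmeas f -> bmeas (fun y => f (x, y)).
Proof.
move=> [mf [M fM]]; split; last by exists M.
exact: measurableT_comp.
Qed.

Lemma bmeas_pair2 (f : X * Y -> R) (y : Y) : bmeas f -> bmeas (fun x => f (x, y)).
Proof.
move=> [mf [M fM]]; split; last by exists M.
exact: measurableT_comp.
Qed.

Lemma bmeas_prod_integrable (P : probability X R) (Q : probability Y R)
  (f : X * Y -> R) : bmeas f -> (P \x Q)%E.-integrable setT (EFin \o f).
Proof.
move=> [mf [M fM]]; apply: measurable_bounded_integrable => //.
  have : ((P \x Q)%E ([set: X] `*` [set: Y]) = P setT * Q setT)%E.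
    exact: (product_measure1E P Q measurableT measurableT).
  by rewrite !probability_setT mule1 setXTT => PQ1; rewrite [ltLHS]PQ1 ltry.
exists M; split; first exact: num_real.
by move=> N MN x _ /=; rewrite (le_trans (fM x))// ltW.
Qed.

Lemma bmeas_bint (Q : {finite_measure set Y -> \bar R}) (f : X * Y -> R) :
  bmeas f -> bmeas (fun x => \int[Q]_y f (x, y))%R.
Proof.
move=> bf; have [mf [M fM]] := bf; split; last first.
  exists (M * fine (Q setT)) => x; apply: bint_norm_le => //.
  exact: bmeas_measurable (bmeas_pair1 _ bf).
(* Adding the bound M makes the function nonnegative, so that Tonelli gives the measurability of the
   inner integral. *)
have bfM : bmeas (fun z => f z + M) by apply: bmeasD => //; exact: bmeas_cst.
have -> : (fun x => \int[Q]_y f (x, y))%R =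
    (fun x => \int[Q]_y (f (x, y) + M) - \int[Q]_y M)%R.
  apply/funext => x; rewrite bintD ?addrK//; last exact: bmeas_cst.
  exact: bmeas_pair1.
apply: measurable_funB => //; apply/measurable_EFinP.
have : measurable_fun setT (fubini_F Q (fun z => (f z + M)%:E)).
  have mfM := bmeas_measurable bfM.
  apply: measurable_fun_fubini_tonelli_F.
  - exact: (measurableT_comp (@EFin_measurable _ setT) mfM).
  - by move=> z; rewrite lee_fin -lerBlDr sub0r; have := fM z; rewrite ler_norml => /andP[].
rewrite (_ : EFin \o _ = fubini_F Q (fun z => (f z + M)%:E))//.
apply/funext => x /=; rewrite /fubini_F bintE//; exact: (bmeas_pair1 x bfM).
Qed.

End BoundedTransfer.

Section BoundedProduct.
Context {d d' : measure_display} {X : measurableType d} {Y : measurableType d'}.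
Context {R : realType}.

Lemma bint_prod1 (P : probability X R) (Q : probability Y R) (f : X * Y -> R) :
  bmeas f ->
  (\int[P \x Q]_z (f z)%:E)%E = (\int[P]_x \int[Q]_y f (x, y))%R%:E.
Proof.
move=> bf; rewrite -integral12_prod_meas1//=; last exact: bmeas_prod_integrable.
rewrite -bintE; last exact: bmeas_bint.
by apply: eq_integral => x _; rewrite /fubini_F bintE//; exact: bmeas_pair1.
Qed.

Lemma bint_prod2 (P : probability X R) (Q : probability Y R) (f : X * Y -> R) :
  bmeas f ->
  (\int[P \x Q]_z (f z)%:E)%E = (\int[Q]_y \int[P]_x f (x, y))%R%:E.
Proof.
move=> bf; rewrite -integral21_prod_meas1//=; last exact: bmeas_prod_integrable.
have bf' : bmeas (fun z : Y * X => f (z.2, z.1)).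
  have [mf [M fM]] := bf; split; last by exists M => z.
  apply: (measurableT_comp mf); exact: measurable_fun_pair.
rewrite -bintE; last exact: (bmeas_bint P bf').
by apply: eq_integral => y _; rewrite /fubini_G bintE//; exact: bmeas_pair2.
Qed.

Lemma bint_swap (P : probability X R) (Q : probability Y R) (f : X * Y -> R) :
  bmeas f ->
  (\int[P]_x \int[Q]_y f (x, y) = \int[Q]_y \int[P]_x f (x, y))%R.
Proof. by move=> bf; apply: EFin_inj; rewrite -bint_prod1// bint_prod2. Qed.

End BoundedProduct.

(** The joint law of [(U, V)] and the product of the two laws agree on rectangles, hence everywhere;
    then Fubini applies. *)
Lemma bint_indep {d d1 d2} {T : measurableType d} {X : measurableType d1}
  {Y : measurableType d2} {R : realType} (P : probability T R)
  (U : {mfun T >-> X}) (V : {mfun T >-> Y}) (f : X * Y -> R) :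
  (forall A B, measurable A -> measurable B ->
    P (U @^-1` A `&` V @^-1` B) = (P (U @^-1` A) * P (V @^-1` B))%E) ->
  bmeas f ->
  (\int[P]_w f (U w, V w) = \int[P]_w \int[P]_v f (U w, V v))%R.
Proof.
move=> UV bf.
have mUV : measurable_fun setT (fun w => (U w, V w)) by exact: measurable_fun_pair.
rewrite -(@bint_distribution _ _ _ _ _ P (pack_mfun mUV))//.
apply: EFin_inj; rewrite -bintE//.
rewrite (@eq_measure_integral _ _ _ _
  (distribution P U \x distribution P V)%E); last first.
  move=> A mA _; apply/esym.
  apply: (@product_measure_unique _ _ _ _ _ (distribution P U) (distribution P V)
    (distribution P (pack_mfun mUV))) => // B C mB mC; exact: UV.
rewrite bint_prod1//; congr EFin; rewrite bint_distribution; last exact: bmeas_bint.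
by apply: eq_Rintegral => w _; rewrite bint_distribution//; exact: bmeas_pair1.
Qed.

Lemma prob_bint_cst {d} {X : measurableType d} {R : realType} (P : probability X R) (c : R) :
  (\int[P]_x c)%R = c.
Proof.
have P1 : P setT = 1%E by exact: probability_setT.
by rewrite Rintegral_cst// [X in fine X]P1 mulr1.
Qed.

(** * The real-valued complex norm and integrals of complex functions *)

Section ComplexNorm.
Context {R : realType}.
Implicit Types (z u v : R[i]).

Lemma normc_ge0 z : 0 <= normc z.
Proof. by case: z => a b /=; exact: sqrtr_ge0. Qed.

Lemma normc_norm z : `|z| = (normc z)%:C.
Proof. by []. Qed.

Lemma normcD z u : normc (z + u) <= normc z + normc u.
Proof. by rewrite -lecR rmorphD /=; exact: (ler_normD z u). Qed.

Lemma normcB z u : normc (z - u) <= normc z + normc u.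
Proof. by rewrite -lecR rmorphD /=; exact: (ler_normB z u). Qed.

Lemma normcBC z u : normc (z - u) = normc (u - z).
Proof. by apply: complexI; rewrite -!normc_norm distrC. Qed.

Lemma normcX z n : normc (z ^+ n) = normc z ^+ n.
Proof. by apply: complexI; rewrite rmorphXn -!normc_norm normrX. Qed.

Lemma normc_eq0 z : (normc z == 0) = (z == 0).
Proof. by rewrite -(inj_eq (@complexI R)) -normc_norm normr_eq0. Qed.

Lemma normc_real (x : R) : normc x%:C = `|x|.
Proof. by rewrite /= expr0n addr0 sqrtr_sqr. Qed.

Lemma Re_le_normc z : `|Re z| <= normc z.
Proof. by rewrite -lecR; exact: normc_ge_Re. Qed.

Lemma Im_le_normc z : `|Im z| <= normc z.
Proof.
case: z => a b /=; rewrite -sqrtr_sqr; apply: ler_wsqrtr.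
by rewrite lerDr sqr_ge0.
Qed.

Lemma normc_le_ReIm z : normc z <= `|Re z| + `|Im z|.
Proof.
case: z => a b /=; rewrite -[leRHS]ger0_norm ?addr_ge0// -sqrtr_sqr.
apply: ler_wsqrtr; rewrite sqrrD !real_normK ?num_real//.
by rewrite addrAC lerDl mulrn_wge0// mulr_ge0.
Qed.

Lemma ReM u v : Re (u * v) = Re u * Re v - Im u * Im v.
Proof. by case: u v => [a b] [c d]. Qed.

Lemma ImM u v : Im (u * v) = Re u * Im v + Im u * Re v.
Proof. by case: u v => [a b] [c d]. Qed.

Lemma complex_eq z u : Re z = Re u -> Im z = Im u -> z = u.
Proof. by case: z u => [a b] [c d] /= -> ->. Qed.

Lemma normc_small_eq0 z : (forall e : R, 0 < e -> normc z <= e) -> z = 0.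
Proof.
move=> ze; apply/eqP; rewrite -normc_eq0 eq_le normc_ge0 andbT.
by apply/ler_addgt0Pr => e e0; rewrite add0r ze.
Qed.

End ComplexNorm.

Section ComplexIntegral.
Context {d : measure_display} {X : measurableType d} {R : realType}.
Implicit Types (f g : X -> R[i]).

Definition cbmeas f := bmeas (fun x => complex.Re (f x)) /\
  bmeas (fun x => complex.Im (f x)).

(** The shape repeats that of [stieltjes], so that [Phi m 1] below is the Stieltjes transform by
    conversion. *)
Definition cint (m : {measure set X -> \bar R}) f : R[i] :=
  (\int[m]_x complex.Re (f x))%R +i* (\int[m]_x complex.Im (f x))%R.

Lemma cbmeas_cst (c : R[i]) : cbmeas (fun=> c).
Proof. by split; exact: bmeas_cst. Qed.

Lemma cbmeasD f g : cbmeas f -> cbmeas g -> cbmeas (fun x => f x + g x).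
Proof.
move=> [rf jf] [rg jg]; split.
- rewrite (_ : (fun _ => _) = (fun x => Re (f x) + Re (g x))); first exact: bmeasD.
  by apply/funext => x; rewrite raddfD.
- rewrite (_ : (fun _ => _) = (fun x => Im (f x) + Im (g x))); first exact: bmeasD.
  by apply/funext => x; rewrite raddfD.
Qed.

Lemma cbmeasM f g : cbmeas f -> cbmeas g -> cbmeas (fun x => f x * g x).
Proof.
move=> [rf jf] [rg jg]; split.
- under eq_fun do rewrite ReM.
  by apply: bmeasB; exact: bmeasM.
- under eq_fun do rewrite ImM.
  by apply: bmeasD; exact: bmeasM.
Qed.

Lemma cbmeasN f : cbmeas f -> cbmeas (fun x => - f x).
Proof.
move=> bf; rewrite (_ : (fun _ => _) = (fun x => (-1) * f x)); last first.
  by apply/funext => x; rewrite mulN1r.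
by apply: cbmeasM => //; exact: cbmeas_cst.
Qed.

Lemma cbmeasB f g : cbmeas f -> cbmeas g -> cbmeas (fun x => f x - g x).
Proof. by move=> bf bg; apply: cbmeasD => //; exact: cbmeasN. Qed.

Lemma cbmeasX f n : cbmeas f -> cbmeas (fun x => f x ^+ n).
Proof.
move=> bf; elim: n => [|n IH]; first exact: cbmeas_cst.
by under eq_fun do rewrite exprS; exact: cbmeasM.
Qed.

Variable m : {finite_measure set X -> \bar R}.

Lemma cintD f g : cbmeas f -> cbmeas g ->
  cint m (fun x => f x + g x) = cint m f + cint m g.
Proof.
move=> [rf jf] [rg jg]; apply: complex_eq => /=.
- by rewrite -bintD//; apply: eq_Rintegral => x _; rewrite raddfD.
- by rewrite -bintD//; apply: eq_Rintegral => x _; rewrite raddfD.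
Qed.

Lemma cintZl (c : R[i]) f : cbmeas f -> cint m (fun x => c * f x) = c * cint m f.
Proof.
move=> [rf jf]; apply: complex_eq; rewrite ?ReM ?ImM /=.
- rewrite -!bintZ// -bintB; [|by apply: bmeasM => //; exact: bmeas_cst..].
  by apply: eq_Rintegral => x _; rewrite ReM.
- rewrite -!bintZ// -bintD; [|by apply: bmeasM => //; exact: bmeas_cst..].
  by apply: eq_Rintegral => x _; rewrite ImM.
Qed.

Lemma cintB f g : cbmeas f -> cbmeas g ->
  cint m (fun x => f x - g x) = cint m f - cint m g.
Proof.
move=> bf bg; rewrite -[X in _ + X]mulN1r -cintZl// -cintD//; last first.
  by apply: cbmeasM => //; exact: cbmeas_cst.
by congr cint; apply/funext => x; rewrite mulN1r.
Qed.

(** The factor 2 comes from bounding the real and the imaginary part separately by M. *)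
Lemma cint_norm_le f (M : R) : cbmeas f -> (forall x, normc (f x) <= M) ->
  normc (cint m f) <= 2 * (M * fine (m setT)).
Proof.
move=> [rf jf] fM; rewrite (le_trans (normc_le_ReIm _))//= mulr_natl mulr2n lerD//.
- apply: bint_norm_le => [|x]; first exact: bmeas_measurable.
  by rewrite (le_trans (Re_le_normc _)).
- apply: bint_norm_le => [|x]; first exact: bmeas_measurable.
  by rewrite (le_trans (Im_le_normc _)).
Qed.

End ComplexIntegral.

Lemma eq_cint {d} {X : measurableType d} {R : realType}
  (m : {measure set X -> \bar R}) (f g : X -> R[i]) : f =1 g ->
  cint m f = cint m g.
Proof. by move=> /funext ->. Qed.

Lemma cint_eq_law {d} {X : measurableType d} {R : realType}
  (m1 m2 : {measure set X -> \bar R}) (f : X -> R[i]) : eq_law m1 m2 ->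
  cint m1 f = cint m2 f.
Proof. by move=> m12; rewrite /cint !(bint_eq_law _ m12). Qed.

(** * Powers of the kernel 1/(w - z), their integrals and the derivatives of the Stieltjes
    transform *)

Section CauchyKernel.
Context {R : realType}.
Implicit Types (z h : R[i]) (w q : R).

Definition cker z w : R[i] := (w%:C - z)^-1.

Lemma cker_den_neq0 z w : 0 < Im z -> w%:C - z != 0.
Proof.
case: z => p q /= q0; apply/eqP => /(congr1 (@complex.Im R)) /= /eqP.
by rewrite add0r oppr_eq0 gt_eqF.
Qed.

Lemma Re_cker z w : Re (cker z w) = (w - Re z) / ((w - Re z) ^+ 2 + Im z ^+ 2).
Proof. by case: z => p q; rewrite /cker /= add0r sqrrN. Qed.

Lemma Im_cker z w : Im (cker z w) = Im z / ((w - Re z) ^+ 2 + Im z ^+ 2).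
Proof. by case: z => p q; rewrite /cker /= add0r sqrrN mulNr opprK. Qed.

Lemma normc_ckerV z w : normc (cker z w) = (normc (w%:C - z))^-1.
Proof. exact: ComplexField.Normc.normcV. Qed.

Lemma Im_le_dist z w : 0 < Im z -> Im z <= normc (w%:C - z).
Proof.
move=> z0; rewrite (le_trans _ (Im_le_normc _))//.
by case: z z0 => p q /= q0; rewrite add0r normrN gtr0_norm.
Qed.

Lemma normc_cker z w : 0 < Im z -> normc (cker z w) <= (Im z)^-1.
Proof.
move=> z0; rewrite normc_ckerV lef_pV2 ?posrE ?Im_le_dist//.
by rewrite (lt_le_trans z0)// Im_le_dist.
Qed.

Lemma normc_cker_le z w q : 0 < q -> q <= Im z -> normc (cker z w) <= q^-1.
Proof.
move=> q0 qz; have z0 := lt_le_trans q0 qz.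
by rewrite (le_trans (normc_cker _ z0))// lef_pV2.
Qed.

Lemma cker_den_gt0 z w : 0 < Im z -> 0 < (w - Re z) ^+ 2 + Im z ^+ 2.
Proof. by move=> z0; rewrite ltr_wpDl ?sqr_ge0// exprn_gt0. Qed.

Lemma continuous_Re_cker z : 0 < Im z -> continuous (fun w : R => Re (cker z w)).
Proof.
move=> z0 w; under eq_fun do rewrite Re_cker expr2.
apply: cvgM; first by apply: cvgB; [exact: cvg_id|exact: cvg_cst].
apply: cvgV; first by rewrite -expr2 gt_eqF// cker_den_gt0.
apply: cvgD; last exact: cvg_cst.
by apply: cvgM; apply: cvgB; [exact: cvg_id|exact: cvg_cst|exact: cvg_id|exact: cvg_cst].
Qed.

Lemma continuous_Im_cker z : 0 < Im z -> continuous (fun w : R => Im (cker z w)).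
Proof.
move=> z0 w; under eq_fun do rewrite Im_cker expr2.
apply: cvgM; first exact: cvg_cst.
apply: cvgV; first by rewrite -expr2 gt_eqF// cker_den_gt0.
apply: cvgD; last exact: cvg_cst.
by apply: cvgM; apply: cvgB; [exact: cvg_id|exact: cvg_cst|exact: cvg_id|exact: cvg_cst].
Qed.

Lemma cbmeas_cker z : 0 < Im z -> cbmeas (cker z : measurableTypeR R -> R[i]).
Proof.
move=> z0; split; split.
- exact: continuous_measurable_fun (continuous_Re_cker z0).
- by exists (Im z)^-1 => w; rewrite (le_trans (Re_le_normc _))// normc_cker.
- exact: continuous_measurable_fun (continuous_Im_cker z0).
- by exists (Im z)^-1 => w; rewrite (le_trans (Im_le_normc _))// normc_cker.
Qed.

Lemma cker_resolvent z h w : 0 < Im z -> 0 < Im (z + h) ->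
  cker (z + h) w - cker z w = h * cker z w * cker (z + h) w.
Proof.
move=> z0 zh0; have := cker_den_neq0 w z0; have := cker_den_neq0 w zh0.
rewrite /cker => nzh nz; field; first by rewrite nz; move: nzh; rewrite opprD addrA => ->.
Qed.

(** M does not depend on w, so the estimate survives integration; it is uniform on a half-plane, so
    it can be summed along a segment. The induction on k rests on the resolvent identity b - a = h a
    b. *)
Lemma ckerX_taylor (q : R) (k : nat) : 0 < q -> exists2 M : R, 0 <= M &
  forall z h w, q <= Im z -> q <= Im (z + h) ->
  normc (cker (z + h) w ^+ k - cker z w ^+ k - h * (k%:R * cker z w ^+ k.+1))
    <= M * normc h ^+ 2.
Proof.
move=> q0; elim: k => [|k [M M0 IH]].
  exists 0 => // z h w _ _; rewrite !expr0 subrr mul0r mulr0 subrr mul0r.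
  by rewrite ComplexField.Normc.normc0.
exists (q^-1 * M + k.+1%:R * q^-1 ^+ k.+3) => [|z h w qz qzh].
  by rewrite addr_ge0// mulr_ge0// ?invr_ge0 ?exprn_ge0 ?invr_ge0 ?(ltW q0).
have z0 := lt_le_trans q0 qz; have zh0 := lt_le_trans q0 qzh.
set a := cker z w; set b := cker (z + h) w.
have -> : b ^+ k.+1 - a ^+ k.+1 - h * (k.+1%:R * a ^+ k.+2) =
  b * (b ^+ k - a ^+ k - h * (k%:R * a ^+ k.+1)) +
  h ^+ 2 * (k.+1%:R * (a ^+ k.+2 * b)).
  have D0 : b - a - h * a * b = 0 by rewrite cker_resolvent// subrr.
  (* The two sides differ by (a^k + (k+1) h a^(k+1)) (b - a - h a b). *)
  apply/eqP; rewrite -subr_eq0; apply/eqP.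
  rewrite -[RHS](mulr0 (a ^+ k + k.+1%:R * h * a ^+ k.+1)) -D0 -natr1 !exprS.
  by ring.
rewrite (le_trans (normcD _ _))// [leRHS]mulrDl lerD//.
  rewrite ComplexField.Normc.normcM -mulrA ler_pM ?normc_ge0 ?normc_cker_le//.
  exact: IH.
rewrite ComplexField.Normc.normcM normcX mulrC ler_wpM2r ?exprn_ge0 ?normc_ge0//.
rewrite ComplexField.Normc.normcM -[k.+1%:R]/(k.+1%:R) (_ : normc k.+1%:R = k.+1%:R); last first.
  by rewrite -(rmorph_nat (real_complex R)) normc_real ger0_norm.
rewrite ler_wpM2l// ComplexField.Normc.normcM normcX [q^-1 ^+ k.+3]exprSr.
rewrite ler_pM ?exprn_ge0 ?normc_ge0 ?normc_cker_le//.
by rewrite lerXn2r ?nnegrE ?normc_ge0 ?invr_ge0 ?(ltW q0)// normc_cker_le.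
Qed.

End CauchyKernel.

Section StieltjesPowers.
Context {R : realType} (m : {finite_measure set (measurableTypeR R) -> \bar R}).
Implicit Types (z h : R[i]).

Definition Phi (k : nat) z : R[i] := cint m (fun w : measurableTypeR R => cker z w ^+ k).

Lemma cbmeas_ckerX z k : 0 < Im z ->
  cbmeas (fun w : measurableTypeR R => cker z w ^+ k).
Proof. by move=> z0; apply: cbmeasX; exact: cbmeas_cker. Qed.

Lemma Phi_norm k z (q : R) : 0 < q -> q <= Im z ->
  normc (Phi k z) <= 2 * (q^-1 ^+ k * fine (m setT)).
Proof.
move=> q0 qz; have z0 := lt_le_trans q0 qz; apply: cint_norm_le => [|w].
  exact: cbmeas_ckerX.
by rewrite normcX lerXn2r ?nnegrE ?normc_ge0 ?invr_ge0 ?(ltW q0)// normc_cker_le.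
Qed.

(** Differentiation under the integral sign, Phi_k' = k Phi_(k+1), in quantitative form. *)
Lemma Phi_taylor (q : R) (k : nat) : 0 < q -> exists2 M : R, 0 <= M &
  forall z h, q <= Im z -> q <= Im (z + h) ->
  normc (Phi k (z + h) - Phi k z - h * (k%:R * Phi k.+1 z)) <= M * normc h ^+ 2.
Proof.
move=> q0; have [M M0 HM] := ckerX_taylor k q0.
exists (2 * (M * fine (m setT))) => [|z h qz qzh].
  by rewrite !mulr_ge0// fine_ge0.
have z0 := lt_le_trans q0 qz; have zh0 := lt_le_trans q0 qzh.
have bz j := cbmeas_ckerX j z0; have bzh j := cbmeas_ckerX j zh0.
have bk : cbmeas (fun w : measurableTypeR R => k%:R * cker z w ^+ k.+1).
  by apply: cbmeasM => //; exact: cbmeas_cst.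
rewrite /Phi -cintZl// -cintB// -cintZl// -cintB//; last 2 first.
- exact: cbmeasB.
- by apply: cbmeasM => //; exact: cbmeas_cst.
have -> : 2 * (M * fine (m setT)) * normc h ^+ 2 =
  2 * (M * normc h ^+ 2 * fine (m setT)) by ring.
apply: cint_norm_le => [|w]; last exact: HM.
apply: cbmeasB; first exact: cbmeasB.
by apply: cbmeasM => //; exact: cbmeas_cst.
Qed.

End StieltjesPowers.

Section QuadraticIncrements.
Context {R : realType}.
Implicit Types (z u h : R[i]) (S : set R[i]).

Definition segment_closed S := forall z u (t : R), S z -> S u -> 0 <= t <= 1 ->
  S (z + t%:C * (u - z)).

(* Splitting the segment from z to u into N pieces bounds the increment of G
   by M |u - z|^2 / N. *)
Lemma quadratic_increments_cst S (G : R[i] -> R[i]) (M : R) :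
  segment_closed S ->
  (forall z h, S z -> S (z + h) -> normc (G (z + h) - G z) <= M * normc h ^+ 2) ->
  forall z u, S z -> S u -> G z = G u.
Proof.
move=> Sseg HM z u Sz Su; apply/eqP; rewrite -subr_eq0; apply/eqP.
set L := normc (u - z).
have key (N : nat) : (0 < N)%N -> normc (G z - G u) <= M * L ^+ 2 / N%:R.
  move=> N0; pose dl := (N%:R^-1 : R)%:C * (u - z).
  have N0' : (N%:R : R) != 0 by rewrite pnatr_eq0 -lt0n.
  have pt j : (j <= N)%N -> S (z + j%:R * dl).
    move=> jN; rewrite /dl mulrA -(rmorph_nat (real_complex R)) -rmorphM.
    apply: Sseg => //; rewrite mulr_ge0//= -(@ler_pM2r _ N%:R) ?ltr0n//.
    by rewrite mulfVK// mul1r ler_nat.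
  have step j : (j <= N)%N -> normc (G (z + j%:R * dl) - G z) <= j%:R * (M * normc dl ^+ 2).
    elim: j => [_|j IH jN]; first by rewrite !mul0r addr0 subrr ComplexField.Normc.normc0.
    have -> : G (z + j.+1%:R * dl) - G z =
      (G (z + j%:R * dl + dl) - G (z + j%:R * dl)) + (G (z + j%:R * dl) - G z).
      by rewrite addrA subrK -natr1 mulrDl mul1r addrA.
    rewrite (le_trans (normcD _ _))// -natr1 mulrDl mul1r addrC lerD//.
      by apply: IH; exact: ltnW.
    apply: HM; first by apply: pt; exact: ltnW.
    by have := pt _ jN; rewrite -natr1 mulrDl mul1r addrA.
  have := step N (leqnn N).
  have -> : N%:R * dl = u - z.
    rewrite /dl mulrA -(rmorph_nat (real_complex R)) -rmorphM /= divff//.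
    by rewrite mul1r.
  rewrite [z + _]addrC subrK normcBC => /le_trans; apply.
  rewrite /dl ComplexField.Normc.normcM normc_real ger0_norm// -/L.
  by rewrite exprMn le_eqVlt; apply/orP; left; apply/eqP; field.
apply: normc_small_eq0 => e e0.
have [ML|ML] := leP (M * L ^+ 2) 0.
  by rewrite (le_trans (key 1%N isT))// divr1 (le_trans ML)// ltW.
have xN := archi_boundP (ltW (divr_gt0 ML e0)); set N := Num.bound _ in xN.
have N0 : (0 < N%:R :> R) by rewrite (lt_trans _ xN)// divr_gt0.
have N0' : (0 < N)%N by rewrite -(ltr0n R).
rewrite (le_trans (key N N0'))//.
by rewrite ler_pdivrMr// [e * _]mulrC -ler_pdivrMr// ltW.
Qed.

End QuadraticIncrements.

Section StieltjesDerivative.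
Context {R : realType} (m : probability (measurableTypeR R) R).
Implicit Types (z h : R[i]).

Lemma segment_closed_Im (q : R) : segment_closed [set z : R[i] | q <= Im z].
Proof.
move=> [p1 q1] [p2 q2] t /= z1 z2 /andP[t0 t1].
rewrite mul0r addr0.
have -> : q1 + t * (q2 - q1) = (1 - t) * q1 + t * q2 by ring.
have -> : q = (1 - t) * q + t * q by ring.
by rewrite lerD// ler_wpM2l// subr_ge0.
Qed.

(** It is enough that f and g agree on the open upper half-plane, where the iterated derivatives
    have their closed form. For |h| <= Im z / 2 the point z + h stays in the half-plane on which the
    remainder is controlled. *)
Lemma derive1_taylor (f g : R[i] -> R[i]) z (df : R[i]) (M : R) :
  0 < Im z ->
  (forall u, 0 < Im u -> f u = g u) ->
  (forall h, Im z / 2 <= Im (z + h) ->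
    normc (g (z + h) - g z - h * df) <= M * normc h ^+ 2) ->
  @derive1 (R[i] : numFieldType) (R[i] : numFieldType) f z = df.
Proof.
move=> z0 fg HM; apply: cvg_lim => //.
apply/cvgrPdist_le => e e0.
have [e' ee'] : exists e' : R, e = e'%:C.
  by exists (Re e); rewrite RRe_real// gtr0_real.
have e'0 : 0 < e' by rewrite -ltcR -ee'.
have M1 : 0 < `|M| + 1 by rewrite ltr_wpDl.
near=> h.
have h0 : h != 0 by near: h; exact: nbhs_dnbhs_neq.
have hq : normc h <= Im z / 2.
  rewrite -lecR -normc_norm; near: h; apply: dnbhs0_le.
  by rewrite ltcR divr_gt0.
have he : normc h <= e' / (`|M| + 1).
  rewrite -lecR -normc_norm; near: h; apply: dnbhs0_le.
  by rewrite ltcR divr_gt0.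
have qzh : Im z / 2 <= Im (z + h).
  rewrite raddfD /=; have := le_trans (Im_le_normc h) hq.
  rewrite ler_norml => /andP[+ _]; lra.
have zh0 : 0 < Im (z + h) by rewrite (lt_le_trans _ qzh)// divr_gt0.
rewrite [h + z]addrC !fg//.
have -> : df - h^-1 *: (g (z + h) - g z) = - h^-1 * (g (z + h) - g z - h * df).
  by rewrite /GRing.scale /=; field.
rewrite ee' normrM normrN normfV !normc_norm -fmorphV -rmorphM lecR.
have nh0 : 0 < normc h by rewrite lt_neqAle eq_sym normc_eq0 h0 normc_ge0.
rewrite ler_pdivrMl// (le_trans (HM _ qzh))//.
rewrite expr2 mulrCA ler_wpM2l ?normc_ge0//.
rewrite ler_pdivlMr// in he; rewrite mulrC (le_trans _ he)// ler_wpM2l ?normc_ge0//.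
by rewrite (le_trans (ler_norm M))// lerDl.
Unshelve. all: by end_near. Qed.

Lemma stieltjesE z : stieltjes m z = Phi m 1 z.
Proof. by []. Qed.

Lemma stieltjes_nE (k : nat) z : 0 < Im z ->
  stieltjes_n m k z = k`!%:R * Phi m k.+1 z.
Proof.
elim: k z => [z _|k IH z z0]; first by rewrite mul1r.
have [M M0 HM] := Phi_taylor m k.+1 (divr_gt0 z0 (ltr0n _ 2)).
rewrite /stieltjes_n derive1nS.
apply: (derive1_taylor (g := fun u => k`!%:R * Phi m k.+1 u)
  (M := k`!%:R * M)) => // h qzh.
have -> : k`!%:R * Phi m k.+1 (z + h) - k`!%:R * Phi m k.+1 z -
   h * (k.+1`!%:R * Phi m k.+2 z) =
  k`!%:R * (Phi m k.+1 (z + h) - Phi m k.+1 z - h * (k.+1%:R * Phi m k.+2 z)).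
  rewrite factS natrM.
  move: (Phi m k.+1 _) (Phi m k.+1 z) (Phi m k.+2 z) (_`!%:R) (_.+1%:R) => a b c r s.
  by ring.
rewrite ComplexField.Normc.normcM -mulrA.
rewrite -(rmorph_nat (real_complex R)) normc_real ger0_norm// ler_wpM2l//.
apply: HM => //; move: z0; lra.
Qed.

End StieltjesDerivative.

(** * Poisson integrals determine a finite measure *)

Section FTCEverywhere.
Context {R : realType}.
Implicit Types (f F : R -> R).

Lemma is_derive_continuous F x (df : R) : is_derive x (1 : R) F df -> {for x, continuous F}.
Proof. by move=> [dF _]; apply/differentiable_continuous/derivable1_diffP. Qed.

Lemma FTC_everywhere f F (a b : R) : a < b -> continuous f ->
  (forall x, is_derive x (1 : R) F (f x)) ->
  (\int[@lebesgue_measure R]_(x in `[a, b]) (f x)%:E = (F b - F a)%:E)%E.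
Proof.
move=> ab cf dF; rewrite (@continuous_FTC2 _ f F)// ?EFinB//.
- exact: continuous_subspaceT.
- have cF x : {for x, continuous F} by exact: is_derive_continuous (dF x).
  split; first by move=> x _; have [] := dF x.
  + exact/cvg_at_right_filter/cF.
  + exact/cvg_at_left_filter/cF.
- by move=> x _; rewrite derive1E; have [_ ->] := dF x.
Qed.

Lemma is_derive_atan_affine (w q x : R) : 0 < q ->
  is_derive x (1 : R) (fun p => atan ((p - w) / q)) (q / ((w - x) ^+ 2 + q ^+ 2)).
Proof.
move=> q0.
have D : is_derive x (1 : R) (fun p => (p - w) / q) q^-1.
  have -> : (fun p => (p - w) / q) = (fun p : R => q^-1 *: p - w / q).
    by apply/funext => p; rewrite mulrBl mulrC.
  by apply: is_derive_eq; rewrite subr0 -[RHS]mulr1.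
have C := @is_derive1_comp R atan _ x _ _ (is_derive1_atan ((x - w) / q)) D.
apply: (is_derive_eq C).
by field; rewrite !gt_eqF ?ltr_wpDl ?sqr_ge0 ?exprn_gt0//.
Qed.

(** The offset 1/(k+1) is small but large compared with the height 1/(k+1)^2: at w = b the argument
    is k+1 and still tends to infinity. So the limit has no halfway value at the jump, which suits
    intervals open on the left and closed on the right. *)
Lemma cvg_atan_step (b w : R) :
  (fun k => atan ((b + k.+1%:R^-1 - w) / k.+1%:R ^- 2)) @ \oo -->
  (if w <= b then pi / 2 else - (pi / 2) : R).
Proof.
have argE k : (b + k.+1%:R^-1 - w) / k.+1%:R ^- 2 =
    (b - w) * k.+1%:R ^+ 2 + k.+1%:R :> R by field.
have [wb|bw] := leP w b.
- apply: (@cvg_comp _ _ _ (fun k => (b + k.+1%:R^-1 - w) / k.+1%:R ^- 2)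
    atan \oo (+oo)); last exact: cvgy_atan.
  apply/cvgryPge => A; near=> k; rewrite argE.
  have : A <= k%:R by near: k; exact: nbhs_infty_ger.
  have : 0 <= (b - w) * k.+1%:R ^+ 2 by rewrite mulr_ge0 ?subr_ge0// sqr_ge0.
  by rewrite -natr1; lra.
- rewrite (_ : (fun k => _) =
    (fun k => - atan (- ((b + k.+1%:R^-1 - w) / k.+1%:R ^- 2)))); last first.
    by apply/funext => k; rewrite atanN opprK.
  apply: cvgN.
  apply: (@cvg_comp _ _ _ (fun k => - ((b + k.+1%:R^-1 - w) / k.+1%:R ^- 2))
    atan \oo (+oo)); last exact: cvgy_atan.
  apply/cvgryPge => A; near=> k; rewrite argE.
  have A1 : A <= k%:R by near: k; exact: nbhs_infty_ger.
  (* From here on (w - b)(k+1) >= 2, so minus the argument, (k+1)((w - b)(k+1) - 1), is at least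
     k+1. *)
  have : 2 / (w - b) <= k%:R by near: k; exact: nbhs_infty_ger.
  rewrite ler_pdivrMr ?subr_gt0// => k2.
  have k0 : 0 <= k%:R :> R by [].
  by rewrite -natr1; nra.
Unshelve. all: by end_near. Qed.

End FTCEverywhere.

Section PoissonUniqueness.
Context {R : realType}.
Local Notation leb := (@lebesgue_measure R).

Lemma measurable_Im_cker2 (q : R) : 0 < q ->
  measurable_fun setT (fun z : measurableTypeR R * measurableTypeR R =>
    Im (cker ((z.2 : R) +i* q) z.1)).
Proof.
move=> q0.
have mc : measurable_fun setT (fun x : measurableTypeR R => Im (cker (0 +i* q) x)).
  exact: continuous_measurable_fun (continuous_Im_cker (z := 0 +i* q) q0).
have md : measurable_fun setT (fun z : measurableTypeR R * measurableTypeR R =>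
    (z.1 : R) - z.2 : measurableTypeR R).
  by apply: measurable_funB; [exact: measurable_fst|exact: measurable_snd].
rewrite (_ : (fun _ => _) = (fun x => Im (cker (0 +i* q) x)) \o
  (fun z : measurableTypeR R * measurableTypeR R => (z.1 : R) - z.2)).
  exact: measurableT_comp.
by apply/funext => z; rewrite /comp !Im_cker /= subr0.
Qed.

Variable m : {finite_measure set (measurableTypeR R) -> \bar R}.

(** Tonelli: the atan difference is the integral of the Poisson kernel over the centres p in
    [a, b]. *)
Lemma integral_poisson (a b q : R) : 0 < q -> a < b ->
  (\int[m]_w (atan ((b - w) / q) - atan ((a - w) / q))%:E =
   \int[leb]_(p in `[a, b]) \int[m]_w (Im (cker (p +i* q) w))%:E)%E.
Proof.
move=> q0 ab.
transitivity (\int[m]_w \int[leb]_p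
    ((Im (cker (p +i* q) w) * \1_`[a, b] p)%:E))%E.
  apply: eq_integral => w _.
  have cf : continuous (fun p : R => Im (cker (p +i* q) w)).
    move=> x; rewrite (_ : (fun _ => _) = fun p => q / ((w - p) ^+ 2 + q ^+ 2)); last first.
      by apply/funext => p; rewrite Im_cker.
    apply: cvgM; first exact: cvg_cst.
    apply: cvgV; first by rewrite gt_eqF// ltr_wpDl ?sqr_ge0// exprn_gt0.
    apply: cvgD; last exact: cvg_cst.
    rewrite expr2; under eq_fun do rewrite expr2.
    by apply: cvgM; apply: cvgB; [exact: cvg_cst|exact: cvg_id|exact: cvg_cst|exact: cvg_id].
  have dF (x : R) : is_derive x (1 : R) (fun p => atan ((p - w) / q)) (Im (cker (x +i* q) w)).
    by rewrite Im_cker; exact: is_derive_atan_affine.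
  rewrite -(FTC_everywhere ab cf dF).
  rewrite integral_mkcond; apply: eq_integral => p _.
  by rewrite patchE indicE; case: ifPn => _; rewrite ?mulr1 ?mulr0.
pose f (z : measurableTypeR R * measurableTypeR R) : \bar R :=
  (Im (cker (z.2 +i* q) z.1) * \1_`[a, b] z.2)%:E.
have mf : measurable_fun setT f.
  apply/measurable_EFinP; apply: measurable_funM; first exact: measurable_Im_cker2.
  have mi : measurable_fun setT (\1_`[a, b] : measurableTypeR R -> R).
    exact: measurable_indic.
  exact: (measurableT_comp mi measurable_snd).
have f0 z : (0 <= f z)%E.
  case: z => w p; rewrite lee_fin mulr_ge0// Im_cker/= divr_ge0 ?addr_ge0 ?sqr_ge0//.
  exact: ltW.
transitivity (\int[leb]_p \int[m]_w f (w, p))%E.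
  exact: (fubini_tonelli (m1 := m) (m2 := leb) f mf f0).
rewrite [RHS]integral_mkcond; apply: eq_integral => p _.
rewrite patchE /f /= indicE; case: ifPn => _.
  by apply: eq_integral => w _; rewrite mulr1.
by apply: integral0_eq => w _; rewrite mulr0.
Qed.

End PoissonUniqueness.

(** Stieltjes inversion. The Poisson kernels at height (k+1)^-2, integrated over their centres
    between a + 1/(k+1) and b + 1/(k+1), tend boundedly to pi times the indicator of ]a, b]. Thus
    the two measures agree on half-open intervals, which form a generating class stable under
    intersection. *)
Lemma poisson_unique {R : realType}
  (m1 m2 : {finite_measure set (measurableTypeR R) -> \bar R}) :
  (forall p q : R, 0 < q ->
    (\int[m1]_w Im (cker (p +i* q) w) = \int[m2]_w Im (cker (p +i* q) w))%R) ->
  eq_law m1 m2.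
Proof.
move=> m12.
pose u (a b : R) (k : nat) (w : measurableTypeR R) : R :=
  atan ((b + k.+1%:R^-1 - w) / k.+1%:R ^- 2)
  - atan ((a + k.+1%:R^-1 - w) / k.+1%:R ^- 2).
have mu_ (a b : R) k : measurable_fun setT (u a b k).
  have cat (c e : R) : measurable_fun setT (fun w : measurableTypeR R => atan ((c - w) / e)).
    apply: continuous_measurable_fun => w.
    apply: (continuous_comp (f := fun w : R => (c - w) / e)); last exact: continuous_atan.
    by apply: cvgM; [apply: cvgB; [exact: cvg_cst|exact: cvg_id]|exact: cvg_cst].
  exact: measurable_funB.
have uM (a b : R) k w : `|u a b k w| <= pi.
  rewrite /u; set x := _ / _; set y := _ / _.
  have := atan_ltpi2 x; have := atan_gtNpi2 x; have := atan_ltpi2 y; have := atan_gtNpi2 y.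
  by rewrite ler_norml; lra.
have ulim (a b : R) (m : {finite_measure set (measurableTypeR R) -> \bar R}) : a < b ->
    (fun k => \int[m]_w u a b k w)%R @ \oo --> pi * fine (m `]a, b]%classic).
  move=> ab.
  have -> : pi * fine (m `]a, b]%classic) = (\int[m]_w (pi * \1_`]a, b] w))%R.
    rewrite bintZ; last exact: bmeas_indic.
    by rewrite /Rintegral integral_indic// setIT.
  apply: (@bint_cvg _ _ _ m (u a b) _ pi) => //.
    by apply: measurable_funM => //; exact: measurable_indic.
  apply: aeW => w.
  have -> : pi * \1_`]a, b] w =
     (if w <= b then pi / 2 else - (pi / 2) : R) - (if w <= a then pi / 2 else - (pi / 2) : R).
    rewrite indicE mem_setE in_itv /=.
    have [aw|wa] := ltP a w; have [wb|bw] := leP w b => /=; try lra.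
  by apply: cvgB; exact: cvg_atan_step.
have oc (a b : R) : m1 `]a, b]%classic = m2 `]a, b]%classic.
  have [ab|ba] := ltP a b; last by rewrite set_itv_ge ?measure0 ?bnd_simp -?leNgt.
  have E : (fun k => \int[m1]_w u a b k w)%R = (fun k => \int[m2]_w u a b k w)%R.
    apply/funext => k; apply: EFin_inj; rewrite -!bintE; last 2 first.
    - by split => //; exists pi.
    - by split => //; exists pi.
    have k0 : 0 < k.+1%:R ^- 2 :> R by rewrite invr_gt0 exprn_gt0.
    rewrite /u !integral_poisson ?ltrD2r//; apply: eq_integral => p _.
    rewrite !bintE; first by rewrite m12.
      by have [] := @cbmeas_cker R (p +i* k.+1%:R ^- 2) k0.
    by have [] := @cbmeas_cker R (p +i* k.+1%:R ^- 2) k0.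
  have := ulim a b m1 ab; rewrite E => l1; have l2 := ulim a b m2 ab.
  have e : pi * fine (m1 `]a, b]%classic) = pi * fine (m2 `]a, b]%classic).
    by rewrite -(cvg_lim (@Rhausdorff R) l1) -(cvg_lim (@Rhausdorff R) l2).
  have e2 := mulfI (lt0r_neq0 (pi_gt0 R)) e.
  by rewrite -[LHS]fineK ?fin_num_measure// e2 fineK// fin_num_measure.
move=> A mA; apply: (@measure_unique _ _ (measurableTypeR R) (@ocitv R) (fun k => `](- k%:R), k%:R]%classic)) => //.
- exact: ocitvI.
- by move=> k; exact: is_ocitv.
- apply/seteqP; split => // x _; exists (Num.bound `|x|) => //=.
  have xb := archi_boundP (normr_ge0 x).
  rewrite in_itv /=; move: xb; rewrite ltr_norml => /andP[-> /ltW ->] //.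
- by move=> C [[a b] _ <-]; exact: oc.
- by move=> k; rewrite -ge0_fin_numE// fin_num_measure.
Qed.

(** * Measures with a density, and the Stieltjes transform of a Cauchy law *)

Lemma density_exists {d} {X : measurableType d} {R : realType}
  (m : {sigma_finite_measure set X -> \bar R}) (F : X -> R) :
  measurable_fun setT F -> (forall x, 0 <= F x) ->
  m.-integrable setT (EFin \o F) ->
  exists nu : {finite_measure set X -> \bar R},
    (forall A, nu A = \int[m]_(x in A) (F x)%:E)%E /\
    (forall f, bmeas f -> (\int[nu]_x f x = \int[m]_x (f x * F x))%R).
Proof.
move=> mF F0 iF.
pose nu0 (A : set X) : \bar R := (\int[m]_(x in A) (F x)%:E)%E.
have nu00 : nu0 set0 = 0%E by rewrite /nu0 integral_set0.
have nu0_ge0 A : (0 <= nu0 A)%E by apply: integral_ge0 => x _; rewrite lee_fin.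
have nu0_sa : semi_sigma_additive nu0.
  move=> A mA tA mUA; rewrite /nu0 integral_bigcup//=; last first.
    by apply: (integrableS _ _ (subsetT _)) => //; exact: iF.
  apply: is_cvg_ereal_nneg_natsum_cond => n _ _.
  by apply: integral_ge0 => /= x ?; rewrite lee_fin.
pose nu1 : {measure set X -> \bar R} := HB.pack nu0 (isMeasure.Build _ _ _ nu0 nu00 nu0_ge0 nu0_sa).
have nu1fin : fin_num_fun nu1.
  move=> A mA; apply: (integrable_fin_num mA); exact: integrableS iF.
pose nu : {finite_measure set X -> \bar R} := HB.pack nu0 nu1 (Measure_isFinite.Build _ _ _ nu1 nu1fin).
exists nu; split => // f bf.
have num : nu `<< m.
  apply/null_content_dominatesP => A mA mA0.
  apply: null_set_integral => //; exact: measurable_funTS (measurable_int m iF).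
have If := bmeas_integrable nu bf.
have E := Radon_Nikodym_change_of_variables num measurableT If.
rewrite /Rintegral -[X in fine X = _]E.
congr fine; apply: ae_eq_integral => //.
- by apply: emeasurable_funM => //; apply/measurable_EFinP; case: bf.
- by apply/measurable_EFinP; apply: measurable_funM => //; case: bf.
(* The Radon-Nikodym derivative equals F almost everywhere, since both have integral [nu A] over
   every measurable A. *)
- under [X in ae_eq _ _ _ X]eq_fun do rewrite EFinM.
  apply: ae_eqe_mul2l => /=.
  rewrite Radon_NikodymE//=; case: cid => /= h [h1 h2 h3].
  apply: integral_ae_eq => //=.
  + exact/measurable_EFinP.
  + by move=> A A01 mA; rewrite -h3.
Qed.

Section CauchyIntegrals.
Context {R : realType}.
Local Notation leb := (@lebesgue_measure R).
Implicit Types f F : R -> R.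

Let itvk (k : nat) : set R := `[- k.+1%:R, k.+1%:R]%classic.

Let cvg_itvk f (x : R) : (fun k => ((f \_ (itvk k)) x)) @ \oo --> f x.
Proof.
apply: cvg_near_cst; near=> k; rewrite patchE ifT// inE /itvk /= in_itv /= -ler_norml.
rewrite (@le_trans _ _ k%:R)//; last by rewrite ler_nat.
by near: k; exact: nbhs_infty_ger.
Unshelve. all: by end_near. Qed.

Lemma ge0_cvg_integral_itvk f : measurable_fun setT f -> (forall x, 0 <= f x) ->
  ((fun k => \int[leb]_(x in itvk k) (f x)%:E) @ \oo --> \int[leb]_x (f x)%:E)%E.
Proof.
move=> mf f0.
rewrite (_ : (fun k => _) = (fun k => \int[leb]_x ((f \_ (itvk k)) x)%:E)%E); last first.
  by apply/funext => k; rewrite integral_mkcond; apply: eq_integral => x _; rewrite restrict_EFin.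
rewrite (_ : (\int[leb]_x (f x)%:E)%E =
  (\int[leb]_x (limn (fun k => ((f \_ (itvk k)) x)%:E)))%E); last first.
  apply: eq_integral => x _; apply/esym/cvg_lim => //; apply: cvg_EFin.
    by near=> k.
  exact: cvg_itvk.
apply: cvg_monotone_convergence => //.
- move=> k; apply/measurable_EFinP.
  have /measurable_restrictT : measurable (itvk k) by exact: measurable_itv.
  by move=> /(_ _ _ f)[+ _]; apply; exact: measurable_funTS.
- by move=> k x _; rewrite lee_fin patchE; case: ifP.
- move=> x _ i j ij; rewrite lee_fin !patchE; case: ifPn => [|_]; last by case: ifP.
  rewrite inE /itvk /= !in_itv /= -ler_norml => xi; rewrite ifT// inE /= in_itv /= -ler_norml.
  by rewrite (le_trans xi)// ler_nat ltnS.
Unshelve. all: by end_near. Qed.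

Lemma cvg_Rintegral_itvk f : leb.-integrable setT (EFin \o f) ->
  (fun k => \int[leb]_(x in itvk k) f x)%R @ \oo --> (\int[leb]_x f x)%R.
Proof.
move=> iF; have mf : measurable_fun setT f by apply/measurable_EFinP; exact: measurable_int iF.
rewrite (_ : (fun k => _) = (fun k => \int[leb]_x ((f \_ (itvk k)) x))%R); last first.
  by apply/funext => k; rewrite Rintegral_mkcond.
have [] := @dominated_convergence _ _ _ leb setT measurableT
  (fun k => EFin \o (f \_ (itvk k))) (EFin \o f) (EFin \o (Num.norm \o f)).
- move=> k; apply/measurable_EFinP.
  have /measurable_restrictT : measurable (itvk k) by exact: measurable_itv.
  by move=> /(_ _ _ f)[+ _]; apply; exact: measurable_funTS.
- exact/measurable_EFinP.
- by apply: aeW => x _; apply: cvg_EFin; [near=> k|exact: cvg_itvk].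
- exact: integrable_norm.
- by apply: aeW => x k _ /=; rewrite lee_fin patchE; case: ifP => // _; rewrite normr0.
move=> _ _ c; apply: fine_cvg; rewrite /Rintegral fineK//.
exact: (integrable_fin_num measurableT iF).
Unshelve. all: by end_near. Qed.

End CauchyIntegrals.

Section CauchyTransform.
Context {R : realType}.
Local Notation leb := (@lebesgue_measure R).
Implicit Types (a b p q w x : R).

Definition cauchy_pdf a b w : R := pi^-1 * (b / ((w - a) ^+ 2 + b ^+ 2)).

Lemma qform_gt0 a b w : 0 < b -> 0 < (w - a) ^+ 2 + b ^+ 2.
Proof. by move=> b0; rewrite ltr_wpDl ?sqr_ge0// exprn_gt0. Qed.

Lemma continuous_qform a b : continuous (fun w => (w - a) ^+ 2 + b ^+ 2).
Proof.
move=> w; apply: cvgD; last exact: cvg_cst.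
under eq_fun do rewrite expr2; rewrite expr2.
by apply: cvgM; apply: cvgB; [exact: cvg_id|exact: cvg_cst|exact: cvg_id|exact: cvg_cst].
Qed.

Lemma continuous_qformV a b : 0 < b -> continuous (fun w => ((w - a) ^+ 2 + b ^+ 2)^-1).
Proof.
move=> b0 w; apply: cvgV; first by rewrite gt_eqF// qform_gt0.
exact: continuous_qform.
Qed.

Lemma continuous_cauchy_pdf a b : 0 < b -> continuous (cauchy_pdf a b).
Proof.
move=> b0 w; apply: cvgM; first exact: cvg_cst.
by apply: cvgM; [exact: cvg_cst|exact: continuous_qformV].
Qed.

Lemma cauchy_pdf_ge0 a b w : 0 < b -> 0 <= cauchy_pdf a b w.
Proof.
move=> b0; rewrite /cauchy_pdf mulr_ge0 ?invr_ge0 ?pi_ge0//.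
by rewrite divr_ge0 ?ltW// qform_gt0.
Qed.

Lemma is_derive_atan_shift a b x : 0 < b ->
  is_derive x (1 : R) (fun w => atan ((w - a) / b)) (b / ((x - a) ^+ 2 + b ^+ 2)).
Proof.
by move=> b0; have := is_derive_atan_affine a x b0; rewrite -(opprB x a) sqrrN.
Qed.

Lemma cvg_atan_posk a b : 0 < b ->
  (fun k => atan ((k.+1%:R - a) / b)) @ \oo --> (pi / 2 : R).
Proof.
move=> b0.
apply: (@cvg_comp _ _ _ (fun k => (k.+1%:R - a) / b) atan \oo (+oo)); last exact: cvgy_atan.
apply/cvgryPge => A; near=> k; rewrite ler_pdivlMr// -natr1.
have : A * b + a <= k%:R by near: k; exact: nbhs_infty_ger.
lra.
Unshelve. all: by end_near. Qed.

Lemma cvg_atan_negk a b : 0 < b ->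
  (fun k => atan ((- k.+1%:R - a) / b)) @ \oo --> (- (pi / 2) : R).
Proof.
move=> b0; rewrite (_ : (fun k => _) = (fun k => - atan ((k.+1%:R - (- a)) / b))).
  by apply: cvgN; exact: cvg_atan_posk.
by apply/funext => k; rewrite -atanN -mulNr; congr (atan (_ / _)); ring.
Qed.

Lemma integral_cauchy_pdf a b : 0 < b -> (\int[leb]_w (cauchy_pdf a b w)%:E = 1)%E.
Proof.
move=> b0.
have cf := continuous_cauchy_pdf (a := a) b0.
have mf : measurable_fun setT (cauchy_pdf a b) by exact: continuous_measurable_fun.
have h := ge0_cvg_integral_itvk mf (fun w => cauchy_pdf_ge0 a w b0).
have dF (x : R) : is_derive x (1 : R) (fun w => pi^-1 * atan ((w - a) / b)) (cauchy_pdf a b x).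
  have D := is_derive_atan_shift a x b0.
  rewrite (_ : (fun _ => _) = pi^-1 \*: (fun w => atan ((w - a) / b))); last by apply/funext.
  exact: is_deriveZ.
have l : (fun k => pi^-1 * atan ((k.+1%:R - a) / b) - pi^-1 * atan ((- k.+1%:R - a) / b))
    @ \oo --> (1 : R).
  rewrite [X in _ --> X](_ : _ = pi^-1 * (pi / 2) - pi^-1 * (- (pi / 2)) :> R).
    apply: cvgB; apply: cvgM; [exact: cvg_cst|exact: cvg_atan_posk|exact: cvg_cst|exact: cvg_atan_negk].
  by rewrite mulrN opprK -mulrDr -splitr mulVf// lt0r_neq0// pi_gt0.
rewrite -(cvg_lim (@ereal_hausdorff R) h); apply/cvg_lim => //.
rewrite (_ : (fun k => _) = (fun k => (pi^-1 * atan ((k.+1%:R - a) / b) - pi^-1 * atan ((- k.+1%:R - a) / b))%:E)).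
  by apply: cvg_EFin; [near=> k|exact: l].
apply/funext => k; rewrite (FTC_everywhere _ cf dF)//.
by rewrite gtrN// ltr0n.
Unshelve. all: by end_near. Qed.

Lemma integrable_cauchy_pdf a b : 0 < b -> leb.-integrable setT (EFin \o cauchy_pdf a b).
Proof.
move=> b0; apply/integrableP; split.
  apply/measurable_EFinP; apply: continuous_measurable_fun.
  exact: continuous_cauchy_pdf.
under eq_integral => w _ do rewrite /= ger0_norm ?cauchy_pdf_ge0//.
by rewrite integral_cauchy_pdf// ltry.
Qed.

(* Logarithm of the quadratic form at +-1/x, after removing ln (1/x^2). *)
Lemma cvg_ln_qform (s p q : R) : 0 < q ->
  (fun k => ln ((1 - p * k.+1%:R^-1) ^+ 2 + (q * k.+1%:R^-1) ^+ 2)) @ \oo --> (0 : R).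
Proof.
move=> q0.
have c1 : (fun k => (1 - p * k.+1%:R^-1) ^+ 2 + (q * k.+1%:R^-1) ^+ 2) @ \oo --> (1 : R).
  rewrite [X in _ --> X](_ : 1 = (1 - p * 0) * (1 - p * 0) + (q * 0) * (q * 0) :> R); last by ring.
  under eq_fun do rewrite !expr2.
  have h : (fun k => k.+1%:R^-1 : R) @ \oo --> (0 : R) by exact: cvg_harmonic.
  have h1 : (fun k => 1 - p * k.+1%:R^-1 : R) @ \oo --> (1 - p * 0 : R).
    by apply: cvgB; [exact: cvg_cst|apply: cvgM => //; exact: cvg_cst].
  have h2 : (fun k => q * k.+1%:R^-1 : R) @ \oo --> (q * 0 : R).
    by apply: cvgM => //; exact: cvg_cst.
  by apply: cvgD; apply: cvgM.
rewrite -(@ln1 R).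
by apply: (cvg_comp _ _ c1); exact: continuous_ln.
Qed.

Lemma ln_qform_pos (p q : R) (k : nat) : 0 < q ->
  ln ((k.+1%:R - p) ^+ 2 + q ^+ 2) =
  ln ((1 - p * k.+1%:R^-1) ^+ 2 + (q * k.+1%:R^-1) ^+ 2) + ln (k.+1%:R ^+ 2) :> R.
Proof.
move=> q0; rewrite -lnM ?posrE ?exprn_gt0//; last first.
  by rewrite ltr_wpDl ?sqr_ge0// exprn_gt0// mulr_gt0.
by congr ln; field.
Qed.

Lemma ln_qform_neg (p q : R) (k : nat) : 0 < q ->
  ln ((- k.+1%:R - p) ^+ 2 + q ^+ 2) =
  ln ((1 - (- p) * k.+1%:R^-1) ^+ 2 + (q * k.+1%:R^-1) ^+ 2) + ln (k.+1%:R ^+ 2) :> R.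
Proof.
by move=> q0; rewrite -(ln_qform_pos (- p))//; congr (ln (_ + _)); ring.
Qed.

Lemma is_derive_ln_qform (p q x : R) : 0 < q ->
  is_derive x (1 : R) (fun w => ln ((w - p) ^+ 2 + q ^+ 2))
    (2 * (x - p) / ((x - p) ^+ 2 + q ^+ 2)).
Proof.
move=> q0.
have D : is_derive x (1 : R) (fun w => (w - p) ^+ 2 + q ^+ 2) (2 * (x - p)).
  have D1 : is_derive x (1 : R) (fun w : R => w - p) 1.
    by apply: is_derive_eq; rewrite subr0.
  rewrite (_ : (fun _ => _) = (fun w : R => w - p) * (fun w : R => w - p) + cst (q ^+ 2)); last first.
    by apply/funext => w; rewrite expr2.
  apply: is_derive_eq; rewrite addr0 /GRing.scale /=; ring.
have L := @is_derive1_comp R (@ln R) _ x _ _ (is_derive1_ln (qform_gt0 p x q0)) D.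
by apply: (is_derive_eq L); rewrite mulrC.
Qed.

Section Transform.
Variables (a b p q : R).
Hypotheses (b0 : 0 < b) (q0 : 0 < q).
Let z := p +i* q.
Let K : R[i] := (z - a%:C) ^+ 2 + (b%:C) ^+ 2.

(** Write D(w) = (w - a)^2 + b^2, so that K = D(z). As D(w) - D(z) is divisible by w - z, K / ((w -
    z) D(w)) = 1/(w - z) - (w + z - 2a)/D(w). The real and the imaginary part of this, times b/pi,
    are [fre] and [fim]. *)
Let fre w : R := pi^-1 * (b * ((w - p) / ((w - p) ^+ 2 + q ^+ 2)
  - ((w - a) + (p - a)) / ((w - a) ^+ 2 + b ^+ 2))).
Let fim w : R := pi^-1 * (b * (q / ((w - p) ^+ 2 + q ^+ 2)
  - q / ((w - a) ^+ 2 + b ^+ 2))).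

Let freE w : Re (K * cker z w) * cauchy_pdf a b w = fre w.
Proof.
rewrite ReM Re_cker Im_cker /K /fre /cauchy_pdf /z; move: pi^-1 => c /=; rewrite !expr2 /=.
have := qform_gt0 p w q0; have := qform_gt0 a w b0; rewrite !expr2 => h1 h2.
by field; rewrite !gt_eqF.
Qed.

Let fimE w : Im (K * cker z w) * cauchy_pdf a b w = fim w.
Proof.
rewrite ImM Re_cker Im_cker /K /fim /cauchy_pdf /z; move: pi^-1 => c /=; rewrite !expr2 /=.
have := qform_gt0 p w q0; have := qform_gt0 a w b0; rewrite !expr2 => h1 h2.
by field; rewrite !gt_eqF.
Qed.
Let continuous_fre : continuous fre.
Proof.
move=> w; apply: cvgM; first exact: cvg_cst.
apply: cvgM; first exact: cvg_cst.
apply: cvgB; apply: cvgM; [|exact: continuous_qformV| |exact: continuous_qformV].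
  by apply: cvgB; [exact: cvg_id|exact: cvg_cst].
by apply: cvgD; [apply: cvgB; [exact: cvg_id|exact: cvg_cst]|exact: cvg_cst].
Qed.

Let continuous_fim : continuous fim.
Proof.
move=> w; apply: cvgM; first exact: cvg_cst.
apply: cvgM; first exact: cvg_cst.
by apply: cvgB; apply: cvgM; [exact: cvg_cst|exact: continuous_qformV|exact: cvg_cst|exact: continuous_qformV].
Qed.

Let bKcker : cbmeas (fun w : measurableTypeR R => K * cker z w).
Proof. by apply: cbmeasM; [exact: cbmeas_cst|exact: cbmeas_cker]. Qed.

Let integrable_bounded_pdf (f : measurableTypeR R -> R) : bmeas f ->
  leb.-integrable setT (EFin \o (fun w => f w * cauchy_pdf a b w)).
Proof.
move=> [mf [M fM]].
have h := integrableMl measurableT (integrable_cauchy_pdf a b0) mf.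
rewrite (_ : EFin \o _ = ((EFin \o cauchy_pdf a b) \* (EFin \o f))%E).
  apply: h; exists M; split; first exact: num_real.
  by move=> N MN x _ /=; rewrite (le_trans (fM x))// ltW.
by apply/funext => w; rewrite /= mulrC.
Qed.

(** Primitives of [fre] and [fim]. Each logarithm diverges at infinity but their difference tends to
    0 at both ends, so only the atan terms contribute. *)
Let Gre w : R := pi^-1 * (b * (2^-1 * (ln ((w - p) ^+ 2 + q ^+ 2)
  - ln ((w - a) ^+ 2 + b ^+ 2)) - (p - a) / b * atan ((w - a) / b))).
Let Gim w : R := pi^-1 * (b * (atan ((w - p) / q) - q / b * atan ((w - a) / b))).

Let is_derive_Gre x : is_derive x (1 : R) Gre (fre x).
Proof.
have D1 := is_derive_ln_qform p x q0; have D2 := is_derive_ln_qform a x b0.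
have D3 := is_derive_atan_shift a x b0.
rewrite (_ : Gre = pi^-1 \*: (b \*: (2^-1 \*: ((fun w => ln ((w - p) ^+ 2 + q ^+ 2)) -
  (fun w => ln ((w - a) ^+ 2 + b ^+ 2))) - ((p - a) / b) \*: (fun w => atan ((w - a) / b)))))//.
apply: is_derive_eq; rewrite /fre /GRing.scale /=; congr (_ * (_ * _)).
by field; rewrite !gt_eqF ?qform_gt0.
Qed.

Let is_derive_Gim x : is_derive x (1 : R) Gim (fim x).
Proof.
have D1 := is_derive_atan_shift p x q0.
have D3 := is_derive_atan_shift a x b0.
rewrite (_ : Gim = pi^-1 \*: (b \*: ((fun w => atan ((w - p) / q)) -
  (q / b) \*: (fun w => atan ((w - a) / b)))))//.
apply: is_derive_eq; rewrite /fim /GRing.scale /=; congr (_ * (_ * _)).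
by field; rewrite !gt_eqF ?qform_gt0.
Qed.

Let Rintegral_limit (f F : R -> R) (l1 l2 : R) : continuous f ->
  (forall x : R, is_derive x (1 : R) F (f x)) ->
  leb.-integrable setT (EFin \o f) ->
  (fun k => F k.+1%:R) @ \oo --> l1 -> (fun k => F (- k.+1%:R)) @ \oo --> l2 ->
  (\int[leb]_w f w)%R = l1 - l2.
Proof.
move=> cf dF iF h1 h2.
rewrite -(cvg_lim (@Rhausdorff R) (cvg_Rintegral_itvk iF)).
apply/cvg_lim => //; rewrite (_ : (fun k => _) = (fun k => F k.+1%:R - F (- k.+1%:R))).
  exact: cvgB.
by apply/funext => k; rewrite /Rintegral (FTC_everywhere _ cf dF)// gtrN// ltr0n.
Qed.

Let integral_fre : (\int[leb]_w fre w)%R = a - p.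
Proof.
have ci (c : R) : (fun=> c) @ \oo --> c by exact: cvg_cst.
rewrite (@Rintegral_limit fre Gre (pi^-1 * (b * (2^-1 * (0 - 0) - (p - a) / b * (pi / 2))))
   (pi^-1 * (b * (2^-1 * (0 - 0) - (p - a) / b * (- (pi / 2)))))
  continuous_fre is_derive_Gre) //.
- have : (pi : R) != 0 by rewrite lt0r_neq0// pi_gt0.
  by move: pi => c c0; field; rewrite c0 gt_eqF.
- rewrite (_ : fre = fun w => Re (K * cker z w) * cauchy_pdf a b w); last first.
    by apply/funext => w; rewrite freE.
  by apply: integrable_bounded_pdf; case: bKcker.
- apply: cvgM => //; apply: cvgM => //; apply: cvgB; apply: cvgM => //.
    rewrite (_ : (fun k => _) = (fun k =>
        ln ((1 - p * k.+1%:R^-1) ^+ 2 + (q * k.+1%:R^-1) ^+ 2) -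
        ln ((1 - a * k.+1%:R^-1) ^+ 2 + (b * k.+1%:R^-1) ^+ 2))).
      by apply: cvgB; exact: cvg_ln_qform.
    by apply/funext => k; rewrite !ln_qform_pos//; ring.
  exact: cvg_atan_posk.
- apply: cvgM => //; apply: cvgM => //; apply: cvgB; apply: cvgM => //.
    rewrite (_ : (fun k => _) = (fun k =>
        ln ((1 - (- p) * k.+1%:R^-1) ^+ 2 + (q * k.+1%:R^-1) ^+ 2) -
        ln ((1 - (- a) * k.+1%:R^-1) ^+ 2 + (b * k.+1%:R^-1) ^+ 2))).
      by apply: cvgB; exact: cvg_ln_qform.
    by apply/funext => k; rewrite !ln_qform_neg//; ring.
  exact: cvg_atan_negk.
Qed.

Let integral_fim : (\int[leb]_w fim w)%R = b - q.
Proof.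
have ci (c : R) : (fun=> c) @ \oo --> c by exact: cvg_cst.
rewrite (@Rintegral_limit fim Gim (pi^-1 * (b * (pi / 2 - q / b * (pi / 2))))
   (pi^-1 * (b * (- (pi / 2) - q / b * (- (pi / 2)))))
  continuous_fim is_derive_Gim) //.
- have : (pi : R) != 0 by rewrite lt0r_neq0// pi_gt0.
  by move: pi => c c0; field; rewrite c0 gt_eqF.
- rewrite (_ : fim = fun w => Im (K * cker z w) * cauchy_pdf a b w); last first.
    by apply/funext => w; rewrite fimE.
  by apply: integrable_bounded_pdf; case: bKcker.
- by apply: cvgM => //; apply: cvgM => //; apply: cvgB; [|apply: cvgM => //]; exact: cvg_atan_posk.
- by apply: cvgM => //; apply: cvgM => //; apply: cvgB; [|apply: cvgM => //]; exact: cvg_atan_negk.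
Qed.

Variable nu : {finite_measure set (measurableTypeR R) -> \bar R}.
Hypothesis nuE : forall f, bmeas f -> (\int[nu]_w f w = \int[leb]_w (f w * cauchy_pdf a b w))%R.

(** The computation gives K times the transform. In the upper half-plane K vanishes at a + ib only,
    where it cannot be cancelled. *)
Lemma cauchy_transform_off_pole : z != a +i* b -> Phi nu 1 z = ((a -i* b) - z)^-1.
Proof.
move=> zs.
have KPhi : K * Phi nu 1 z = (a - p) +i* (b - q).
  rewrite /Phi -cintZl; last exact: cbmeas_ckerX.
  have [bR bI] := bKcker.
  apply: complex_eq => /=.
  - rewrite nuE; last exact: bR.
    rewrite -integral_fre; apply: eq_Rintegral => w _; exact: freE.
  - rewrite nuE; last exact: bI.
    rewrite -integral_fim; apply: eq_Rintegral => w _; exact: fimE.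
have KE : K = (z - (a +i* b)) * (z - (a -i* b)).
  by apply: complex_eq; rewrite /K /z /= ?ReM ?ImM /=; ring.
have n1 : z - (a +i* b) != 0 by rewrite subr_eq0.
have n2 : z - (a -i* b) != 0.
  apply/eqP => /(congr1 (@complex.Im R)) /= /eqP; rewrite opprK gt_eqF// addr_gt0//.
have K0 : K != 0 by rewrite KE mulf_neq0.
apply: (mulfI K0); rewrite KPhi KE -[(a -i* b) - z]opprB invrN mulrN -mulrA.
rewrite [X in - (_ * X)]mulfV// mulr1 opprB.
by apply: complex_eq.
Qed.
End Transform.

End CauchyTransform.

(** [cauchy_law] is a bare set function; nu supplies the measure structure that [Phi] and the
    uniqueness lemmas require. *)
Lemma cauchy_law_measure {R : realType} (a b : R) : 0 < b ->
  exists nu : {finite_measure set (measurableTypeR R) -> \bar R},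
    eq_law nu (cauchy_law a b) /\
    forall z, 0 < Im z -> Phi nu 1 z = ((a -i* b) - z)^-1.
Proof.
move=> b0.
have mf : measurable_fun [set: measurableTypeR R] (cauchy_pdf a b).
  exact: continuous_measurable_fun (continuous_cauchy_pdf (a := a) b0).
have [nu [nuA nuE]] := density_exists mf (fun w => cauchy_pdf_ge0 a w b0)
  (integrable_cauchy_pdf a b0).
exists nu; split; first by move=> A mA; exact: nuA.
move=> z z0; have [zs|zs] := eqVneq z (a +i* b); last first.
  by case: z z0 zs => p q q0 zs; exact: (cauchy_transform_off_pole b0 q0 nuE).
(* At the pole of the partial fractions the value follows by continuity. *)
have q0 : 0 < Im z / 2 by rewrite divr_gt0.
(* The function u -> 1/(c - u) is the kernel with pole u - c evaluated at 0, so [ckerX_taylor] also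
   expands it. *)
have tE u : ((a -i* b) - u)^-1 = cker (u - (a -i* b)) 0.
  by rewrite /cker sub0r opprB.
have [M1 M10 H1] := Phi_taylor nu 1 q0.
have [M2 M20 H2] := ckerX_taylor 1 q0.
apply/eqP; rewrite -subr_eq0; apply/eqP; apply: normc_small_eq0 => e e0.
set d := 1%:R * Phi nu 2 z - 1%:R * cker (z - (a -i* b)) 0 ^+ 2.
(* The two sides agree at z + t, so for t <= 1 they differ at z by at most (M1 + M2) t^2 + t |d| <=
   t N; the choice t <= e / N makes this at most e. *)
pose N := normc d + M1 + M2 + 1.
have N0 : 0 < N by rewrite ltr_wpDl// !addr_ge0// normc_ge0.
pose t := Num.min 1 (e / N).
have t0 : 0 < t by rewrite lt_min ltr01 divr_gt0.
have nt : normc t%:C = t by rewrite normc_real gtr0_norm.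
have Imzt : Im (z + t%:C) = Im z by rewrite raddfD /= addr0.
have qz : Im z / 2 <= Im z by move: z0; lra.
have qz' : Im z / 2 <= Im (z - (a -i* b)) by rewrite raddfB /= opprK; move: z0 b0; lra.
have h1 := H1 z t%:C qz; rewrite Imzt in h1; have {}h1 := h1 qz.
have h2 := H2 (z - (a -i* b)) t%:C 0 qz'.
have {}h2 : normc (cker (z - (a -i* b) + t%:C) 0 ^+ 1 - cker (z - (a -i* b)) 0 ^+ 1 -
   t%:C * (1%:R * cker (z - (a -i* b)) 0 ^+ 2)) <= M2 * normc t%:C ^+ 2.
  by apply: h2; rewrite addrAC raddfB /= Imzt opprK; move: z0 b0; lra.
have DE : Phi nu 1 (z + t%:C) = cker (z - (a -i* b) + t%:C) 0 ^+ 1.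
  rewrite addrAC expr1 -tE.
  have zt0 : 0 < Im (z + t%:C) by rewrite Imzt.
  have zts : z + t%:C != a +i* b.
    rewrite zs -subr_eq0 addrAC subrr add0r; apply/eqP => /(congr1 (@complex.Re R)) /= /eqP.
    by rewrite gt_eqF.
  move: zt0 zts; case: (z + t%:C) => p q q'0 pqs.
  exact: (cauchy_transform_off_pole b0 q'0 nuE).
rewrite DE in h1; rewrite tE -[cker (z - _) 0]expr1.
move: h1 h2; rewrite nt.
set A := cker (_ + _) _ ^+ 1; set P1 := Phi nu 1 z; set C1 := cker _ _ ^+ 1 => h1 h2.
have -> : P1 - C1 = (A - C1 - t%:C * (1%:R * cker (z - (a -i* b)) 0 ^+ 2))
   - (A - P1 - t%:C * (1%:R * Phi nu 2 z)) - t%:C * d.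
  by rewrite /d; move: (1%:R * Phi nu 2 z) (1%:R * cker _ _ ^+ 2) => x y; ring.
rewrite (le_trans (normcB _ _))// (le_trans (lerD (normcB _ _) (lexx _)))//.
rewrite ComplexField.Normc.normcM nt.
have t1 : t <= 1 by rewrite ge_min lexx.
have tN : t * N <= e by rewrite -ler_pdivlMr// ge_min lexx orbT.
rewrite (le_trans _ tN)// /N !mulrDr.
have : t ^+ 2 <= t by rewrite expr2 ler_piMl// ltW.
have := normc_ge0 d; move: h1 h2 (ltW t0) M10 M20; nra.
Qed.

(* D is constant along vertical lines and tends to 0 at the far end. *)
Lemma quadratic_vanish {R : realType} (D : R[i] -> R[i]) (C : R) :
  (forall q : R, 0 < q -> exists M : R, forall z h : R[i], q <= Im z -> q <= Im (z + h) ->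
    normc (D (z + h) - D z) <= M * normc h ^+ 2) ->
  (forall u, 1 <= Im u -> normc (D u) <= C / Im u) ->
  forall z, 0 < Im z -> D z = 0.
Proof.
move=> Dq DC z z0; apply: normc_small_eq0 => e e0.
pose s := 1 + Im z + `|C| / e.
have c20 : 0 <= `|C| / e by rewrite divr_ge0// ltW.
have s1 : 1 <= s by rewrite /s; move: z0 c20; lra.
have sz : Im z <= s by rewrite /s; move: z0 c20; lra.
have s0 : 0 < s by rewrite (lt_le_trans ltr01).
have [M HM] := Dq _ z0.
have -> : D z = D (Re z +i* s).
  exact: (@quadratic_increments_cst _ _ D M (@segment_closed_Im R (Im z)) HM z
    (Re z +i* s) (lexx _) sz).
rewrite (le_trans (DC (Re z +i* s) s1))// ler_pdivrMr// (le_trans (ler_norm C))//.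
rewrite [e * _]mulrC -ler_pdivrMr// /= /s; move: z0; lra.
Qed.

(** The difference of the two functions Phi_k has linear part k times the difference of the two
    Phi_(k+1), which is zero, and it is O(1 / Im z); so it vanishes. At k = 1 the imaginary part is
    the Poisson integral. *)
Lemma Phi_unique {R : realType} (m1 m2 : {finite_measure set (measurableTypeR R) -> \bar R})
  (k : nat) : (0 < k)%N ->
  (forall z, 0 < Im z -> Phi m1 k z = Phi m2 k z) -> eq_law m1 m2.
Proof.
elim: k => // -[_ _ h|k IH _ h].
  apply: poisson_unique => p q q0.
  by have := h (p +i* q) q0 => -[].
apply: IH => // z z0; apply/eqP; rewrite -subr_eq0; apply/eqP.
pose c := fine (m1 setT) + fine (m2 setT).
apply: (quadratic_vanish (D := fun v => Phi m1 k.+1 v - Phi m2 k.+1 v) (C := 2 * c) _ _ z0).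
- move=> q q0; have [M1 M10 H1] := Phi_taylor m1 k.+1 q0.
  have [M2 M20 H2] := Phi_taylor m2 k.+1 q0; exists (M1 + M2) => v l qv qvl.
  have h1 := H1 _ _ qv qvl; have h2 := H2 _ _ qv qvl.
  rewrite h ?(lt_le_trans q0)// in h1.
  rewrite [X in normc X](_ : _ = (Phi m1 k.+1 (v + l) - Phi m1 k.+1 v - l * (k.+1%:R * Phi m2 k.+2 v)) -
    (Phi m2 k.+1 (v + l) - Phi m2 k.+1 v - l * (k.+1%:R * Phi m2 k.+2 v))); last first.
    move: (Phi m1 k.+1 (v + l)) (Phi m1 k.+1 v) (Phi m2 k.+1 (v + l)) (Phi m2 k.+1 v).
    by move: (_ * Phi _ _ _) => x1 x2 x3 x4 x5; ring.
  by rewrite (le_trans (normcB _ _))// mulrDl lerD.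
- move=> u u1; have u0 : 0 < Im u by rewrite (lt_le_trans ltr01).
  rewrite (le_trans (normcB _ _))//.
  have n1 := Phi_norm m1 k.+1 u0 (lexx _); have n2 := Phi_norm m2 k.+1 u0 (lexx _).
  rewrite (le_trans (lerD n1 n2))// -mulrDr -mulrDr -/c -mulrA ler_wpM2l// mulrC.
  rewrite ler_wpM2l ?addr_ge0 ?fine_ge0// exprS ler_piMr ?invr_ge0 ?(ltW u0)//.
  by rewrite exprn_ile1 ?invr_ge0 ?(ltW u0)// invf_le1.
Qed.

(** * The equation Phi_2 = Phi_1^2 and its solutions *)

Section MobiusStieltjes.
Context {R : realType} (m : probability (measurableTypeR R) R).

(** The integrand is positive at every w, so a zero integral would make the whole line a null
    set. *)
Lemma Phi1_Im_gt0 z : 0 < Im z -> 0 < Im (Phi m 1 z).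
Proof.
move=> z0; rewrite /Phi /= lt_neqAle eq_sym; apply/andP; split; last first.
  apply: Rintegral_ge0 => w _; rewrite Im_cker.
  by rewrite divr_ge0 ?ltW// cker_den_gt0.
apply/eqP => I0.
have bI : bmeas (fun w : measurableTypeR R => Im (cker z w)) by case: (cbmeas_cker z0).
have pos w : 0 < Im (cker z w) by rewrite Im_cker divr_gt0// cker_den_gt0.
have : (\int[m]_w `|(Im (cker z w))%:E| = 0)%E.
  under eq_integral => w _ do rewrite abse_EFin ger0_norm ?(ltW (pos w))//.
  by rewrite bintE// I0.
move=> /(ae_eq_integral_abs m measurableT _).1 => /(_ _)[].
  by apply/measurable_EFinP; case: bI.
move=> N [mN N0 sN].
have NT : N = setT.
  apply/seteqP; split => // w _; apply: sN => /= /(_ Logic.I) [].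
  by move/eqP; rewrite gt_eqF.
have : m N = 1%E by rewrite NT probability_setT.
by rewrite N0 => /esym/eqP; rewrite onee_eq0.
Qed.

Lemma Phi_lip (q : R) z h : 0 < q -> q <= Im z -> q <= Im (z + h) ->
  normc (Phi m 1 (z + h) - Phi m 1 z) <= 2 * q^-1 ^+ 2 * normc h.
Proof.
move=> q0 qz qzh; have z0 := lt_le_trans q0 qz; have zh0 := lt_le_trans q0 qzh.
have m1 : fine (m setT) = 1 by rewrite probability_setT.
rewrite /Phi -cintB; [|exact: cbmeas_ckerX..].
have -> : 2 * q^-1 ^+ 2 * normc h = 2 * ((q^-1 ^+ 2 * normc h) * fine (m setT)).
  by rewrite m1 mulr1 mulrA.
apply: cint_norm_le => [|w]; first by apply: cbmeasB; exact: cbmeas_ckerX.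
rewrite !expr1 cker_resolvent// !ComplexField.Normc.normcM -mulrA.
rewrite [leRHS]mulrC ler_wpM2l ?normc_ge0// expr2.
by rewrite ler_pM ?normc_ge0// normc_cker_le.
Qed.

(* The derivative of Phi 2 - (Phi 1)^2 is 2 (Phi 3 - Phi 1 Phi 2). *)
Lemma Phi2_of_Phi3 : (forall z, 0 < Im z -> Phi m 3 z = Phi m 1 z * Phi m 2 z) ->
  forall z, 0 < Im z -> Phi m 2 z = Phi m 1 z * Phi m 1 z.
Proof.
move=> H3 z z0; apply/eqP; rewrite -subr_eq0; apply/eqP.
have m1 : fine (m setT) = 1 by rewrite probability_setT.
(* 6 = 2 + 4: for Im u >= 1 the two terms are at most 2 / (Im u)^2 and (2 / Im u)^2. *)
apply: (quadratic_vanish (D := fun v => Phi m 2 v - Phi m 1 v * Phi m 1 v) (C := 6) _ _ z0).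
- move=> q q0; have [M1 M10 H1] := Phi_taylor m 1 q0; have [M2 M20 H2] := Phi_taylor m 2 q0.
  exists (M2 + 2 * q^-1 ^+ 2 * (2 * q^-1 ^+ 2) + M1 * (2 * q^-1 + 2 * q^-1)) => v h qv qvh.
  have h1 := H1 _ _ qv qvh; have h2 := H2 _ _ qv qvh; have hl := Phi_lip q0 qv qvh.
  have n1 := Phi_norm m 1 q0 qv; have n1' := Phi_norm m 1 q0 qvh; have n2 := Phi_norm m 2 q0 qv.
  rewrite m1 !mulr1 !expr1 in n1 n1' n2.
  rewrite H3 ?(lt_le_trans q0)// in h2.
  move: h1 h2 hl n1 n1' n2; move: (Phi m 1 (v + h)) (Phi m 1 v) (Phi m 2 (v + h)) (Phi m 2 v).
  move=> A' A B' B h1 h2 hl n1 n1' n2.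
  (* The linear part 2 h A B of B' - B and the term h B (A' + A) hidden in A'^2 - A^2 differ by h B
     (A' - A), which is itself quadratic in h. *)
  have -> : B' - A' * A' - (B - A * A) = (B' - B - h * (2%:R * (A * B)))
     - h * (B * (A' - A)) - (A' - A - h * (1%:R * B)) * (A' + A) by ring.
  rewrite (le_trans (normcB _ _))// (le_trans (lerD (normcB _ _) (lexx _)))//.
  rewrite !ComplexField.Normc.normcM [leRHS]mulrDl [X in _ <= X + _]mulrDl.
  rewrite lerD ?lerD//.
    rewrite [leRHS](_ : _ = normc h * ((2 * q^-1 ^+ 2) * ((2 * q^-1 ^+ 2) * normc h))); last by ring.
    by rewrite ler_wpM2l ?normc_ge0// ler_pM ?normc_ge0.
  rewrite mulrAC ler_pM ?normc_ge0//.
  by rewrite (le_trans (normcD _ _))// lerD.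
- move=> u u1; have u0 : 0 < Im u by rewrite (lt_le_trans ltr01).
  have n1 := Phi_norm m 1 u0 (lexx _); have n2 := Phi_norm m 2 u0 (lexx _).
  rewrite m1 !mulr1 !expr1 in n1 n2.
  rewrite (le_trans (normcB _ _))// ComplexField.Normc.normcM.
  have i1 : (Im u)^-1 <= 1 by rewrite invf_le1.
  have i0 : 0 <= (Im u)^-1 by rewrite invr_ge0 ltW.
  have n11 := ler_pM (normc_ge0 _) (normc_ge0 _) n1 n1.
  rewrite (le_trans (lerD n2 n11))//.
  have : (Im u)^-1 ^+ 2 <= (Im u)^-1 by rewrite expr2 ler_piMl.
  by rewrite expr2; nra.
Qed.

End MobiusStieltjes.

Section MobiusForm.
Context {R : realType} (m : probability (measurableTypeR R) R).

Lemma segment_closed_ball (c : R[i]) (L : R) : segment_closed [set z | normc (z - c) <= L].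
Proof.
move=> z u t /= zL uL /andP[t0 t1].
have -> : z + t%:C * (u - z) - c = (1 - t)%:C * (z - c) + t%:C * (u - c).
  by rewrite rmorphB rmorph1; ring.
rewrite (le_trans (normcD _ _))// !ComplexField.Normc.normcM !normc_real.
rewrite ger0_norm ?subr_ge0// ger0_norm//.
have -> : L = (1 - t) * L + t * L by ring.
by rewrite lerD// ler_wpM2l// subr_ge0.
Qed.

(** A Harnack inequality: |w - z| <= |w - z0| + L <= (1 + L / Im z0) |w - z0| because |w - z0| >= Im
    z0, so the Poisson kernels at z and z0 are comparable uniformly in w. It keeps Phi_1 away from 0
    where [Phi1_mobius] divides by it. *)
Lemma Im_Phi1_lower z0 z (q L : R) : 0 < q -> 0 < Im z0 -> q <= Im z ->
  normc (z - z0) <= L ->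
  q / (Im z0 * (1 + L / Im z0) ^+ 2) * Im (Phi m 1 z0) <= Im (Phi m 1 z).
Proof.
move=> q0 z00 qz zL; have z0' := lt_le_trans q0 qz.
have L0 : 0 <= L by rewrite (le_trans _ zL)// normc_ge0.
rewrite /Phi /= -bintZ; last by case: (cbmeas_cker z00).
apply: bint_le => [||w].
- by apply: bmeasM; [exact: bmeas_cst|case: (cbmeas_cker z00)].
- by case: (cbmeas_cker z0').
have E (u : R[i]) : 0 < Im u -> Im (cker u w) = Im u / normc (w%:C - u) ^+ 2.
  move=> u0; rewrite Im_cker; congr (_ / _); case: u u0 => p r r0 /=.
  by rewrite sqr_sqrtr ?addr_ge0 ?sqr_ge0// add0r sqrrN.
rewrite !E//.
set A := normc (w%:C - z0); set B := normc (w%:C - z).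
have A0 : 0 < A by rewrite (lt_le_trans z00)// Im_le_dist.
have B0 : 0 < B by rewrite (lt_le_trans z0')// Im_le_dist.
have BA : B <= A * (1 + L / Im z0).
  rewrite mulrDr mulr1 (@le_trans _ _ (A + L))//.
    rewrite /B [w%:C - z](_ : _ = (w%:C - z0) - (z - z0)); last by ring.
    by rewrite (le_trans (normcB _ _))// lerD.
  by rewrite lerD2l mulrCA ler_peMr// ler_pdivlMr// mul1r Im_le_dist.
have k0 : 0 < 1 + L / Im z0 by rewrite ltr_wpDr ?divr_ge0// ltW.
have B2 : B ^+ 2 <= (A * (1 + L / Im z0)) ^+ 2 by rewrite lerXn2r ?nnegrE ?(ltW B0) ?(ltW (mulr_gt0 A0 k0)).
apply: (@le_trans _ _ (q / B ^+ 2)); last by rewrite ler_wpM2r// invr_ge0 sqr_ge0.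
rewrite [leLHS](_ : _ = q / (A * (1 + L / Im z0)) ^+ 2); last first.
  by move: (1 + _) k0 => k k0; field; rewrite !gt_eqF.
by rewrite ler_wpM2l ?(ltW q0)// lef_pV2 ?posrE ?exprn_gt0// mulr_gt0.
Qed.

(* If G' = G^2 then (1/G + z)' = 0. *)
Lemma Phi1_mobius : (forall z, 0 < Im z -> Phi m 2 z = Phi m 1 z * Phi m 1 z) ->
  exists a b : R, 0 <= b /\ forall z, 0 < Im z -> Phi m 1 z = ((a -i* b) - z)^-1.
Proof.
move=> H2.
have G0 z : 0 < Im z -> Phi m 1 z != 0.
  move=> z0; apply/eqP => E; have := Phi1_Im_gt0 m z0.
  by rewrite E ltxx.
have m1 : fine (m setT) = 1 by rewrite probability_setT.
have Fcst z z0 : 0 < Im z -> 0 < Im z0 -> (Phi m 1 z)^-1 + z = (Phi m 1 z0)^-1 + z0.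
  move=> iz iz0.
  pose q := Num.min (Im z) (Im z0); have q0 : 0 < q by rewrite lt_min iz.
  pose L := normc (z - z0); have L0 : 0 <= L by exact: normc_ge0.
  pose dl := q / (Im z0 * (1 + L / Im z0) ^+ 2) * Im (Phi m 1 z0).
  have k0 : 0 < 1 + L / Im z0 by rewrite ltr_wpDr ?divr_ge0// ltW.
  have dl0 : 0 < dl by rewrite mulr_gt0 ?Phi1_Im_gt0// divr_gt0// mulr_gt0// exprn_gt0.
  have [M1 M10 H1] := Phi_taylor m 1 q0.
  (* The lower bound on |Phi_1| is uniform only at bounded distance from z0, hence the disc. Both
     constraints are convex, so the segment from z to z0 stays in S. *)
  pose S := [set u : R[i] | q <= Im u /\ normc (u - z0) <= L].
  pose Bd := 2 * q^-1; have Bd0 : 0 <= Bd by rewrite mulr_ge0// invr_ge0 ltW.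
  pose Lp := 2 * q^-1 ^+ 2.
  have Lp0 : 0 <= Lp by rewrite mulr_ge0// exprn_ge0// invr_ge0 ltW.
  apply: (@quadratic_increments_cst _ S (fun u => (Phi m 1 u)^-1 + u)
    ((Bd * Lp + M1) / dl ^+ 2)).
  - move=> u v t [u1 u2] [v1 v2] t01; split.
      exact: (@segment_closed_Im R q).
    exact: (@segment_closed_ball z0 L).
  - move=> u h [u1 u2] [v1 v2].
    have u0 := lt_le_trans q0 u1; have v0 := lt_le_trans q0 v1.
    have h1 := H1 _ _ u1 v1; rewrite H2// in h1.
    have hl := Phi_lip m q0 u1 v1.
    have n1 := Phi_norm m 1 q0 u1; rewrite m1 mulr1 expr1 in n1.
    have du := le_trans (Im_Phi1_lower q0 iz0 u1 u2) (le_trans (ler_norm _) (Im_le_normc _)).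
    have dv := le_trans (Im_Phi1_lower q0 iz0 v1 v2) (le_trans (ler_norm _) (Im_le_normc _)).
    have gu := G0 u u0; have gv := G0 _ v0.
    rewrite -/dl in du dv; rewrite -/Bd in n1; rewrite -/Lp in hl.
    move: h1 hl n1 du dv gu gv.
    move: (Phi m 1 (u + h)) (Phi m 1 u) => A' A h1 hl n1 du dv gu gv.
    have -> : A'^-1 + (u + h) - (A^-1 + u) =
      (h * (A * (A' - A)) - (A' - A - h * (1%:R * (A * A)))) * (A * A')^-1.
      by field; rewrite gu gv.
    rewrite ComplexField.Normc.normcM ComplexField.Normc.normcV mulrAC.
    apply: ler_pM; rewrite ?normc_ge0 ?invr_ge0 ?normc_ge0//.
      rewrite (le_trans (normcB _ _))// mulrDl lerD// !ComplexField.Normc.normcM.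
      rewrite [leRHS](_ : _ = normc h * (Bd * (Lp * normc h))); last by ring.
      by rewrite ler_wpM2l ?normc_ge0// ler_pM ?normc_ge0.
    rewrite lef_pV2 ?posrE ?exprn_gt0//.
      by rewrite ComplexField.Normc.normcM expr2 ler_pM ?(ltW dl0).
    by rewrite ComplexField.Normc.normcM mulr_gt0// (lt_le_trans dl0).
  - by split; [rewrite ge_min lexx|exact: lexx].
  - by split; [rewrite ge_min lexx orbT|rewrite subrr ComplexField.Normc.normc0].
pose c := (Phi m 1 'i)^-1 + 'i.
have iI : 0 < Im ('i : R[i]) by rewrite /= ltr01.
have E z : 0 < Im z -> Phi m 1 z = (c - z)^-1.
  by move=> z0; rewrite /c -(Fcst z 'i z0 iI) addrK invrK.
(* If Im c were positive, Phi_1(c) would be the inverse of 0, which is 0 by convention, against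
   [G0]. *)
have c0 : Im c <= 0.
  rewrite leNgt; apply/negP => c0; have := G0 c c0.
  by rewrite E// subrr invr0 eqxx.
exists (Re c), (- Im c); split; first by rewrite oppr_ge0.
move=> z z0; rewrite E//; congr ((_ - _)^-1).
by apply: complex_eq => //=; rewrite opprK.
Qed.

Lemma mobius_law (a b : R) : 0 <= b ->
  (forall z, 0 < Im z -> Phi m 1 z = ((a -i* b) - z)^-1) -> is_cauchy m \/ is_dirac m.
Proof.
rewrite le_eqVlt => /predU1P[<-|b0] E; [right|left].
  exists a; apply: (@Phi_unique R m (\d_(a : measurableTypeR R) : probability _ R) 1) => // z z0.
  rewrite E// oppr0 /Phi /cint /Rintegral.
  have [bR bI] := cbmeas_cker z0.
  rewrite !integral_dirac//=.
  - by rewrite indicT !mul1r; apply: complex_eq.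
  - by apply/measurable_EFinP; exact: bmeas_measurable bI.
  - by apply/measurable_EFinP; exact: bmeas_measurable bR.
have [nu [nuE nuP]] := cauchy_law_measure a b0.
exists a, b; split => // A mA; rewrite -nuE//.
by apply: (@Phi_unique R m nu 1) => // z z0; rewrite E// nuP.
Qed.

End MobiusForm.

(** * Independence of the partial sums from the variables still to come *)

Section Independence.
Context {d : measure_display} {T : measurableType d} {R : realType}.
Variable P : probability T R.

(** As functions of D both sides are finite measures: the image of P restricted to C, and the law of
    [(U, V)] scaled by P C. They agree on rectangles, which generate the product and are stable
    under intersection. *)
Lemma rectangles_indep {d1 d2} {X : measurableType d1} {Y : measurableType d2}
  (U : {mfun T >-> X}) (V : {mfun T >-> Y}) (C : set T) : measurable C ->
  (forall A B, measurable A -> measurable B ->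
    P (U @^-1` A `&` (V @^-1` B `&` C)) = (P (U @^-1` A `&` V @^-1` B) * P C)%E) ->
  forall D : set (X * Y), measurable D ->
    P ((fun w => (U w, V w)) @^-1` D `&` C) =
    (P ((fun w => (U w, V w)) @^-1` D) * P C)%E.
Proof.
move=> mC UVC D mD.
have mUV : measurable_fun setT (fun w => (U w, V w)) by exact: measurable_fun_pair.
have PC0 : 0 <= fine (P C) by rewrite fine_ge0.
pose m1 : {measure set (X * Y) -> \bar R} :=
  measure_function_pushforward__canonical__measure_function_Measure (mrestr P mC) mUV.
pose m2 : {measure set (X * Y) -> \bar R} := mscale (NngNum PC0) (distribution P (pack_mfun mUV)).
have PCE : P C = (fine (P C))%:E by rewrite fineK ?fin_num_measure.
suff /(_ D mD) : eq_law m1 m2.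
  by move=> h; rewrite muleC PCE; exact: h.
move=> {D mD} D mD.
pose G : set (set (X * Y)) := [set A `*` B | A in measurable & B in measurable].
apply: (@measure_unique _ _ _ G (fun=> setT)) => //.
- by rewrite /G -measurable_prod_measurableType.
- move=> _ _ [A mA [B mB <-]] [A' mA' [B' mB' <-]]; rewrite -setXI.
  by exists (A `&` A'); [exact: measurableI|exists (B `&` B'); [exact: measurableI|]].
- by move=> _; exists setT => //; exists setT => //; rewrite setXTT.
- by rewrite bigcup_const.
- move=> _ [A mA [B mB <-]].
  have := UVC _ _ mA mB; rewrite setIA muleC PCE => h; exact: h.
- move=> _; have : (P (setT `&` C) < +oo)%E by rewrite setTI PCE ltry.
  by move=> h; exact: h.
Qed.

Variables (B Y : nat -> {mfun T >-> measurableTypeR R}).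

Definition stick_var (i : nat + nat) : {mfun T >-> measurableTypeR R} :=
  match i with inl n => B n | inr n => Y n end.

(** Position in the enumeration [B 0], [Y 0], [B 1], [Y 1], ..., the order in which the partial sums
    consume the variables. *)
Definition stick_rank (i : nat + nat) : nat :=
  match i with inl n => n.*2 | inr n => n.*2.+1 end.

Definition var_events (i : nat + nat) : set (set T) :=
  preimage_set_system setT (stick_var i) measurable.

Hypothesis indepBY : mutual_independence P var_events.

(** Independence of Z from all variables of rank at least N, tested on finite intersections of their
    events. In this form it passes to functions of Z and can be extended by one variable at a time,
    with no sigma-algebra of the past to describe. *)
Definition indep_future (N : nat) {d1} {X : measurableType d1} (Z : T -> X) : Prop :=
  measurable_fun setT Z /\
  forall (J : {fset nat + nat}) (A : nat + nat -> set T),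
    (forall i, i \in J -> (N <= stick_rank i)%N /\ var_events i (A i)) ->
    forall E, measurable E ->
      P (Z @^-1` E `&` \bigcap_(i in [set` J]) A i) =
      (P (Z @^-1` E) * P (\bigcap_(i in [set` J]) A i))%E.

Lemma var_events_measurable i A : var_events i A -> measurable A.
Proof. by move=> [F mF <-]; apply: measurable_funP. Qed.

Lemma indep_future_cst {d1} {X : measurableType d1} (x : X) : indep_future 0 (fun=> x).
Proof.
split=> [|J A JA E mE]; first exact: measurable_cst.
rewrite preimage_cst; case: ifPn => _; first by rewrite setTI probability_setT mul1e.
by rewrite set0I measure0 mul0e.
Qed.

Lemma indep_future_comp (N : nat) {d1 d2} {X : measurableType d1} {X' : measurableType d2}
  (Z : T -> X) (phi : X -> X') : measurable_fun setT phi ->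
  indep_future N Z -> indep_future N (phi \o Z).
Proof.
move=> mphi [mZ IZ]; split; first exact: measurableT_comp.
move=> J A JA E mE; rewrite comp_preimage; apply: IZ => //.
by rewrite -[X in measurable X]setTI; exact: mphi.
Qed.

Lemma bigcap_fset_measurable (J : {fset nat + nat}) (A : nat + nat -> set T) :
  (forall i, i \in J -> measurable (A i)) -> measurable (\bigcap_(i in [set` J]) A i).
Proof. by move=> mA; apply: fin_bigcap_measurable => // i /=; exact: mA. Qed.

(** On a rectangle, the event about the variable [i0] is first counted with the future: joined to J
    it separates from Z by hypothesis, and from J by mutual independence. [rectangles_indep] then
    reaches every set of the product. *)
Lemma indep_future_pair (i0 : nat + nat) {d1} {X : measurableType d1} (Z : T -> X) :
  indep_future (stick_rank i0) Z ->
  indep_future (stick_rank i0).+1 (fun w => (Z w, stick_var i0 w)).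
Proof.
move=> [mZ IZ]; split; first exact: measurable_fun_pair.
move=> J A JA.
have mC : measurable (\bigcap_(i in [set` J]) A i).
  by apply: bigcap_fset_measurable => i iJ; exact: var_events_measurable (JA i iJ).2.
(* Every index in J has rank above that of [i0], so adjoining [i0] adds a new factor to the
   product. *)
have i0J : i0 \notin J by apply/negP => /JA[]; rewrite ltnn.
have cap F : measurable F -> let J' := (i0 |` J)%fset in
    let A' := fun i => if i == i0 then stick_var i0 @^-1` F else A i in
    [/\ \bigcap_(i in [set` J']) A' i = stick_var i0 @^-1` F `&` \bigcap_(i in [set` J]) A i,
     (forall i, i \in J' -> (stick_rank i0 <= stick_rank i)%N /\ var_events i (A' i))
     & (\prod_(i <- J') P (A' i) = P (stick_var i0 @^-1` F) * \prod_(i <- J) P (A i))%E].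
  move=> mF J' A'; split.
  - rewrite set_fsetU1 bigcap_setU1 /A' eqxx; congr (_ `&` _).
    apply: eq_bigcapr => i /= iJ; case: eqP => // ii0.
    by move: iJ; rewrite ii0 (negbTE i0J).
  - move=> i; rewrite !inE /A'; case: eqP => [-> _|_ /= iJ].
      by split => //; exists F => //; rewrite setTI.
    by have [h1 h2] := JA i iJ; split => //; exact: ltnW.
  - rewrite big_fsetU1//= /A' eqxx; congr (_ * _)%E.
    apply: eq_big_seq => i iJ; case: eqP => // ii0.
    by move: iJ; rewrite ii0 (negbTE i0J).
apply: (@rectangles_indep _ _ _ _ (pack_mfun mZ) (stick_var i0)) => // E F mE mF.
have [capE capA capP] := cap F mF.
have [_ h0 _] := cap setT measurableT.
rewrite -capE IZ// capE.
have E1 : P (stick_var i0 @^-1` F `&` \bigcap_(i in [set` J]) A i) =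
    (P (stick_var i0 @^-1` F) * P (\bigcap_(i in [set` J]) A i))%E.
  have h1 := indepBY (fun i iJ => (capA i iJ).2).
  have h2 := indepBY (fun i iJ => (JA i iJ).2).
  by rewrite h2 -capP -h1 -capE.
have E2 : P (Z @^-1` E `&` stick_var i0 @^-1` F) =
    (P (Z @^-1` E) * P (stick_var i0 @^-1` F))%E.
  have := IZ [fset i0]%fset (fun=> stick_var i0 @^-1` F) _ E mE.
  rewrite set_fset1 bigcap_set1; apply => i; rewrite inE => /eqP ->; split => //.
  by exists F => //; rewrite setTI.
by rewrite E1 muleA -E2.
Qed.

End Independence.

(** * The operator T and the law of S_m + R_m x *)

Section StickOperator.
Context {R : realType} (alpha eta : probability (measurableTypeR R) R).
Implicit Types f : measurableTypeR R -> R.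

(* The law of Y B + (1 - Y) x, with B ~ alpha and Y ~ eta, tested on f. *)
Definition Tstick f (x : measurableTypeR R) : R :=
  (\int[alpha]_b \int[eta]_y f ((y : R) * b + (1 - (y : R)) * x : R))%R.

Lemma measurable_mix : measurable_fun setT
  (fun z : measurableTypeR R * measurableTypeR R * measurableTypeR R =>
    (z.2 : R) * z.1.2 + (1 - (z.2 : R)) * z.1.1 : measurableTypeR R).
Proof.
have m2 : measurable_fun setT
  (fun z : measurableTypeR R * measurableTypeR R * measurableTypeR R => z.2) by exact: measurable_snd.
have m12 : measurable_fun setT
  (fun z : measurableTypeR R * measurableTypeR R * measurableTypeR R => z.1.2).
  exact: (measurableT_comp measurable_snd measurable_fst).
have m11 : measurable_fun setT
  (fun z : measurableTypeR R * measurableTypeR R * measurableTypeR R => z.1.1).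
  exact: (measurableT_comp measurable_fst measurable_fst).
apply: measurable_funD; first exact: measurable_funM.
by apply: measurable_funM => //; apply: measurable_funB.
Qed.

Lemma bmeas_mix f : bmeas f ->
  bmeas (fun z : measurableTypeR R * measurableTypeR R * measurableTypeR R =>
    f ((z.2 : R) * z.1.2 + (1 - (z.2 : R)) * z.1.1 : R)).
Proof.
move=> [mf [M fM]].
by apply: (bmeas_comp measurable_mix mf); exists M.
Qed.

Lemma bmeas_Tstick f : bmeas f -> bmeas (Tstick f).
Proof.
move=> /bmeas_mix bf; have b1 := bmeas_bint eta bf.
exact: (bmeas_bint alpha b1).
Qed.

End StickOperator.

Section StickDynamics.
Context {dT : measure_display} {T : measurableType dT} {R : realType}.
Variables (P : probability T R) (t : R) (alpha : probability (measurableTypeR R) R).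
Variables (B Y : nat -> {RV P >-> measurableTypeR R}).
Hypothesis sb : stick_breaking t alpha P B Y.

Definition stick_sum (m : nat) (w : T) : measurableTypeR R :=
  series (fun n => weight Y n w * B n w : R) m.

Definition stick_rest (m : nat) (w : T) : measurableTypeR R :=
  \prod_(k < m) (1 - (Y k w : R)).

Let eta := distribution P (Y 0).

Lemma stick_indep : mutual_independence P (var_events B Y).
Proof.
move=> J A JA; apply: (sb_indep sb) => i iJ; have := JA i iJ.
by rewrite /var_events; case: i iJ.
Qed.

Lemma stick_sumS m w :
  stick_sum m.+1 w = (stick_sum m w : R) + stick_rest m w * (Y m w * B m w).
Proof.
rewrite /stick_sum seriesSr /= /weight /stick_rest; congr (_ + _).
by rewrite -mulrA mulrCA.
Qed.

Lemma stick_restS m w : stick_rest m.+1 w = (stick_rest m w : R) * (1 - (Y m w : R)).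
Proof. by rewrite /stick_rest big_ord_recr. Qed.

Definition stick_state m (w : T) := (stick_sum m w, stick_rest m w).

Let upd (z : measurableTypeR R * measurableTypeR R * measurableTypeR R * measurableTypeR R) :
    measurableTypeR R * measurableTypeR R :=
  ((z.1.1.1 : R) + (z.1.1.2 : R) * ((z.2 : R) * z.1.2), (z.1.1.2 : R) * (1 - (z.2 : R))).

Let measurable_upd : measurable_fun setT upd.
Proof.
have m11 : measurable_fun setT (fun z : measurableTypeR R * measurableTypeR R *
    measurableTypeR R * measurableTypeR R => z.1.1).
  exact: (measurableT_comp measurable_fst measurable_fst).
have m111 := measurableT_comp measurable_fst m11.
have m112 := measurableT_comp measurable_snd m11.
have m12 : measurable_fun setT (fun z : measurableTypeR R * measurableTypeR R *
    measurableTypeR R * measurableTypeR R => z.1.2).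
  exact: (measurableT_comp measurable_snd measurable_fst).
apply: measurable_fun_pair.
  apply: measurable_funD => //; apply: measurable_funM => //.
  exact: measurable_funM.
by apply: measurable_funM => //; apply: measurable_funB.
Qed.

Lemma indep_future_state m : indep_future P B Y m.*2 (stick_state m).
Proof.
elim: m => [|m IH].
  rewrite (_ : stick_state 0 = fun=> (0, 1)); first exact: indep_future_cst.
  apply/funext => w; rewrite /stick_state /stick_sum /stick_rest big_ord0.
  by rewrite /series /= big_geq.
have h1 := indep_future_pair stick_indep (i0 := inl m) IH.
have h2 := indep_future_pair stick_indep (i0 := inr m) h1.
have := indep_future_comp measurable_upd h2.
rewrite (_ : upd \o _ = stick_state m.+1)//.
by apply/funext => w; rewrite /upd /= /stick_state stick_sumS stick_restS.
Qed.

Lemma measurable_stick_state m : measurable_fun setT (stick_state m).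
Proof. by have [] := indep_future_state m. Qed.

Definition hstick (m : nat) (f : measurableTypeR R -> R) (x : measurableTypeR R) : R :=
  (\int[P]_w f ((stick_sum m w : R) + stick_rest m w * x : R))%R.

Lemma var_indep (N : nat) (i : nat + nat) {d1} {X : measurableType d1} (Z : T -> X) :
  indep_future P B Y N Z -> (N <= stick_rank i)%N ->
  forall A C, measurable A -> measurable C ->
    P (Z @^-1` A `&` stick_var B Y i @^-1` C) =
    (P (Z @^-1` A) * P (stick_var B Y i @^-1` C))%E.
Proof.
move=> [_ IZ] Ni A C mA mC.
have := IZ [fset i]%fset (fun=> stick_var B Y i @^-1` C) _ A mA.
rewrite set_fset1 bigcap_set1; apply => j; rewrite inE => /eqP ->; split => //.
by exists C => //; rewrite setTI.
Qed.

Lemma law_Y m : eq_law (distribution P (Y m)) eta.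
Proof. by move=> A mA; rewrite (sb_Y sb)// -(sb_Y sb 0%N). Qed.

(** The last pair is peeled off: S_(m+1) + R_(m+1) x = S_m + R_m (Y_m B_m + (1 - Y_m) x). The state,
    B_m and Y_m are separated by [indep_future_pair]; integrating over the state first then leaves
    [hstick m f] at the mixed point Y_m B_m + (1 - Y_m) x. *)
Lemma hstickS m f x : bmeas f -> hstick m.+1 f x = Tstick alpha eta (hstick m f) x.
Proof.
move=> bf; have [mf [M fM]] := bf.
pose g (z : measurableTypeR R * measurableTypeR R * measurableTypeR R * measurableTypeR R) : R :=
  f ((z.1.1.1 : R) + (z.1.1.2 : R) * ((z.2 : R) * z.1.2 + (1 - (z.2 : R)) * x)).
have bg : bmeas g.
  have m11 : measurable_fun setT (fun z : measurableTypeR R * measurableTypeR R *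
    measurableTypeR R * measurableTypeR R => z.1.1).
    exact: (measurableT_comp measurable_fst measurable_fst).
  have m111 := measurableT_comp measurable_fst m11.
  have m112 := measurableT_comp measurable_snd m11.
  have m12 : measurable_fun setT (fun z : measurableTypeR R * measurableTypeR R *
    measurableTypeR R * measurableTypeR R => z.1.2).
    exact: (measurableT_comp measurable_snd measurable_fst).
  split; last by exists M => z; exact: fM.
  apply: (measurableT_comp mf); apply: measurable_funD => //; apply: measurable_funM => //.
  apply: measurable_funD; first exact: measurable_funM.
  by apply: measurable_funM => //; apply: measurable_funB.
pose U := pack_mfun (measurable_stick_state m).
have mUB : measurable_fun setT (fun w => (U w, B m w)) by exact: measurable_fun_pair.
pose UB := pack_mfun mUB.
have iUB := indep_future_pair stick_indep (i0 := inl m) (indep_future_state m).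
have -> : hstick m.+1 f x = (\int[P]_w g (UB w, Y m w))%R.
  apply: eq_Rintegral => w _; rewrite /g /= stick_sumS stick_restS; congr (f _).
  by rewrite -addrA -[_ * _ * x]mulrA -mulrDr.
rewrite bint_indep//; last by move=> A C mA mC; exact: (var_indep (i := inr m) iUB).
pose g2 (z : measurableTypeR R * measurableTypeR R * measurableTypeR R) : R :=
  (\int[eta]_y g (z, y))%R.
have bg2 : bmeas g2 by exact: bmeas_bint.
transitivity (\int[P]_w g2 (U w, B m w))%R.
  apply: eq_Rintegral => w _; rewrite /g2 -(bint_eq_law _ (law_Y m)).
  by rewrite bint_distribution//; exact: bmeas_pair1.
rewrite bint_indep//; last first.
  by move=> A C mA mC; exact: (var_indep (i := inl m) (indep_future_state m)).
transitivity (\int[P]_w \int[alpha]_b g2 (U w, b))%R.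
  apply: eq_Rintegral => w _; rewrite -(bint_eq_law _ (sb_B sb m)).
  by rewrite bint_distribution//; exact: bmeas_pair1.
have bgw : bmeas (fun z : T * measurableTypeR R * measurableTypeR R => g (U z.1.1, z.1.2, z.2)).
  have [mg [N gN]] := bg; split; last by exists N => z; exact: gN.
  apply: (measurableT_comp mg); apply: measurable_fun_pair => //.
  apply: measurable_fun_pair; last exact: (measurableT_comp measurable_snd measurable_fst).
  apply: measurableT_comp => //.
  exact: (measurableT_comp measurable_fst measurable_fst).
rewrite (bint_swap P alpha (f := fun z => g2 (U z.1, z.2)))/=; last first.
  exact: (bmeas_bint eta bgw).
apply: eq_Rintegral => b _; rewrite /g2.
rewrite (bint_swap P eta (f := fun z => g (U z.1, b, z.2)))//=.
have [mg [N gN]] := bg; split; last by exists N => z; exact: gN.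
apply: (measurableT_comp mg); apply: measurable_fun_pair; last exact: measurable_snd.
have mU1 : measurable_fun setT (fun z : T * measurableTypeR R => U z.1).
  exact: (measurableT_comp (measurable_funPT U) measurable_fst).
exact: (measurable_fun_pair mU1 (measurable_cst _)).
Qed.

Lemma hstick0 f x : hstick 0 f x = f x.
Proof.
rewrite /hstick /stick_sum /stick_rest.
under eq_Rintegral => w _ do rewrite /series /= big_geq// big_ord0 mul1r add0r.
by rewrite Rintegral_cst//= probability_setT mulr1.
Qed.

Lemma hstick_iter m f : bmeas f -> hstick m f = iter m (Tstick alpha eta) f.
Proof.
move=> bf; elim: m => [|m IH]; first by apply/funext => x; rewrite hstick0.
by apply/funext => x; rewrite hstickS// iterS -IH.
Qed.

End StickDynamics.

(** * Almost sure convergence of the series, and measurability of its sum *)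

Lemma ae_cvg_series {d} {T : measurableType d} {R : realType} (P : probability T R)
  (v : nat -> T -> R) (K : R) : (forall m, bmeas (v m)) -> (forall m w, 0 <= v m w) ->
  (forall n, \sum_(m < n) (\int[P]_w v m w)%R <= K) ->
  {ae P, forall w, cvgn (series (v^~ w))}.
Proof.
move=> bv v0 vK.
pose g w := (\sum_(0 <= m <oo) (v m w)%:E)%E.
have g0 w : (0 <= g w)%E by apply: nneseries_ge0 => m _ _; rewrite lee_fin.
have mv m : measurable_fun setT (fun w => (v m w)%:E).
  by apply/measurable_EFinP; exact: bmeas_measurable.
have mg : measurable_fun setT g.
  by apply: ge0_emeasurable_sum => // m w _ _; rewrite lee_fin.
have gK : (\int[P]_w g w <= K%:E)%E.
  rewrite integral_nneseries//; last by move=> m w _; rewrite lee_fin.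
  apply: lime_le.
    by apply: is_cvg_nneseries => m _ _; apply: integral_ge0 => w _; rewrite lee_fin.
  near=> n; rewrite big_mkord.
  under eq_bigr => m _ do rewrite bintE//.
  by rewrite sumEFin lee_fin.
have ig : P.-integrable setT g.
  apply/integrableP; split => //.
  under eq_integral => w _ do rewrite gee0_abs//.
  by rewrite (le_lt_trans gK)// ltry.
have [N [mN N0 sN]] := integrable_ae measurableT ig.
exists N; split => // w wN; apply: sN => /= /(_ Logic.I) gw; apply: wN.
apply: nondecreasing_is_cvgn.
  by apply: nondecreasing_series => m _ _.
exists (fine (g w)) => _ [n _ <-]; rewrite -lee_fin fineK//.
rewrite /series /= -sumEFin; apply: nneseries_lim_ge => m _ _.
by rewrite lee_fin.
Unshelve. all: by end_near. Qed.

(** Applied with c = ln (1 + |x|) / ln r, where the sum bounds the number of powers of r that |x|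
    exceeds. *)
Lemma sum_nat_lt_le {R : realType} (c : R) (n : nat) : 0 <= c ->
  \sum_(m < n) ((m%:R < c)%R : nat)%:R <= 1 + c.
Proof.
move=> c0; have nlt k : \sum_(m < k) ((m%:R < c)%R : nat)%:R <= k%:R :> R.
  rewrite -[leRHS](_ : \sum_(m < k) 1 = k%:R); last by rewrite sumr_const card_ord.
  by apply: ler_sum => m _; case: (_ < _).
elim: n => [|n IH]; first by rewrite big_ord0 addr_ge0.
have [nc|cn] := boolP (n%:R < c).
  by rewrite (le_trans (nlt _))// -natr1 addrC lerD2l ltW.
by rewrite big_ord_recr /= (negbTE cn) addr0.
Qed.

Lemma sum_geometric_le {R : realType} (q : R) (n : nat) : 0 <= q -> q < 1 ->
  \sum_(m < n) q ^+ m <= (1 - q)^-1.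
Proof.
move=> q0 q1; have h : 0 < 1 - q by rewrite subr_gt0.
rewrite -[leRHS]mul1r ler_pdivlMr//.
have E := subrX1 q n; have qn : 0 <= q ^+ n by rewrite exprn_ge0.
by rewrite mulrC -opprB mulNr -E; lra.
Qed.

Lemma bint_sum {d} {X : measurableType d} {R : realType}
  (m : {finite_measure set X -> \bar R}) (f : nat -> X -> R) (n : nat) :
  (forall k, bmeas (f k)) ->
  bmeas (fun x => \sum_(k < n) f k x) /\
  (\int[m]_x \sum_(k < n) f k x = \sum_(k < n) \int[m]_x f k x)%R.
Proof.
move=> bf; elim: n => [|n [bn En]].
  split; first by under eq_fun => x do rewrite big_ord0; exact: bmeas_cst.
  rewrite big_ord0; under eq_Rintegral => x _ do rewrite big_ord0.
  by rewrite Rintegral_cst// mul0r.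
split.
  by under eq_fun => x do rewrite big_ord_recr /=; exact: bmeasD.
rewrite big_ord_recr /= -En -bintD//.
by apply: eq_Rintegral => x _; rewrite big_ord_recr.
Qed.

Section StickConvergence.
Context {dT : measure_display} {T : measurableType dT} {R : realType}.
Variables (P : probability T R) (t : R) (alpha : probability (measurableTypeR R) R).
Variables (B Y : nat -> {RV P >-> measurableTypeR R}).
Hypothesis sb : stick_breaking t alpha P B Y.
Hypothesis alphaFT : FT1 alpha.

Let eta := distribution P (Y 0).

Lemma eta_itv : eta (~` `]0%R, 1%R[%classic) = 0%E.
Proof.
rewrite [LHS](sb_Y sb 0%N); last exact: measurableC.
by rewrite /beta1 setICl integral_set0.
Qed.

Lemma ae_Y_itv : {ae P, forall w, forall m, 0 < (Y m w : R) < 1}.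
Proof.
apply/ae_foralln => m; exists (Y m @^-1` (~` `]0%R, 1%R[%classic)); split.
- by rewrite -[X in measurable X]setTI; apply: measurable_funPT => //; exact: measurableC.
- by rewrite -[LHS]/(distribution P (Y m) _) (law_Y sb)//; [exact: eta_itv|exact: measurableC].
- by move=> w /= h; rewrite in_itv.
Qed.

(** On (0, 1), which carries the law of the Y_k, this is 1 - y; elsewhere it stays in [0, 1]. Hence
    the products [Q] below are in [0, 1] everywhere and equal the residual masses almost surely. *)
Let phi (y : measurableTypeR R) : R := Num.min 1 `|1 - (y : R)|.

Let bphi : bmeas phi.
Proof.
split; last by exists 1 => y; rewrite ger0_norm ?ge_min ?lexx// le_min ler01 normr_ge0.
apply: measurable_minr => //; apply: measurableT_comp => //.
by apply: measurable_funB.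
Qed.

Let phi0 y : 0 <= phi y. Proof. by rewrite le_min ler01 normr_ge0. Qed.
Let phi1 y : phi y <= 1. Proof. by rewrite ge_min lexx. Qed.

Let q : R := (\int[eta]_y phi y)%R.

Let q0 : 0 <= q. Proof. by apply: Rintegral_ge0 => y _; exact: phi0. Qed.

(** On (0, 1) phi is less than 1; if its mean were 1, that interval, which has full measure, would
    be a null set. *)
Let q1 : q < 1.
Proof.
rewrite lt_neqAle; apply/andP; split; last first.
  rewrite (le_trans (bint_le eta bphi (bmeas_cst 1) phi1))//.
  by rewrite prob_bint_cst.
apply/eqP => qE.
have b1 : bmeas (fun y => 1 - phi y) by apply: bmeasB => //; exact: bmeas_cst.
have : (\int[eta]_y `|(1 - phi y)%:E| = 0)%E.
  under eq_integral => y _ do rewrite abse_EFin ger0_norm ?subr_ge0//.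
  rewrite bintE// bintB//; last exact: bmeas_cst.
  by rewrite -/q qE prob_bint_cst subrr.
move=> /(ae_eq_integral_abs eta measurableT _).1 => /(_ _)[].
  by apply/measurable_EFinP; exact: bmeas_measurable.
move=> N [mN N0 sN].
have NI : `]0%R, 1%R[%classic `<=` N.
  move=> y /=; rewrite in_itv /= => /andP[y0 y1]; apply: sN => /= /(_ Logic.I) [] /eqP.
  rewrite subr_eq0 /phi minEle ger0_norm ?subr_ge0 ?(ltW y1)//.
  rewrite lerBrDr gerDl leNgt y0 /= => /eqP h.
  by move: y0; rewrite -(subKr 1 (y : R)) -h subrr ltxx.
have : eta setT = 0%E.
  apply/eqP; rewrite eq_le measure_ge0 andbT.
  rewrite -(setvU `]0%R, 1%R[%classic) (le_trans (measureU2 _ _ _))//.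
  - exact: measurableC.
  - have l1 : (eta (~` `]0%R, 1%R[%classic) <= 0)%E by rewrite eta_itv.
    have l2 : (eta `]0%R, 1%R[%classic <= 0)%E by rewrite -N0 le_measure ?inE.
    by rewrite -[leRHS]adde0; exact: leeD l1 l2.
have e1 : eta setT = 1%E by exact: probability_setT.
by rewrite e1 => /eqP; rewrite onee_eq0.
Qed.

Let Q (m : nat) (w : T) : measurableTypeR R := \prod_(k < m) phi (Y k w).

Let Q0 m w : 0 <= (Q m w : R). Proof. by apply: prodr_ge0 => k _; exact: phi0. Qed.
Let Q1 m w : (Q m w : R) <= 1.
Proof. by apply: prodr_ile1 => k _; rewrite phi0 phi1. Qed.

Let QS m w : Q m.+1 w = (Q m w : R) * phi (Y m w).
Proof. by rewrite /Q big_ord_recr. Qed.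

Let indep_Q m : indep_future P B Y m.*2 (Q m).
Proof.
elim: m => [|m IH].
  rewrite (_ : Q 0 = fun=> 1); first exact: indep_future_cst.
  by apply/funext => w; rewrite /Q big_ord0.
have h1 : indep_future P B Y (stick_rank (inr m)) (Q m).
  case: IH => mQ IQ; split => // J A JA; apply: IQ => i iJ.
  by have [h1 h2] := JA i iJ; split => //; exact: ltnW.
have h2 := indep_future_pair (stick_indep sb) (i0 := inr m) h1.
have mu : measurable_fun setT (fun z : measurableTypeR R * measurableTypeR R =>
    (z.1 : R) * phi z.2 : measurableTypeR R).
  apply: measurable_funM; first exact: measurable_fst.
  exact: (measurableT_comp (bmeas_measurable bphi) measurable_snd).
have := indep_future_comp mu h2.
rewrite (_ : _ \o _ = Q m.+1)//.
by apply/funext => w; rewrite QS.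
Qed.

Let mQ m : measurable_fun setT (Q m). Proof. by have [] := indep_Q m. Qed.

Let bQ m : bmeas (Q m : T -> R).
Proof. by split; [exact: mQ|exists 1 => w; rewrite ger0_norm ?Q1 ?Q0]. Qed.

Let EQ m : (\int[P]_w Q m w)%R = q ^+ m.
Proof.
elim: m => [|m IH].
  by under eq_Rintegral => w _ do rewrite /Q big_ord0; rewrite prob_bint_cst.
(* Q has values in [0, 1], so it can be replaced by phi (1 - Q); the test function is then bounded
   on the whole product space, as [bint_indep] requires. *)
have phiQ k w : phi (1 - (Q k w : R)) = Q k w.
  by rewrite /phi subKr ger0_norm ?Q0// (min_idPr (Q1 _ _)).
have b1 : bmeas (fun x : measurableTypeR R => phi (1 - (x : R))).
  case: bphi => mp [M pM]; split; last by exists M => x.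
  by apply: (measurableT_comp mp); apply: measurable_funB.
have bm : bmeas (fun z : measurableTypeR R * measurableTypeR R => phi (1 - (z.1 : R)) * phi z.2).
  apply: bmeasM.
    by apply: (bmeas_comp measurable_fst (bmeas_measurable b1)); case: b1.
  by apply: (bmeas_comp measurable_snd (bmeas_measurable bphi)); case: bphi.
transitivity (\int[P]_w (phi (1 - (pack_mfun (mQ m) w : R)) * phi (Y m w)))%R.
  by apply: eq_Rintegral => w _; rewrite QS [X in _ = X * _]phiQ.
have indQ A C : measurable A -> measurable C ->
    P (pack_mfun (mQ m) @^-1` A `&` Y m @^-1` C) =
    (P (pack_mfun (mQ m) @^-1` A) * P (Y m @^-1` C))%E.
  move=> mA mC; apply: (var_indep (i := inr m) (indep_Q m)) => //=.
rewrite (bint_indep indQ bm)/=.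
transitivity (\int[P]_w ((Q m w : R) * q))%R.
  apply: eq_Rintegral => w _; rewrite [in LHS](phiQ m w) bintZ; last first.
    by apply: (bmeas_comp _ (bmeas_measurable bphi)) => //; case: bphi.
  congr (_ * _); rewrite -(bint_distribution P (Y m) bphi).
  exact: (bint_eq_law _ (law_Y sb m)).
under eq_Rintegral => w _ do rewrite mulrC.
by rewrite bintZ// IH exprS.
Qed.

(** Chosen to satisfy both 1 < r and r q < 1: the levels r^m grow geometrically while r^m E Q_m
    remains summable. *)
Let r : R := 2 / (1 + q).

Let oneq : 0 < 1 + q. Proof. by move: q0; lra. Qed.

Let r1 : 1 < r. Proof. by rewrite /r ltr_pdivlMr//; move: q1; lra. Qed.

Let rq1 : r * q < 1.
Proof. by rewrite /r mulrAC ltr_pdivrMr//; move: q1; lra. Qed.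

Let big_set m : set (measurableTypeR R) := [set x | r ^+ m < `|x : R|].

Let measurable_big_set m : measurable (big_set m).
Proof.
rewrite (_ : big_set m = (fun x : measurableTypeR R => `|x : R|) @^-1` `]r ^+ m, +oo[%classic).
  rewrite -[X in measurable X]setTI.
  by apply: normr_measurable => //; exact: measurable_itv.
by apply/seteqP; split => x /=; rewrite in_itv /= andbT.
Qed.

(** Here the logarithmic moment is used: r^m < |x| forces m < ln (1 + |x|) / ln r, so x lies in at
    most 1 + ln (1 + |x|) / ln r of these sets. *)
Let sum_big_set n : \sum_(m < n) (\int[alpha]_x \1_(big_set m) x)%R <=
  1 + (\int[alpha]_x ln (1 + `|x : R|))%R / ln r.
Proof.
have bI m : bmeas (\1_(big_set m) : measurableTypeR R -> R) by exact: bmeas_indic.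
have [bS <-] := bint_sum alpha n bI.
have L0 (x : R) : 0 <= ln (1 + `|x|) by rewrite ln_ge0// lerDl.
have lr0 : 0 < ln r by rewrite ln_gt0.
have mL : measurable_fun setT (fun x : measurableTypeR R => ln (1 + `|x : R|)).
  apply: measurableT_comp => //; apply: measurable_funD => //.
have iL : alpha.-integrable setT (EFin \o (fun x : measurableTypeR R => ln (1 + `|x : R|))).
  apply/integrableP; split; first exact/measurable_EFinP.
  by under eq_integral => x _ do rewrite /= ger0_norm//.
rewrite mulrC -RintegralZl// -[X in X + _](prob_bint_cst alpha) -RintegralD//; last 2 first.
- by apply: bmeas_integrable; exact: bmeas_cst.
- exact: integrableZl iL.
apply: le_Rintegral => //.
- exact: bmeas_integrable.
- have i1 : alpha.-integrable setT (EFin \o (fun _ : measurableTypeR R => 1 : R)).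
    by apply: bmeas_integrable; exact: bmeas_cst.
  exact: (integrableD measurableT i1 (integrableZl measurableT (ln r)^-1 iL)).
move=> x _; have c0 : 0 <= (ln r)^-1 * ln (1 + `|x : R|).
  by rewrite mulr_ge0// invr_ge0 ltW.
rewrite (le_trans _ (sum_nat_lt_le n c0))//; apply: ler_sum => m _.
rewrite indicE; case: (boolP (x \in _)); last by case: (_ < _).
rewrite inE /big_set /= => xr; rewrite ler_nat (_ : (m%:R < _) = true)//.
rewrite ltr_pdivlMl// mulr_natr -lnXn; last by rewrite (lt_trans _ r1).
have rm0 : 0 < r ^+ m by rewrite exprn_gt0// (lt_trans _ r1).
have rx : r ^+ m < 1 + `|x : R| by rewrite (lt_le_trans xr)// lerDr.
by rewrite ltr_ln ?posrE// (lt_trans rm0).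
Qed.

(** The truncation at 1 gives a mean controlled by the tails of B: when |B_m| > r^m the first term
    is at most 1, otherwise it is at most r^m Q_m. The added Q_m forces the residual masses to 0. *)
Let v m w : R := Num.min 1 ((Q m w : R) * `|B m w : R|) + Q m w.

Let v0 m w : 0 <= v m w.
Proof. by rewrite addr_ge0// le_min ler01 mulr_ge0. Qed.

Let bv1 m : bmeas (fun w => Num.min 1 ((Q m w : R) * `|B m w : R|)).
Proof.
split; last by exists 1 => w; rewrite ger0_norm ?ge_min ?lexx// le_min ler01 mulr_ge0.
apply: measurable_minr => //; apply: measurable_funM; first exact: mQ.
exact: (measurableT_comp (@normr_measurable R setT) (measurable_funPT (B m))).
Qed.

Let bv m : bmeas (v m). Proof. exact: bmeasD. Qed.

Let Ev m : (\int[P]_w v m w)%R <=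
  (\int[alpha]_x \1_(big_set m) x)%R + (r * q) ^+ m + q ^+ m.
Proof.
rewrite bintD// EQ lerD2r.
have bI : bmeas (\1_(big_set m) : measurableTypeR R -> R) by exact: bmeas_indic.
have bIB : bmeas (fun w => \1_(big_set m) (B m w) : R).
  by apply: (bmeas_comp _ (bmeas_measurable bI)) => //; case: bI.
have r0 : 0 < r ^+ m by rewrite exprn_gt0// (lt_trans ltr01 r1).
rewrite (@le_trans _ _ (\int[P]_w (\1_(big_set m) (B m w) + r ^+ m * Q m w))%R)//.
  apply: bint_le => // [|w].
    by apply: bmeasD => //; apply: bmeasM => //; exact: bmeas_cst.
  rewrite indicE; case: (boolP (_ \in _)) => [_|].
    by rewrite ge_min lerDl mulr_ge0 ?(ltW r0)//.
  rewrite notin_setE /big_set /= => /negP; rewrite -leNgt => Br.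
  by rewrite add0r ge_min [X in _ || X](_ : _ = true) ?orbT// mulrC ler_wpM2r.
rewrite bintD//; last by apply: bmeasM => //; exact: bmeas_cst.
rewrite bintZ// EQ -exprMn lerD2r.
rewrite -(bint_distribution P (B m) bI) (bint_eq_law _ (sb_B sb m)).
exact: lexx.
Qed.

Lemma stick_convergence : {ae P, forall w,
  (fun m => stick_rest Y m w : R) @ \oo --> (0 : R) /\
  cvgn (fun m => stick_sum B Y m w : R)}.
Proof.
have vK n : \sum_(m < n) (\int[P]_w v m w)%R <=
    1 + (\int[alpha]_x ln (1 + `|x : R|))%R / ln r + (1 - r * q)^-1 + (1 - q)^-1.
  have rq0 : 0 <= r * q by rewrite mulr_ge0// (le_trans ler01)// ltW.
  apply: (@le_trans _ _ (\sum_(m < n)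
    ((\int[alpha]_x \1_(big_set m) x)%R + (r * q) ^+ m + q ^+ m))).
    by apply: ler_sum => m _; exact: Ev.
  by rewrite !big_split /= !lerD// ?sum_geometric_le// sum_big_set.
have [N1 [mN1 N10 sN1]] := ae_cvg_series bv v0 vK.
have [N2 [mN2 N20 sN2]] := ae_Y_itv.
exists (N1 `|` N2); split; [exact: measurableU|exact: null_set_setU|].
move=> w /= wn; apply: contrapT => /not_orP[w1 w2]; apply: wn.
have {w2} Yw : forall m, 0 < (Y m w : R) < 1 by apply: contrapT => h; apply: w2; exact: sN2.
have {w1} cv : cvgn (series (v^~ w)) by apply: contrapT => h; apply: w1; exact: sN1.
have RQ m : stick_rest Y m w = Q m w.
  apply: eq_bigr => k _; have /andP[y0 y1] := Yw k.
  rewrite /phi ger0_norm ?subr_ge0 ?ltW//; apply/esym/min_idPr.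
  by rewrite lerBlDr lerDl ltW.
have v_0 := cvg_series_cvg_0 cv.
have Qv m : (Q m w : R) <= v m w by rewrite lerDr le_min ler01 mulr_ge0.
split.
  under eq_fun => m do rewrite RQ.
  apply: (@squeeze_cvgr _ _ _ _ (fun=> 0) (v^~ w)) => //; last exact: cvg_cst.
  by apply: nearW => m; rewrite Q0 Qv.
pose u m : R := (Q m w : R) * `|B m w : R|.
have u0 m : 0 <= u m by rewrite mulr_ge0.
have u_0 : u @ \oo --> (0 : R).
  apply: (@squeeze_cvgr _ _ _ _ (fun=> 0) (v^~ w)) => //; last exact: cvg_cst.
  near=> m; rewrite u0 /=.
  have : v m w < 1.
    near: m; apply: (cvgr_lt 0) => //.
  rewrite /v -/(u m) => vm1; move: (Q0 m w); case: (leP 1 (u m)) vm1 => h; lra.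
have [M [_ HM]] := cvg_seq_bounded (cvgP _ u_0).
pose K := `|M| + 1.
have uK m : u m <= K.
  rewrite -[u m]ger0_norm//; apply: (HM K) => //.
  by rewrite /K (le_lt_trans (ler_norm M))// ltrDl.
have K1 : 1 <= K by rewrite lerDr.
have uv m : u m <= K * v m w.
  rewrite (@le_trans _ _ (K * Num.min 1 (u m)))//.
    case: (leP 1 (u m)) => h; first by rewrite mulr1.
    by rewrite ler_peMl.
  by rewrite ler_wpM2l ?lerDl ?(le_trans ler01 K1).
apply: normed_cvg.
apply: (@series_le_cvg _ _ (fun m => K * v m w)) => [m|m|m|].
- exact: normr_ge0.
- by rewrite mulr_ge0// (le_trans ler01).
- apply: (le_trans _ (uv m)).
  rewrite -[leLHS]/(`|(Y m w : R) * (stick_rest Y m w : R) * (B m w : R)|) RQ !normrM.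
  have /andP[y0 y1] := Yw m.
  rewrite /u ler_wpM2r// (ger0_norm (Q0 m w)) ger0_norm ?ler_piMl// ltW//.
- by rewrite (_ : series _ = K \*: series (v^~ w)); [exact: is_cvgZr|apply/funext => n; rewrite /series /= scaler_sumr].
Unshelve. all: by end_near. Qed.

End StickConvergence.

(** The Cauchy criterion with all quantifiers over integers, so that the set of convergence is
    obtained by countable operations. *)
Lemma cvgn_cauchyP {R : realType} (u : nat -> R) :
  cvgn u <-> forall k : nat, exists N : nat, forall m : nat, (N <= m)%N ->
    `|u m - u N| <= k.+1%:R^-1.
Proof.
split=> [cu k|H].
  have k0 : 0 < (2 * k.+1%:R)^-1 :> R by rewrite invr_gt0.
  have /cvgrPdist_le /(_ _ k0) [N _ HN] := cu.
  exists N => m Nm; rewrite -(subrKA (limn u)) (le_trans (ler_normD _ _))//.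
  rewrite (_ : k.+1%:R^-1 = (2 * k.+1%:R)^-1 + (2 * k.+1%:R)^-1); last by field.
  by rewrite lerD//; [rewrite distrC|]; apply: HN => /=.
apply/cauchy_cvgP/cauchy_ballP => e e0.
have [k ke] : exists k : nat, 2 * k.+1%:R^-1 < e.
  have := archi_boundP (ltW (divr_gt0 (ltr0n R 2) e0)).
  set k := Num.bound _ => h; exists k; rewrite ltr_pdivrMr//.
  by move: h; rewrite ltr_pdivrMr// => h; rewrite (lt_trans h)// mulrC ltr_pM2l// ltr_nat.
have [N HN] := H k.
rewrite near_map2; near=> a b; rewrite /ball /= /ball_; apply: le_lt_trans ke.
rewrite -(subrKA (u N)) (le_trans (ler_normD _ _))// mulr_natl mulr2n lerD//.
  by apply: HN; near: a; exact: nbhs_infty_ge.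
by rewrite distrC; apply: HN; near: b; exact: nbhs_infty_ge.
Unshelve. all: by end_near. Qed.

(** Where the sequence diverges [limn] is the default [point]. Replacing the sequence by that
    constant off the measurable set D of convergence gives measurable functions that converge
    everywhere to [limn]. *)
Lemma measurable_fun_limn {d} {T : measurableType d} {R : realType} (S : nat -> T -> R) :
  (forall m, measurable_fun setT (S m)) -> measurable_fun setT (fun w => limn (S^~ w)).
Proof.
move=> mS.
pose D := \bigcap_k \bigcup_N \bigcap_(m in [set m | (N <= m)%N])
  [set w | `|S m w - S N w| <= k.+1%:R^-1].
have DE w : D w <-> cvgn (S^~ w).
  split=> [Dw|/cvgn_cauchyP h]; last by move=> k _; have [N HN] := h k; exists N.
  by apply/cvgn_cauchyP => k; have [N _ HN] := Dw k Logic.I; exists N.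
have mD : measurable D.
  apply: bigcapT_measurable => k; apply: bigcupT_measurable => N.
  apply: bigcap_measurableType => m _.
  have ml : measurable_fun setT (fun w => `|S m w - S N w|).
    by apply: measurableT_comp => //; exact: measurable_funB.
  rewrite (_ : [set w | _] = (fun w => `|S m w - S N w|) @^-1` `]-oo, k.+1%:R^-1]).
    by rewrite -[X in measurable X]setTI; apply: ml => //; exact: measurable_itv.
  by apply/seteqP; split => w /=; rewrite in_itv.
pose F m w : R := \1_D w * S m w + (1 - \1_D w) * (point : R).
apply: (measurable_fun_cvg (h := F)) => [m|w _].
  have m1 : measurable_fun setT (\1_D : T -> R) by exact: measurable_indic.
  apply: measurable_funD; first exact: measurable_funM.
  by apply: measurable_funM => //; exact: measurable_funB.
rewrite /F indicE; have [|] := boolP (w \in D).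
  rewrite inE => /DE cS.
  under eq_fun => m do rewrite mul1r subrr mul0r addr0.
  exact: cS.
rewrite notin_setE => nD.
under eq_fun => m do rewrite mul0r add0r subr0 mul1r.
rewrite dvgP; first exact: cvg_cst.
by move=> h; apply: nD; exact/DE.
Qed.

(** * Invariance under T of the law of the sum, and conversely *)

Section StickLimit.
Context {dT : measure_display} {T : measurableType dT} {R : realType}.
Variables (P : probability T R) (t : R) (alpha : probability (measurableTypeR R) R).
Variables (B Y : nat -> {RV P >-> measurableTypeR R}).
Hypothesis sb : stick_breaking t alpha P B Y.
Hypothesis alphaFT : FT1 alpha.

Let eta := distribution P (Y 0).
Let Tst := Tstick alpha eta.

Definition stick_limit (w : T) : measurableTypeR R :=
  series_sum (fun n => weight Y n w * B n w).

Lemma measurable_stick_limit : measurable_fun setT stick_limit.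
Proof.
apply: (@measurable_fun_limn _ _ _ (fun m w => stick_sum B Y m w : R)) => m.
have h := measurable_stick_state sb m.
exact: (measurableT_comp measurable_fst h).
Qed.

Lemma mu1E : mu1 P B Y = distribution P (pack_mfun measurable_stick_limit).
Proof. by []. Qed.

Lemma measurable_stick_sum m : measurable_fun setT (stick_sum B Y m).
Proof. exact: (measurableT_comp measurable_fst (measurable_stick_state sb m)). Qed.

Lemma measurable_stick_rest m : measurable_fun setT (stick_rest Y m).
Proof. exact: (measurableT_comp measurable_snd (measurable_stick_state sb m)). Qed.

Lemma cvg_hstick (f : measurableTypeR R -> R) (x : measurableTypeR R) : bmeas f ->
  (forall y : R, {for y, continuous (f : R -> R)}) ->
  (fun m => hstick B Y m f x) @ \oo --> (\int[P]_w f (stick_limit w))%R.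
Proof.
move=> [mf [M fM]] cf.
apply: (@bint_cvg _ _ _ P (fun m w => f ((stick_sum B Y m w : R) + stick_rest Y m w * x : R))
  _ M) => //.
- move=> m; apply: (measurableT_comp mf); apply: measurable_funD.
    exact: measurable_stick_sum.
  by apply: measurable_funM => //; exact: measurable_stick_rest.
- exact: (measurableT_comp mf measurable_stick_limit).
have [N [mN N0 sN]] := stick_convergence sb alphaFT.
exists N; split => // w wN; apply: sN => /= -[h1 h2]; apply: wN.
apply: (@cvg_comp _ _ _ (fun m => (stick_sum B Y m w : R) + stick_rest Y m w * x : R) f
  \oo (nbhs (stick_limit w : R))); last exact: cf.
rewrite -[stick_limit w : R]addr0 -(mul0r (x : R)).
by apply: cvgD; [exact: h2|apply: cvgM; [exact: h1|exact: cvg_cst]].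
Qed.

(** T^m (T f) and T^(m+1) f are the same sequence; at the point 0 it tends to E (T f)(X) by the
    first reading and to E f(X) by the second. Each reading requires continuity of the function to
    which the powers of T are applied. *)
Lemma stick_limit_invariant (f : measurableTypeR R -> R) : bmeas f ->
  (forall y : R, {for y, continuous (f : R -> R)}) ->
  (forall y : R, {for y, continuous (Tst f : R -> R)}) ->
  (\int[P]_w Tst f (stick_limit w) = \int[P]_w f (stick_limit w))%R.
Proof.
move=> bf cf cTf; have bTf : bmeas (Tst f) by exact: bmeas_Tstick.
have l1 := cvg_hstick 0 bf cf; have l2 := cvg_hstick 0 bTf cTf.
rewrite -(cvg_lim (@Rhausdorff R) l2); apply/cvg_lim => //.
rewrite (_ : (fun m => hstick B Y m (Tst f) 0) = (fun m => hstick B Y (m + 1)%N f 0)).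
  by rewrite (cvg_shiftn 1 (fun m => hstick B Y m f 0) _).
by apply/funext => m; rewrite !(hstick_iter sb)// addn1 iterSr.
Qed.

(** The integral of T^m f against alpha does not move with m, while T^m f tends boundedly to the
    constant E f(X). *)
Lemma invariant_stick_limit (f : measurableTypeR R -> R) :
  (forall g, bmeas g -> (\int[alpha]_x Tst g x = \int[alpha]_x g x)%R) ->
  bmeas f -> (forall y : R, {for y, continuous (f : R -> R)}) ->
  (\int[alpha]_x f x = \int[P]_w f (stick_limit w))%R.
Proof.
move=> inv bf cf; have [mf [M fM]] := bf.
have bit m : bmeas (iter m Tst f).
  by elim: m => //= m IH; exact: bmeas_Tstick.
have itE m : (\int[alpha]_x iter m Tst f x = \int[alpha]_x f x)%R.
  by elim: m => //= m IH; rewrite inv.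
have c : (fun m => \int[alpha]_x iter m Tst f x)%R @ \oo -->
    (\int[alpha]_x (fun=> \int[P]_w f (stick_limit w)) x)%R.
  apply: (@bint_cvg _ _ _ alpha (fun m => iter m Tst f) _ M) => //.
  - by move=> m; exact: bmeas_measurable.
  - move=> m x; rewrite -(hstick_iter sb)// /hstick.
    have := @bint_norm_le _ _ _ P (fun w => f ((stick_sum B Y m w : R) + stick_rest Y m w * x : R)) M.
    have P1 : fine (P setT) = 1 by rewrite probability_setT.
    rewrite P1 mulr1; apply => //.
    apply: (measurableT_comp mf); apply: measurable_funD.
      exact: measurable_stick_sum.
    by apply: measurable_funM => //; exact: measurable_stick_rest.
  - apply: aeW => x; under eq_fun => m do rewrite -(hstick_iter sb)//.
    exact: cvg_hstick.
rewrite prob_bint_cst in c.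
rewrite -(cvg_lim (@Rhausdorff R) c); apply/esym/cvg_lim => //.
by under eq_fun => m do rewrite itE; exact: cvg_cst.
Qed.

Lemma mu1_of_invariant :
  (forall g, bmeas g -> (\int[alpha]_x Tst g x = \int[alpha]_x g x)%R) ->
  eq_law (mu1 P B Y) alpha.
Proof.
move=> inv; rewrite mu1E.
apply: (@poisson_unique R (distribution P (pack_mfun measurable_stick_limit)) alpha) => p q q0.
have [_ bI] := @cbmeas_cker R (p +i* q) q0.
rewrite bint_distribution//; apply/esym; apply: (invariant_stick_limit inv bI) => y.
exact: (continuous_Im_cker (z := p +i* q) q0).
Qed.

End StickLimit.

(** * Complex-valued functions of a real variable, and the beta identity *)

Section ComplexValuedDerivative.
Context {R : realType}.
Implicit Types (f g : R -> R[i]) (x : R).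

Lemma ReD (u v : R[i]) : Re (u + v) = Re u + Re v.
Proof. by case: u v => [a b] [c d]. Qed.

Lemma ImD (u v : R[i]) : Im (u + v) = Im u + Im v.
Proof. by case: u v => [a b] [c d]. Qed.

Lemma ReN (u : R[i]) : Re (- u) = - Re u. Proof. by case: u. Qed.

Lemma ImN (u : R[i]) : Im (- u) = - Im u. Proof. by case: u. Qed.

Definition cderive f x (df : R[i]) : Prop :=
  is_derive x (1 : R) (fun y => Re (f y)) (Re df) /\
  is_derive x (1 : R) (fun y => Im (f y)) (Im df).

Lemma cderive_cst (c : R[i]) x : cderive (fun=> c) x 0.
Proof. by split; exact: is_derive_cst. Qed.

Lemma cderiveM f g x (df dg : R[i]) : cderive f x df -> cderive g x dg ->
  cderive (fun y => f y * g y) x (df * g x + f x * dg).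
Proof.
move=> [rf jf] [rg jg]; split.
- rewrite (_ : (fun _ => _) = (fun y => Re (f y)) * (fun y => Re (g y)) -
    (fun y => Im (f y)) * (fun y => Im (g y))); last by apply/funext => y; rewrite ReM.
  apply: is_derive_eq; rewrite ReD !ReM /GRing.scale /=; ring.
- rewrite (_ : (fun _ => _) = (fun y => Re (f y)) * (fun y => Im (g y)) +
    (fun y => Im (f y)) * (fun y => Re (g y))); last by apply/funext => y; rewrite ImM.
  apply: is_derive_eq; rewrite ImD !ImM /GRing.scale /=; ring.
Qed.

Lemma cderiveX f x (df : R[i]) n : cderive f x df ->
  cderive (fun y => f y ^+ n) x (n%:R * f x ^+ n.-1 * df).
Proof.
move=> cf; elim: n => [|n IH].
  by rewrite !mul0r; exact: cderive_cst.
under eq_fun do rewrite exprS.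
have := cderiveM cf IH; congr (cderive _ _ _).
case: n {IH} => [|n]; first by rewrite !mul0r mulr0 addr0 mul1r mulrC expr0.
by rewrite /= -[in RHS]natr1 exprS; ring.
Qed.

Lemma cderive_cker (z : R[i]) x : 0 < Im z ->
  cderive (cker z) x (- cker z x ^+ 2).
Proof.
move=> z0; have c0 := cker_den_gt0 x z0.
have D1 : is_derive x (1 : R) (fun w : R => w - Re z) 1.
  by apply: is_derive_eq; rewrite subr0.
have D : is_derive x (1 : R) (fun w => (w - Re z) ^+ 2 + Im z ^+ 2) (2 * (x - Re z)).
  rewrite (_ : (fun _ => _) = (fun w : R => w - Re z) * (fun w : R => w - Re z) + cst (Im z ^+ 2)); last first.
    by apply/funext => w; rewrite expr2.
  apply: is_derive_eq; rewrite addr0 /GRing.scale /=; ring.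
have DV := is_deriveV (f := fun w => (w - Re z) ^+ 2 + Im z ^+ 2) (lt0r_neq0 c0) D.
split.
- rewrite (_ : (fun _ => _) = (fun w : R => w - Re z) *
     (fun w => ((w - Re z) ^+ 2 + Im z ^+ 2)^-1)); last by apply/funext => w; rewrite Re_cker.
  apply: is_derive_eq; rewrite ReN expr2 ReM Re_cker Im_cker /GRing.scale /=.
  by field; rewrite lt0r_neq0.
- rewrite (_ : (fun _ => _) = Im z \*: (fun w => ((w - Re z) ^+ 2 + Im z ^+ 2)^-1)); last first.
    by apply/funext => w; rewrite Im_cker.
  apply: is_derive_eq; rewrite ImN expr2 ImM Re_cker Im_cker /GRing.scale /=.
  by field; rewrite lt0r_neq0.
Qed.

Lemma cderive_affine f (a c x : R) (df : R[i]) : cderive f (a * x + c) df ->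
  cderive (fun y => f (a * y + c)) x (a%:C * df).
Proof.
move=> [rf jf].
have D : is_derive x (1 : R) (fun y => a * y + c) a.
  rewrite (_ : (fun _ => _) = a \*: (@id R) + cst c)//.
  by apply: is_derive_eq; rewrite addr0 /GRing.scale /= mulr1.
split.
- have C := @is_derive1_comp R (fun y => Re (f y)) (fun y => a * y + c) x _ _ rf D.
  by apply: (is_derive_eq C); rewrite ReM /= mul0r subr0 mulrC.
- have C := @is_derive1_comp R (fun y => Im (f y)) (fun y => a * y + c) x _ _ jf D.
  by apply: (is_derive_eq C); rewrite ImM /= mul0r addr0 mulrC.
Qed.

Lemma cderive_continuous f x (df : R[i]) : cderive f x df ->
  {for x, continuous (fun y => Re (f y))} /\ {for x, continuous (fun y => Im (f y))}.
Proof.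
move=> [[h1 _] [h2 _]].
by split; apply: differentiable_continuous; apply/derivable1_diffP.
Qed.

End ComplexValuedDerivative.


Section BetaIdentity.
Context {R : realType}.
Local Notation leb := (@lebesgue_measure R).

Definition beta1_pdf (n : nat) (y : R) : R := \1_`]0%R, 1%R[ y * (n%:R * (1 - y) ^+ n.-1).

Lemma beta1_law_measure (n : nat) : (0 < n)%N ->
  exists nu : {finite_measure set (measurableTypeR R) -> \bar R},
    eq_law nu (beta1 n%:R) /\
    forall f, bmeas f -> (\int[nu]_y f y =
      \int[leb]_(y in `]0%R, 1%R[) (f y * (n%:R * (1 - y) ^+ n.-1)))%R.
Proof.
move=> n0.
have mp : measurable_fun [set: measurableTypeR R] (fun y : R => n%:R * (1 - y) ^+ n.-1).
  apply: measurable_funM => //; apply: measurable_funX; exact: measurable_funB.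
have mf : measurable_fun [set: measurableTypeR R] (beta1_pdf n).
  by apply: measurable_funM => //; exact: measurable_indic.
have f0 y : 0 <= beta1_pdf n y.
  rewrite /beta1_pdf indicE; case: (boolP (_ \in _)); last by rewrite mul0r.
  rewrite inE /= in_itv /= => /andP[y0 y1].
  by rewrite !mulr_ge0// exprn_ge0// subr_ge0 ltW.
have iF : leb.-integrable setT (EFin \o beta1_pdf n).
  pose h (y : measurableTypeR R) : R := n%:R * (1 - (y : R)) ^+ n.-1.
  have mI : measurable (`]0%R, 1%R[%classic : set (measurableTypeR R)) by exact: measurable_itv.
  have ih : leb.-integrable `]0%R, 1%R[ (EFin \o h).
    apply: (measurable_bounded_integrable (f := h)) => //.
    - have e := @lebesgue_measure_itv R `]0%R, 1%R[; rewrite /= lte_fin ltr01 -EFinB in e.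
      by rewrite [X in (X < _)%E]e ltry.
    - exact: (measurable_funS measurableT (@subsetT _ _) mp).
    - exists n%:R; split; first exact: num_real.
      move=> N nN y /=; rewrite in_itv /= => /andP[y0 y1]; apply: le_trans (ltW nN).
      rewrite ger0_norm /h ?mulr_ge0 ?exprn_ge0 ?subr_ge0 ?(ltW y1)// ler_piMr//.
      by rewrite exprn_ile1// ?subr_ge0 ?(ltW y1)// lerBlDr lerDl ltW.
  have := (integrable_mkcond (EFin \o h) mI).1 ih.
  rewrite (_ : (EFin \o h) \_ _ = EFin \o beta1_pdf n)//.
  apply/funext => y; rewrite patchE /= /beta1_pdf indicE.
  by case: (_ \in _); rewrite ?mul1r ?mul0r.
have [nu [nuA nuE]] := density_exists mf f0 iF.
exists nu; split=> [A mA|f bf].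
  rewrite nuA /beta1 integral_mkcondr; apply: eq_integral => y _.
  rewrite patchE /beta1_pdf indicE; case: (boolP (_ \in _)); last by rewrite mul0r.
  rewrite inE /= in_itv /= => /andP[y0 y1]; rewrite mul1r.
  have -> : n%:R - 1 = n.-1%:R :> R by rewrite -[in LHS](prednK n0) -natr1 addrK.
  by rewrite powR_mulrn// subr_ge0 ltW.
rewrite nuE// [RHS]Rintegral_mkcond; apply: eq_Rintegral => y _.
rewrite patchE /beta1_pdf indicE; case: (_ \in _); last by rewrite mul0r mulr0.
by rewrite mul1r.
Qed.

(** The two-atom case of the Dirichlet identity: the weights (y, 1 - y) are Dirichlet with masses 1
    and n, and the mean of the averaged w - z to the power -(1 + n) splits into one factor for each
    atom, with its mass as exponent. *)
Lemma beta_identity (n : nat) (eta : probability (measurableTypeR R) R) (z : R[i]) (b x : R) :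
  (0 < n)%N -> eq_law eta (beta1 n%:R) -> 0 < Im z ->
  cint eta (fun y : measurableTypeR R => cker z ((y : R) * b + (1 - (y : R)) * x) ^+ n.+1) =
  cker z b * cker z x ^+ n.
Proof.
move=> n0 eta_beta z0.
have [nu [nu_beta nuE]] := beta1_law_measure n0.
have enu : eq_law eta nu by move=> A mA; rewrite eta_beta// nu_beta.
rewrite (cint_eq_law _ enu).
pose s (y : R) := (b - x) * y + x.
have sE y : y * b + (1 - y) * x = s y by rewrite /s; ring.
pose g y : R[i] := cker z (s y).
(* Since s y + (1 - y) (b - x) = b, h' = - (b - z) g^2, so that the integrand
   is the derivative of - h^n / (b - z). *)
pose h y : R[i] := (1 - y)%:C * g y.
pose F y : R[i] := - cker z b * h y ^+ n.
have dg (y : R) : cderive g y ((b - x)%:C * - (cker z (s y)) ^+ 2).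
  exact: (cderive_affine (cderive_cker _ z0)).
have d1 (y : R) : cderive (fun y => (1 - y)%:C) y (-1).
  split; last by rewrite /= oppr0; exact: is_derive_cst.
  by rewrite /=; apply: is_derive_eq; rewrite add0r mul1r.
have gV y : g y * ((s y)%:C - z) = 1 by rewrite /g mulVf// cker_den_neq0.
have bV : cker z b * (b%:C - z) = 1 by rewrite mulVf// cker_den_neq0.
have dh (y : R) : cderive h y (- (b%:C - z) * g y ^+ 2).
  have := cderiveM (d1 y) (dg y); congr (cderive _ _ _).
  have sC : (s y)%:C = (b%:C - x%:C) * y%:C + x%:C :> R[i].
    by rewrite /s rmorphD rmorphM rmorphB.
  have := gV y; rewrite -/(g y) sC rmorphB /= rmorphB /=.
  move: (g y) (b%:C) (x%:C) (y%:C) => u b' x' y' e.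
  have e2 : u = u ^+ 2 * ((b' - x') * y' + x' - z) by rewrite expr2 -mulrA e mulr1.
  rewrite {1}e2; ring.
pose k y : R[i] := (n%:R * (1 - y) ^+ n.-1)%:C * g y ^+ n.+1.
have dF (y : R) : cderive F y (k y).
  have := cderiveM (cderive_cst (- cker z b) y) (cderiveX n (dh y)).
  congr (cderive _ _ _); rewrite mul0r add0r /k /h exprMn rmorphM rmorph_nat rmorphXn /=.
  move: bV; have -> : g y ^+ n.+1 = g y ^+ n.-1 * g y ^+ 2 by rewrite -exprD addn2 prednK.
  move: (cker z b) (b%:C - z) (_ ^+ n.-1) (_ ^+ n.-1) (g y ^+ 2) n%:R => v c p q u N e.
  rewrite (_ : _ * _ = (v * c) * (N * p * q * u)); last by ring.
  by rewrite e; ring.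
have kE y : k y = n%:R * (1 - y)%:C ^+ n.-1 * g y ^+ n.+1.
  by rewrite /k rmorphM rmorph_nat rmorphXn.
have ck : continuous (fun y => Re (k y)) /\ continuous (fun y => Im (k y)).
  rewrite (_ : k = fun y => n%:R * (1 - y)%:C ^+ n.-1 * g y ^+ n.+1); last exact/funext.
  have D y := cderiveM (cderiveM (cderive_cst n%:R y) (cderiveX n.-1 (d1 y))) (cderiveX n.+1 (dg y)).
  by split=> y; have [] := cderive_continuous (D y).
have F10 : F 1 - F 0 = cker z b * cker z x ^+ n.
  rewrite /F /h subrr mul0r expr0n eqn0Ngt n0 mulr0 sub0r subr0 mul1r mulNr opprK.
  by rewrite /g /s mulr0 add0r.
have itvE (u : R -> R) : continuous u ->
    (\int[leb]_(y in `]0%R, 1%R[) u y = \int[leb]_(y in `[0%R, 1%R]) u y)%R.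
  move=> cu.
  have iu : leb.-integrable `[0%R, 1%R] (EFin \o u).
    apply: continuous_compact_integrable; first exact: segment_compact.
    exact: continuous_subspaceT.
  have io : leb.-integrable `]0%R, 1%R] (EFin \o u).
    by apply: integrableS iu => //; apply: subset_itvr; rewrite bnd_simp.
  rewrite Rintegral_itv_bndo_bndc; last first.
    by apply: integrableS iu => //; apply: subset_itv; rewrite bnd_simp.
  by rewrite Rintegral_itv_obnd_cbnd.
have FTC (u U : R -> R) : continuous u -> (forall y : R, is_derive y (1 : R) U (u y)) ->
    (\int[leb]_(y in `]0%R, 1%R[) u y = U 1 - U 0)%R.
  by move=> cu dU; rewrite itvE// /Rintegral (FTC_everywhere ltr01 cu dU).
have bk : cbmeas (fun y : measurableTypeR R => cker z (s (y : R)) ^+ n.+1).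
  have [bR bI] := cbmeas_ckerX n.+1 z0.
  have ms : measurable_fun setT (s : measurableTypeR R -> measurableTypeR R).
    by apply: measurable_funD => //; exact: measurable_funM.
  by split; [exact: (bmeas_comp ms bR.1 bR.2)|exact: (bmeas_comp ms bI.1 bI.2)].
rewrite (eq_cint nu (g := fun y : measurableTypeR R => cker z (s (y : R)) ^+ n.+1)); last first.
  by move=> y; rewrite sE.
have [bR bI] := bk; rewrite /cint (nuE _ bR) (nuE _ bI) -F10.
have Rek y : Re (cker z (s y) ^+ n.+1) * (n%:R * (1 - y) ^+ n.-1) = Re (k y).
  by rewrite /k ReM /= mul0r subr0 mulrC.
have Imk y : Im (cker z (s y) ^+ n.+1) * (n%:R * (1 - y) ^+ n.-1) = Im (k y).
  by rewrite /k ImM /= mul0r addr0 mulrC.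
apply: complex_eq; rewrite /= ?ReD ?ReN ?ImD ?ImN.
- rewrite -(FTC _ _ ck.1 (fun y => (dF y).1)).
  by apply: eq_Rintegral => y _; exact: Rek.
- rewrite -(FTC _ _ ck.2 (fun y => (dF y).2)).
  by apply: eq_Rintegral => y _; exact: Imk.
Qed.

End BetaIdentity.

(** * Cauchy and Dirac laws have a geometric sequence of transforms *)

Section Geometric.
Context {R : realType} (m : probability (measurableTypeR R) R).

(** By induction Phi_(k+1) and the power 1/(c - z)^(k+1) agree on the half-plane, so their
    derivatives agree; these are k+1 times Phi_(k+2) and k+1 times the next power. *)
Lemma PhiX_mobius (a b : R) : 0 <= b ->
  (forall z, 0 < Im z -> Phi m 1 z = ((a -i* b) - z)^-1) ->
  forall k z, 0 < Im z -> Phi m k.+1 z = Phi m 1 z ^+ k.+1.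
Proof.
move=> b0 E1.
pose c : R[i] := a -i* b.
have E z : 0 < Im z -> Phi m 1 z = cker (z - c) 0.
  by move=> z0; rewrite E1// /cker rmorph0 sub0r opprB.
have Ic (z : R[i]) : Im z <= Im (z - c) by case: z => p q /=; rewrite opprK lerDl.
elim=> [z z0|k IH z z0]; first by rewrite expr1.
have q0 := divr_gt0 z0 (ltr0n R 2).
have zq : Im z / 2 <= Im z by rewrite ler_pdivrMr// ler_pMr// ler1n.
have [M1 _ H1] := Phi_taylor m k.+1 q0; have [M2 _ H2] := ckerX_taylor k.+1 q0.
have D1 : @derive1 (R[i] : numFieldType) (R[i] : numFieldType) (Phi m k.+1) z =
    k.+1%:R * Phi m k.+2 z.
  by apply: (derive1_taylor (g := Phi m k.+1) z0) => // h hz; exact: H1.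
have : @derive1 (R[i] : numFieldType) (R[i] : numFieldType) (Phi m k.+1) z =
    k.+1%:R * cker (z - c) 0 ^+ k.+2.
  apply: (derive1_taylor (g := fun v => cker (v - c) 0 ^+ k.+1) z0) => [u u0|h hz].
    by rewrite IH// E.
  rewrite [z + h - c]addrAC; apply: H2.
    exact: le_trans zq (Ic z).
  by rewrite addrAC; exact: le_trans hz (Ic _).
rewrite D1 -E// => /mulfI; apply.
by rewrite pnatr_eq0.
Qed.

Lemma cauchy_dirac_mobius : is_cauchy m \/ is_dirac m ->
  exists a b : R, 0 <= b /\ forall z, 0 < Im z -> Phi m 1 z = ((a -i* b) - z)^-1.
Proof.
move=> [[a [b [b0 mC]]]|[a mD]].
  have [nu [nuC nuE]] := cauchy_law_measure a b0.
  exists a, b; split=> [|z z0]; first exact: ltW.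
  rewrite -nuE//; apply: cint_eq_law => A mA.
  exact: etrans (mC A mA) (esym (nuC A mA)).
exists a, 0; split=> // z z0.
have -> : Phi m 1 z = Phi (\d_(a : measurableTypeR R) : probability _ R) 1 z.
  exact: cint_eq_law.
rewrite oppr0 /Phi /cint /Rintegral.
have [bR bI] := cbmeas_cker z0.
rewrite !integral_dirac//=.
- by rewrite indicT !mul1r; apply: complex_eq.
- by apply/measurable_EFinP; exact: bmeas_measurable bI.
- by apply/measurable_EFinP; exact: bmeas_measurable bR.
Qed.

End Geometric.

(** * The equivalence and the classification on the real line *)

Section RealLine.
Context {dT : measure_display} {T : measurableType dT} {R : realType}.
Variables (P : probability T R) (n : nat) (alpha : probability (measurableTypeR R) R).
Variables (B Y : nat -> {RV P >-> measurableTypeR R}).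
Hypothesis n0 : (0 < n)%N.
Hypothesis sb : stick_breaking n%:R alpha P B Y.
Hypothesis alphaFT : FT1 alpha.

Let eta := distribution P (Y 0).

Lemma Tstick_cker (z : R[i]) x : 0 < Im z ->
  Tstick alpha eta (fun w => Re (cker z w ^+ n.+1)) x = Re (Phi alpha 1 z * cker z x ^+ n) /\
  Tstick alpha eta (fun w => Im (cker z w ^+ n.+1)) x = Im (Phi alpha 1 z * cker z x ^+ n).
Proof.
move=> z0.
have E b := beta_identity b x n0 (sb_Y sb 0) z0.
rewrite [Phi _ _ _ * _]mulrC -cintZl; last exact: cbmeas_ckerX.
split; apply: eq_Rintegral => b _.
- by rewrite expr1 mulrC -E.
- by rewrite expr1 mulrC -E.
Qed.

Lemma Phi_recurrence_of_invariant : eq_law (mu1 P B Y) alpha ->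
  forall z, 0 < Im z -> Phi alpha n.+1 z = Phi alpha 1 z * Phi alpha n z.
Proof.
move=> inv z z0.
rewrite /Phi -/(Phi alpha 1 z) -cintZl; last exact: cbmeas_ckerX.
have lawE (f : measurableTypeR R -> R) : bmeas f ->
    (\int[alpha]_x f x = \int[P]_w f (stick_limit B Y w))%R.
  move=> bf; rewrite -(bint_distribution P (pack_mfun (measurable_stick_limit sb)))//.
  by apply: bint_eq_law => A mA; exact: esym (inv A mA).
have [bR bI] := @cbmeas_ckerX R z n.+1 z0.
have [cR cI] : continuous (fun y : R => Re (cker z y ^+ n.+1)) /\
    continuous (fun y : R => Im (cker z y ^+ n.+1)).
  by split=> y; have [] := cderive_continuous (cderiveX n.+1 (cderive_cker y z0)).
have [dR dI] : continuous (fun y : R => Re (Phi alpha 1 z * cker z y ^+ n)) /\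
    continuous (fun y : R => Im (Phi alpha 1 z * cker z y ^+ n)).
  by split=> y; have [] := cderive_continuous
    (cderiveM (cderive_cst (Phi alpha 1 z) y) (cderiveX n (cderive_cker y z0))).
have TR : Tstick alpha eta (fun w => Re (cker z w ^+ n.+1)) =
    fun x => Re (Phi alpha 1 z * cker z x ^+ n).
  by apply/funext => x; rewrite (Tstick_cker x z0).1.
have TI : Tstick alpha eta (fun w => Im (cker z w ^+ n.+1)) =
    fun x => Im (Phi alpha 1 z * cker z x ^+ n).
  by apply/funext => x; rewrite (Tstick_cker x z0).2.
have iR := stick_limit_invariant sb alphaFT bR cR.
have iI := stick_limit_invariant sb alphaFT bI cI.
rewrite /= -/eta TR in iR; rewrite /= -/eta TI in iI.
have [b'R b'I] : cbmeas (fun x : measurableTypeR R => Phi alpha 1 z * cker z x ^+ n).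
  by apply: cbmeasM; [exact: cbmeas_cst|exact: cbmeas_ckerX].
by apply: complex_eq; rewrite /cint /= !lawE// ?iR ?iI.
Qed.

Lemma invariant_of_Phi_recurrence :
  (forall z, 0 < Im z -> Phi alpha n.+1 z = Phi alpha 1 z * Phi alpha n z) ->
  eq_law (mu1 P B Y) alpha.
Proof.
move=> H.
(* T f is tested against alpha as f against this law, so that it suffices to
   compare the integrals of (w - z)^-(n+1). *)
pose mix := distribution (alpha \x alpha \x eta)%E (pack_mfun (@measurable_mix R)).
have mixE (f : measurableTypeR R -> R) : bmeas f ->
    (\int[mix]_x f x = \int[alpha]_x Tstick alpha eta f x)%R.
  move=> bf; rewrite bint_distribution//; apply: EFin_inj.
  have bm := bmeas_mix bf.
  rewrite -bintE// bint_prod1//; congr EFin; apply: EFin_inj.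
  have b1 := bmeas_bint eta bm.
  by rewrite -bintE// (bint_prod1 _ _ b1).
have law : eq_law mix alpha.
  apply: (@Phi_unique R mix alpha n.+1) => // z z0; rewrite H// /Phi -/(Phi alpha 1 z).
  rewrite -cintZl; last exact: cbmeas_ckerX.
  have [bR bI] := @cbmeas_ckerX R z n.+1 z0.
  rewrite /cint !mixE//; congr (_ +i* _); apply: eq_Rintegral => x _.
  - by rewrite (Tstick_cker x z0).1.
  - by rewrite (Tstick_cker x z0).2.
apply: (mu1_of_invariant sb alphaFT) => g bg.
by rewrite -mixE//; exact: bint_eq_law.
Qed.

Lemma mu1_invariantP : eq_law (mu1 P B Y) alpha <->
  forall z : R[i], 0 < Im z ->
    n%:R * stieltjes alpha z * stieltjes_n alpha n.-1 z = stieltjes_n alpha n z.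
Proof.
have rec z : 0 < Im z ->
    (n%:R * stieltjes alpha z * stieltjes_n alpha n.-1 z = stieltjes_n alpha n z) <->
    (Phi alpha n.+1 z = Phi alpha 1 z * Phi alpha n z).
  (* As n! = n (n-1)!, both sides of the differential equation carry the same nonzero factor n
     (n-1)!. *)
  move=> z0; rewrite !stieltjes_nE// prednK// stieltjesE.
  have -> : n`!%:R = n%:R * n.-1`!%:R :> R[i].
    by rewrite -natrM -[in LHS](prednK n0) factS prednK.
  have : n.-1`!%:R != 0 :> R[i] by rewrite pnatr_eq0 -lt0n fact_gt0.
  have : n%:R != 0 :> R[i] by rewrite pnatr_eq0 -lt0n.
  move: n%:R (n.-1`!%:R) (Phi alpha 1 z) (Phi alpha n z) (Phi alpha n.+1 z) => N F u v w N0 F0.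
  rewrite (_ : N * u * (F * v) = N * F * (u * v)); last by ring.
  by split=> [/mulfI ->//|->//]; rewrite mulf_neq0.
split=> [inv z z0|H].
  by apply/(rec z z0); exact: Phi_recurrence_of_invariant.
by apply: invariant_of_Phi_recurrence => z z0; apply/(rec z z0); exact: H.
Qed.

Lemma cauchy_dirac_of_invariant : n = 1%N \/ n = 2%N -> eq_law (mu1 P B Y) alpha ->
  is_cauchy alpha \/ is_dirac alpha.
Proof.
move=> n12 /Phi_recurrence_of_invariant H.
have H2 z : 0 < Im z -> Phi alpha 2 z = Phi alpha 1 z * Phi alpha 1 z.
  by case: n12 H => -> H; [exact: H|exact: Phi2_of_Phi3 H z].
have [a [b [b0 E]]] := Phi1_mobius H2.
exact: mobius_law b0 E.
Qed.

Lemma invariant_of_cauchy_dirac : is_cauchy alpha \/ is_dirac alpha ->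
  eq_law (mu1 P B Y) alpha.
Proof.
move=> /cauchy_dirac_mobius [a [b [b0 E]]].
apply: invariant_of_Phi_recurrence => z z0.
(* Phi_(n+1) = Phi_1^(n+1) = Phi_1 Phi_n, for every positive n. *)
have := PhiX_mobius b0 E n.-1 z0; rewrite prednK// => ->.
by rewrite (PhiX_mobius b0 E n z0) exprS.
Qed.

End RealLine.

(** * Exponential mixtures of cosines and the Cramer-Wold theorem *)

Section ExponentialCosine.
Context {R : realType} (q : R).
Hypothesis q0 : 0 < q.
Local Notation leb := (@lebesgue_measure R).

Lemma exponential_probability : exists E : probability (measurableTypeR R) R,
  forall f, bmeas f -> (\int[E]_s f s = \int[leb]_s (f s * exponential_pdf q s))%R.
Proof.
have mf : measurable_fun [set: measurableTypeR R] (exponential_pdf q).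
  exact: measurable_exponential_pdf.
have [nu [nuA nuE]] := density_exists mf (exponential_pdf_ge0 (ltW q0))
  (integrable_exponential_pdf q0).
unshelve epose (E := (exponential_prob q : probability (measurableTypeR R) R)).
  exact: q0.
exists E => f bf; rewrite -nuE//.
by apply: bint_eq_law => A mA; exact: esym (nuA A).
Qed.

Lemma is_derive_exp_trig (v s : R) :
  is_derive s (1 : R) (fun s => q / (q ^+ 2 + v ^+ 2) *
    (expR (- q * s) * (v * sin (v * s) - q * cos (v * s))))
    (cos (v * s) * (q * expR (- q * s))).
Proof.
have D (a x : R) : is_derive x (1 : R) (fun y => a * y) a.
  rewrite (_ : (fun _ => _) = a \*: (@id R))//.
  by apply: is_derive_eq; rewrite /GRing.scale /= mulr1.
have De := @is_derive1_comp R (@expR R) (fun y => - q * y) s _ _ (is_derive_expR _) (D _ _).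
have Ds := @is_derive1_comp R (@sin R) (fun y => v * y) s _ _ (is_derive_sin _) (D _ _).
have Dc := @is_derive1_comp R (@cos R) (fun y => v * y) s _ _ (is_derive_cos _) (D _ _).
rewrite (_ : (fun _ => _) = (q / (q ^+ 2 + v ^+ 2)) \*: ((@expR R \o (fun y => - q * y)) *
  (v \*: (@sin R \o (fun y => v * y)) - q \*: (@cos R \o (fun y => v * y)))))//.
apply: is_derive_eq; rewrite /GRing.scale /=.
have n0 : q ^+ 2 + v ^+ 2 != 0 by rewrite gt_eqF// ltr_pwDl ?sqr_ge0// exprn_gt0.
rewrite !fctE /=.
rewrite (_ : v *: sin (v * s) - q *: cos (v * s) = v * sin (v * s) - q * cos (v * s))//.
move: (expR _) (sin _) (cos _) => e S C; by field.
Qed.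

Lemma exponential_cos (E : probability (measurableTypeR R) R) :
  (forall f, bmeas f -> (\int[E]_s f s = \int[leb]_s (f s * exponential_pdf q s))%R) ->
  forall v : R, (\int[E]_s cos (v * (s : R)) = q ^+ 2 / (q ^+ 2 + v ^+ 2))%R.
Proof.
move=> EE v.
have n0 : 0 < q ^+ 2 + v ^+ 2 by rewrite ltr_pwDl ?sqr_ge0// exprn_gt0.
have cc : continuous (fun s : R => cos (v * s)).
  move=> s; apply: (@cvg_comp _ _ _ (fun s : R => v * s) cos); last exact: continuous_cos.
  by apply: cvgM; [exact: cvg_cst|exact: cvg_id].
have mc : measurable_fun setT (fun s : measurableTypeR R => cos (v * (s : R)) : R).
  exact: continuous_measurable_fun cc.
pose I k : set (measurableTypeR R) := `[0%R, k.+1%:R]%classic.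
have mI k : measurable (I k) by exact: measurable_itv.
pose G (s : R) := q / (q ^+ 2 + v ^+ 2) * (expR (- q * s) * (v * sin (v * s) - q * cos (v * s))).
have cg : continuous (fun s : R => cos (v * s) * (q * expR (- q * s))).
  move=> s; apply: cvgM; first exact: cc.
  apply: cvgM; first exact: cvg_cst.
  apply: (@cvg_comp _ _ _ (fun s : R => - q * s) expR); last exact: continuous_expR.
  by apply: cvgM; [exact: cvg_cst|exact: cvg_id].
have c1 : (fun k => \int[E]_s (\1_(I k) s * cos (v * (s : R))))%R @ \oo -->
    (\int[E]_s cos (v * (s : R)))%R.
  have mh : measurable_fun setT (fun s : measurableTypeR R => \1_(`[0%R, +oo[%classic : set R) s * cos (v * (s : R)) : R).
    by apply: measurable_funM => //; exact: measurable_indic.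
  have bh : bmeas (fun s : measurableTypeR R => \1_(`[0%R, +oo[%classic : set R) s * cos (v * (s : R)) : R).
    split => //; exists 1 => s; rewrite normrM mulr_ile1// ?cos_max//.
    by rewrite indicE; case: (_ \in _); rewrite ?normr1 ?normr0.
  have bc : bmeas (fun s : measurableTypeR R => cos (v * (s : R))).
    by split => //; exists 1 => s; exact: cos_max.
  (* The exponential law does not charge the negative half-line, so the cosine may be cut off there;
     the indicators of [0, k+1] then converge pointwise to the cut-off. *)
  have -> : (\int[E]_s cos (v * (s : R)) =
      \int[E]_s (\1_(`[0%R, +oo[%classic : set R) s * cos (v * (s : R))))%R.
    rewrite !EE//; apply: eq_Rintegral => s _.
    rewrite /exponential_pdf patchE indicE; case: (_ \in _); first by rewrite mul1r.
    by rewrite !mulr0.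
  apply: (@bint_cvg _ _ _ E _ _ 1) => //.
  - by move=> k; apply: measurable_funM => //; exact: measurable_indic.
  - move=> k s; rewrite normrM mulr_ile1// ?cos_max//.
    by rewrite indicE; case: (_ \in _); rewrite ?normr1 ?normr0.
  - apply: aeW => s; apply: cvgM; last exact: cvg_cst.
    apply: cvg_near_cst; near=> k; rewrite !indicE /I.
    congr (nat_of_bool _)%:R; apply/idP/idP; rewrite !inE /= !in_itv /= ?andbT; first by move=> /andP[].
    move=> s0; rewrite s0 /=; near: k.
    exists (Num.Def.trunc (s : R)) => // k /= km; apply: ltW; apply: (lt_le_trans (truncnS_gt _)).
    by rewrite ler_nat.
have E1 k : (\int[E]_s (\1_(I k) s * cos (v * (s : R))) = G k.+1%:R - G 0)%R.
  rewrite EE; last first.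
    split; first by apply: measurable_funM => //; exact: measurable_indic.
    exists 1 => s; rewrite normrM mulr_ile1// ?cos_max//.
    by rewrite indicE; case: (_ \in _); rewrite ?normr1 ?normr0.
  have F := FTC_everywhere (ltr0Sn R k) cg (is_derive_exp_trig v).
  rewrite (_ : G _ - G _ = \int[leb]_(s in I k) (cos (v * s) * (q * expR (- q * s))))%R; last first.
    by rewrite /Rintegral F.
  rewrite [RHS]Rintegral_mkcond; apply: eq_Rintegral => s _.
  rewrite patchE indicE; case: (boolP (s \in I k)); last by rewrite !mul0r.
  rewrite /I inE /= in_itv /= => /andP[s0 _].
  by rewrite mul1r exponential_pdfE.
have c2 : (fun k => G k.+1%:R - G 0) @ \oo --> q ^+ 2 / (q ^+ 2 + v ^+ 2).
  pose C := q / (q ^+ 2 + v ^+ 2) * (`|v| + q).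
  have qn : 0 <= q / (q ^+ 2 + v ^+ 2) by rewrite divr_ge0// ltW.
  have GC s : `|G s| <= C * expR (- q * s).
    rewrite /G normrM (ger0_norm qn) /C -mulrA ler_wpM2l//.
    rewrite normrM ger0_norm ?expR_ge0// [leLHS]mulrC ler_wpM2r ?expR_ge0//.
    rewrite (le_trans (ler_normB _ _))// !normrM (gtr0_norm q0) lerD//.
      by rewrite ler_piMr// sin_max.
    by rewrite ler_piMr// ?cos_max// ltW.
  have cu : (fun k => C * expR (- q) ^+ k.+1) @ \oo --> (0 : R).
    rewrite -[X in _ --> X](mulr0 C); apply: cvgM; first exact: cvg_cst.
    have cq : (fun k => expR (- q) ^+ k) @ \oo --> (0 : R).
      by apply: cvg_expr; rewrite ger0_norm ?expR_ge0// expR_lt1 oppr_lt0.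
    by rewrite -(cvg_shiftS (fun k => expR (- q) ^+ k)) in cq.
  have cu' : (fun k => - (C * expR (- q) ^+ k.+1)) @ \oo --> (0 : R).
    by rewrite -[X in _ --> X]oppr0; exact: cvgN.
  have c3 : (fun k => G k.+1%:R) @ \oo --> (0 : R).
    apply: squeeze_cvgr cu' cu; apply: nearW => k.
    rewrite -ler_norml (le_trans (GC _))// -expRM_natr.
    by rewrite [X in expR X]mulrC.
  have -> : q ^+ 2 / (q ^+ 2 + v ^+ 2) = 0 - G 0.
    by rewrite /G !mulr0 expR0 sin0 cos0; field; rewrite lt0r_neq0.
  by apply: cvgB c3 _; exact: cvg_cst.
rewrite -(cvg_lim (@Rhausdorff R) c1); apply/cvg_lim => //.
by under eq_fun => k do rewrite E1.
Unshelve. all: by end_near. Qed.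

End ExponentialCosine.

Section Inner.
Context {R : realType} {d : nat}.
Local Notation V := (d.-tuple (measurableTypeR R)).

Lemma measurable_inner (f : V) : measurable_fun setT (inner f : V -> measurableTypeR R).
Proof.
apply: (@measurable_sum _ V R setT _ _ (fun i x => (tnth f i : R) * (tnth x i : R))) => i.
by apply: measurable_funM => //; exact: (measurable_tnth i).
Qed.

(** The vector f + s e_k: through it the cosine of inner f x + s x_k is again the cosine of a
    projection. *)
Definition shift_coord (k : 'I_d) (f : V) (s : R) : V :=
  [tuple ((tnth f i : R) + s * (i == k)%:R : measurableTypeR R) | i < d].

Lemma inner_shift (k : 'I_d) (f x : V) s :
  inner (shift_coord k f s) x = inner f x + s * (tnth x k : R).
Proof.
rewrite /inner; under eq_bigr => i _ do rewrite tnth_mktuple mulrDl.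
rewrite big_split /=; congr (_ + _); rewrite (bigD1 k)//= eqxx mulr1 big1 ?addr0// => i ik.
by rewrite (negbTE ik) mulr0 mul0r.
Qed.

End Inner.

Lemma weighted_marginal {d} {V : measurableType d} {R : realType}
    (m : probability V R) (G : V -> R) (phi : V -> measurableTypeR R) :
  bmeas G -> (forall x, 0 <= G x) -> measurable_fun setT phi ->
  exists nu : {finite_measure set (measurableTypeR R) -> \bar R},
    forall h, bmeas h -> (\int[nu]_u h u = \int[m]_x (G x * h (phi x)))%R.
Proof.
move=> bG G0 mphi.
have [lam [_ lamE]] := density_exists (bmeas_measurable bG) G0 (bmeas_integrable m bG).
pose nu1 : {measure set (measurableTypeR R) -> \bar R} :=
  measure_function_pushforward__canonical__measure_function_Measure lam mphi.
have nu1fin : fin_num_fun nu1.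
  move=> A mA; apply: (fin_num_measure lam); rewrite -[_ @^-1` _]setTI; exact: (mphi measurableT A mA).
pose nu : {finite_measure set (measurableTypeR R) -> \bar R} :=
  HB.pack (nu1 : set _ -> \bar R) nu1 (Measure_isFinite.Build _ _ _ nu1 nu1fin).
exists nu => h [mh [M hM]].
have bh : bmeas (h \o phi) by apply: bmeas_comp => //; exists M.
under [RHS]eq_Rintegral => x _ do rewrite mulrC.
rewrite -lamE// /Rintegral; congr fine.
rewrite integral_pushforward//.
- exact/measurable_EFinP.
- exact: bmeas_integrable.
Qed.

(** Uniqueness of the characteristic function for the image under phi of the measure G dm, reduced
    to [poisson_unique]. The free phase supplies the centre p of the Poisson kernel, as cos ((u - p)
    s) = cos (s u - p s). *)
Lemma weighted_marginal_eq {d} {V : measurableType d} {R : realType}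
    (m1 m2 : probability V R) (G : V -> R) (phi : V -> measurableTypeR R) :
  bmeas G -> (forall x, 0 <= G x) -> measurable_fun setT phi ->
  (forall s t : R, (\int[m1]_x (G x * cos (s * (phi x : R) + t)) =
    \int[m2]_x (G x * cos (s * (phi x : R) + t)))%R) ->
  forall h, bmeas h -> (\int[m1]_x (G x * h (phi x)) = \int[m2]_x (G x * h (phi x)))%R.
Proof.
move=> bG G0 mphi E h bh.
have [nu1 nu1E] := weighted_marginal m1 bG G0 mphi.
have [nu2 nu2E] := weighted_marginal m2 bG G0 mphi.
rewrite -nu1E// -nu2E//; apply: bint_eq_law.
apply: poisson_unique => p q q0.
have [_ bI] := @cbmeas_cker R (p +i* q) q0.
rewrite nu1E// nu2E//.
have [Ex ExE] := exponential_probability q0.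
have mcos : measurable_fun setT
    (fun z : V * measurableTypeR R => cos (((phi z.1 : R) - p) * (z.2 : R)) : R).
  apply: (measurableT_comp (f := @cos R)).
    by apply: continuous_measurable_fun; exact: continuous_cos.
  apply: measurable_funM => //; apply: measurable_funB => //.
  exact: (measurableT_comp mphi measurable_fst).
have bF : bmeas (fun z : V * measurableTypeR R =>
    G z.1 * cos (((phi z.1 : R) - p) * (z.2 : R))).
  apply: bmeasM; last by split => //; exists 1 => z; exact: cos_max.
  have [mG [M GM]] := bG; split; first exact: (measurableT_comp mG measurable_fst).
  by exists M.
have bc (v : R) : bmeas (fun s : measurableTypeR R => cos (v * (s : R))).
  split; last by exists 1 => s; exact: cos_max.
  apply: (measurableT_comp (f := @cos R)).
    by apply: continuous_measurable_fun; exact: continuous_cos.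
  exact: measurable_funM.
(* q / ((u - p)^2 + q^2) is q^-1 E cos ((u - p) S), with S exponential of rate q. *)
have K (m : probability V R) :
    (\int[m]_x (G x * Im (cker (p +i* q) (phi x))) =
     q^-1 * \int[Ex]_s \int[m]_x (G x * cos (((phi x : R) - p) * s)))%R.
  rewrite -(bint_swap m Ex bF) -bintZ; last exact: (bmeas_bint Ex bF).
  apply: eq_Rintegral => x _.
  have -> : (\int[Ex]_s (G (x, s).1 * cos (((phi (x, s).1 : R) - p) * ((x, s).2 : R))) =
      G x * \int[Ex]_s cos (((phi x : R) - p) * (s : R)))%R by rewrite -bintZ.
  rewrite (exponential_cos q0 ExE) Im_cker /=.
  have n0 : 0 < q ^+ 2 + ((phi x : R) - p) ^+ 2 by rewrite ltr_pwDl ?sqr_ge0// exprn_gt0.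
  by rewrite [_ ^+ 2 + q ^+ 2]addrC; field; rewrite !lt0r_neq0.
rewrite !K; congr (_ * _); apply: eq_Rintegral => s _.
have e x : ((phi x : R) - p) * s = s * (phi x : R) + (- (p * s)) by ring.
by under eq_Rintegral => x _ do rewrite e; rewrite E; under eq_Rintegral => x _ do rewrite -e.
Qed.

Section CramerWold.
Context {R : realType} {d : nat}.
Local Notation V := (d.-tuple (measurableTypeR R)).
Variables m1 m2 : probability V R.
Hypothesis projE : forall f : V,
  eq_law (pushforward m1 (inner f : V -> measurableTypeR R))
         (pushforward m2 (inner f : V -> measurableTypeR R)).

(* With a free phase t, the cosines carry the whole characteristic function of
   the restriction to D. *)
Let same_cf (D : set V) := forall (f : V) (t : R),
  (\int[m1]_x (\1_D x * cos (inner f x + t)) = \int[m2]_x (\1_D x * cos (inner f x + t)))%R.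

Let bmeas_cos (f : V) (t : R) : bmeas (fun x => cos (inner f x + t)).
Proof.
split; last by exists 1 => x; exact: cos_max.
apply: (measurableT_comp (f := @cos R)).
  by apply: continuous_measurable_fun; exact: continuous_cos.
by apply: measurable_funD => //; exact: measurable_inner.
Qed.

Let same_cfT : same_cf setT.
Proof.
move=> f t; under eq_Rintegral => x _ do rewrite indicT mul1r.
under [RHS]eq_Rintegral => x _ do rewrite indicT mul1r.
have bc : bmeas (fun u : measurableTypeR R => cos ((u : R) + t)).
  split; last by exists 1 => x; exact: cos_max.
  apply: (measurableT_comp (f := @cos R)).
    by apply: continuous_measurable_fun; exact: continuous_cos.
  exact: measurable_funD.
rewrite -(bint_distribution m1 (pack_mfun (measurable_inner f)) bc).
rewrite -(bint_distribution m2 (pack_mfun (measurable_inner f)) bc).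
by apply: bint_eq_law; exact: projE.
Qed.

(** By the product formula for cosines, G(x) cos (s x_k + r) is a combination of cosines of
    projections restricted to D. So the law of x_k weighted by G is the same under [m1] and [m2],
    and the cosine in x_k may be exchanged for the indicator of A. *)
Let same_cf_cylinder (D : set V) (k : 'I_d) (A : set (measurableTypeR R)) :
  measurable D -> measurable A -> same_cf D ->
  same_cf (D `&` (fun x : V => tnth x k) @^-1` A).
Proof.
move=> mD mA HD f t.
have bD : bmeas (\1_D : V -> R) by exact: bmeas_indic.
have bA : bmeas (\1_A : measurableTypeR R -> R) by exact: bmeas_indic.
have D0 x : 0 <= (\1_D x : R) by rewrite indicE.
pose z0 : V := [tuple (0 : measurableTypeR R) | i < d].
have in0 x : inner z0 x = 0.
  by rewrite /inner big1// => i _; rewrite tnth_mktuple mul0r.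
have H0 s r : (\int[m1]_x (\1_D x * cos (s * (tnth x k : R) + r)) =
    \int[m2]_x (\1_D x * cos (s * (tnth x k : R) + r)))%R.
  have := HD (shift_coord k z0 s) r.
  under eq_Rintegral => x _ do rewrite inner_shift in0 add0r.
  by under [RHS]eq_Rintegral => x _ do rewrite inner_shift in0 add0r.
(* Adding 1 makes the weight nonnegative; \1_D alone is handled separately. *)
pose G x : R := \1_D x * (1 + cos (inner f x + t)).
have bG : bmeas G.
  by apply: bmeasM => //; apply: bmeasD; [exact: bmeas_cst|exact: bmeas_cos].
have G0 x : 0 <= G x.
  have := cos_max (inner f x + t); rewrite ler_norml => /andP[c _].
  by apply: mulr_ge0 => //; lra.
have HG s r : (\int[m1]_x (G x * cos (s * (tnth x k : R) + r)) =
    \int[m2]_x (G x * cos (s * (tnth x k : R) + r)))%R.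
  have e x : G x * cos (s * (tnth x k : R) + r) = \1_D x * cos (inner (shift_coord k z0 s) x + r) +
      (2^-1 * (\1_D x * cos (inner (shift_coord k f s) x + (t + r))) +
       2^-1 * (\1_D x * cos (inner (shift_coord k f (- s)) x + (t - r)))).
    rewrite !inner_shift in0 add0r /G.
    have -> : inner f x + s * (tnth x k : R) + (t + r) = (inner f x + t) + (s * (tnth x k : R) + r) by ring.
    have -> : inner f x + - s * (tnth x k : R) + (t - r) = (inner f x + t) - (s * (tnth x k : R) + r) by ring.
    move: (inner f x + t) (s * (tnth x k : R) + r) (\1_D x : R) => u v e.
    by rewrite cosB cosD; field.
  have bt g r' : bmeas (fun x => \1_D x * cos (inner g x + r')) by exact: bmeasM.
  have bt2 g r' : bmeas (fun x => 2^-1 * (\1_D x * cos (inner g x + r'))).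
    by apply: bmeasM => //; exact: bmeas_cst.
  have split_int (m : probability V R) : (\int[m]_x (G x * cos (s * (tnth x k : R) + r)) =
      \int[m]_x (\1_D x * cos (inner (shift_coord k z0 s) x + r)) +
      (2^-1 * \int[m]_x (\1_D x * cos (inner (shift_coord k f s) x + (t + r))) +
       2^-1 * \int[m]_x (\1_D x * cos (inner (shift_coord k f (- s)) x + (t - r)))))%R.
    under eq_Rintegral => x _ do rewrite e.
    by rewrite !bintD ?bintZ//; exact: bmeasD.
  by rewrite !split_int !HD.
have mk : measurable_fun setT (fun x : V => tnth x k) by exact: measurable_tnth.
have W1 := weighted_marginal_eq bG G0 mk HG bA.
have W0 := weighted_marginal_eq bD D0 mk H0 bA.
have fE x : \1_(D `&` (fun x : V => tnth x k) @^-1` A) x * cos (inner f x + t) =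
    G x * \1_A (tnth x k) - \1_D x * \1_A (tnth x k).
  have -> : \1_(D `&` (fun x : V => tnth x k) @^-1` A) x = \1_D x * \1_A (tnth x k) :> R.
    by rewrite indicI /= !indicE.
  rewrite /G.
  by move: (\1_D x) (\1_A _) (cos _) => a b c; ring.
have bk : bmeas (fun x : V => \1_A (tnth x k) : R).
  by apply: (bmeas_comp mk); [case: bA|case: bA].
under eq_Rintegral => x _ do rewrite fE.
under [RHS]eq_Rintegral => x _ do rewrite fE.
by rewrite !bintB ?W1 ?W0//; exact: bmeasM.
Qed.

Lemma cramer_wold : eq_law m1 m2.
Proof.
(* The quantifier over D makes C stable under intersection, since A and A' can be imposed one after
   the other. *)
pose C : set (set V) := [set A | measurable A /\
  forall D, measurable D -> same_cf D -> same_cf (D `&` A)].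
have CT : C setT by split => // D mD HD; rewrite setIT.
have Ccyl (k : 'I_d) (A : set (measurableTypeR R)) : measurable A ->
    C ((fun x : V => tnth x k) @^-1` A).
  move=> mA; split; last by move=> D mD HD; exact: same_cf_cylinder.
  by rewrite -[_ @^-1` _]setTI; exact: (measurable_tnth k).
apply: (@measure_unique _ _ _ C (fun=> setT)) => //.
- apply/seteqP; split.
    apply: smallest_sub; first exact: smallest_sigma_algebra.
    move=> A; rewrite -bigcup_seq /= => -[k _ [S mS <-]].
    by apply: sub_sigma_algebra; rewrite setTI; exact: Ccyl.
  apply: smallest_sub; first exact: sigma_algebra_measurable.
  by move=> A [].
- move=> A A' [mA HA] [mA' HA']; split; first exact: measurableI.
  move=> D mD HD; rewrite setIA; apply: HA'; first exact: measurableI.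
  exact: HA.
- by rewrite bigcup_const.
- move=> A [mA HA].
  (* At frequency 0 and phase 0 the cosine is 1, and the integrals become the measures of A. *)
  have := HA setT measurableT same_cfT [tuple (0 : measurableTypeR R) | i < d] 0.
  have e x : \1_(setT `&` A) x *
      cos (inner [tuple (0 : measurableTypeR R) | i < d] x + 0) = \1_A x :> R.
    rewrite setTI /inner big1 ?addr0 ?cos0 ?mulr1// => i _.
    by rewrite tnth_mktuple mul0r.
  under eq_Rintegral => x _ do rewrite e.
  under [RHS]eq_Rintegral => x _ do rewrite e.
  move/(congr1 (@EFin R)); rewrite -!bintE; try exact: bmeas_indic.
  by rewrite !integral_indic// !setIT.
- by move=> _; rewrite [ltLHS]probability_setT ltry.
Qed.

End CramerWold.

(** * Reduction of dimension d to its projections *)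

Section NormBound.
Context {R : realType} {d : nat}.
Local Notation V := (d.-tuple (measurableTypeR R)).

Lemma norm2_ge0 (x : V) : 0 <= norm2 x. Proof. exact: sqrtr_ge0. Qed.

Lemma measurable_norm2 : measurable_fun setT (norm2 : V -> R).
Proof.
apply: (measurableT_comp (f := @Num.sqrt R)).
  by apply: continuous_measurable_fun; exact: sqrt_continuous.
apply: (@measurable_sum _ V R setT _ _ (fun i x => (tnth x i : R) * (tnth x i : R))) => i.
by apply: measurable_funM; exact: (measurable_tnth i).
Qed.

Lemma normr_tnth_le (x : V) i : `|tnth x i : R| <= norm2 x.
Proof.
rewrite -sqrtr_sqr; apply: ler_wsqrtr; rewrite /inner (bigD1 i)//= expr2 lerDl.
by apply: sumr_ge0 => j _; rewrite -expr2 sqr_ge0.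
Qed.

Lemma normr_inner_le (f x : V) : `|inner f x| <= (\sum_(i < d) `|tnth f i : R|) * norm2 x.
Proof.
rewrite (le_trans (ler_norm_sum _ _ _))// mulr_suml; apply: ler_sum => i _.
by rewrite normrM ler_wpM2l// normr_tnth_le.
Qed.

(** With C the sum of the |f_i|, 1 + |inner f x| <= (1 + C)(1 + |x|), and the logarithm turns the
    product into a sum. *)
Lemma FT_projection (alpha : probability V R) (f : V) : FT alpha ->
  FT1 (distribution alpha (pack_mfun (measurable_inner f))).
Proof.
move=> aFT; rewrite /FT1.
have mL : measurable_fun setT (fun x : measurableTypeR R => (ln (1 + `|x : R|))%:E).
  apply/measurable_EFinP; apply: measurableT_comp => //.
  by apply: measurable_funD => //; exact: measurableT_comp.
have mN : measurable_fun setT (fun x : V => (ln (1 + norm2 x))%:E).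
  apply/measurable_EFinP; apply: measurableT_comp => //.
  by apply: measurable_funD => //; exact: measurable_norm2.
rewrite ge0_integral_distribution//; last first.
  by move=> y; rewrite lee_fin ln_ge0// lerDl.
pose C : R := \sum_(i < d) `|tnth f i : R|.
have C0 : 0 <= C by exact: sumr_ge0.
have lC : 0 <= ln (1 + C) by rewrite ln_ge0// lerDl.
have lN x : 0 <= ln (1 + norm2 (x : V)) by rewrite ln_ge0// lerDl norm2_ge0.
apply: (@le_lt_trans _ _ (\int[alpha]_x ((ln (1 + C))%:E + (ln (1 + norm2 x))%:E))%E).
  apply: ge0_le_integral => //.
  - by move=> x _; rewrite lee_fin ln_ge0// lerDl.
  - exact: (measurableT_comp mL (measurable_inner f)).
  - by apply: emeasurable_funD => //.
  - move=> x _ /=; rewrite -EFinD lee_fin -lnM ?posrE ?ltr_pwDl ?norm2_ge0//.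
    rewrite ler_ln ?posrE ?mulr_gt0 ?ltr_pwDl ?norm2_ge0//.
    have := normr_inner_le f x; rewrite -/C => h.
    apply: (@le_trans _ _ (1 + C * norm2 x)); first by rewrite lerD2l.
    have := norm2_ge0 x; move: (norm2 x) => t t0; rewrite mulrDl !mulrDr !mul1r mulr1; lra.
rewrite ge0_integralD//; try by move=> x _; rewrite lee_fin.
have a1 : alpha setT = 1%E by exact: probability_setT.
by rewrite integral_cst// [X in (_ * X)%E]a1 mule1 lte_add_pinfty// ltry.
Qed.

End NormBound.

Section Projection.
Context {R : realType} {d : nat} {dT : measure_display} {T : measurableType dT}.
Local Notation V := (d.-tuple (measurableTypeR R)).
Variables (P : probability T R) (n : nat) (alpha : probability V R).
Variables (B : nat -> {RV P >-> V}) (Y : nat -> {RV P >-> measurableTypeR R}).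
Hypothesis sb : stick_breaking n%:R alpha P B Y.
Hypothesis alphaFT : FT alpha.

Definition proj_law (f : V) := distribution alpha (pack_mfun (measurable_inner f)).

Lemma measurable_proj_var (f : V) k : measurable_fun setT
  (fun w => inner f (B k w) : measurableTypeR R).
Proof. exact: (measurableT_comp (measurable_inner f) (measurable_funPT (B k))). Qed.

Definition proj_var (f : V) k : {RV P >-> measurableTypeR R} :=
  pack_mfun (measurable_proj_var f k).

Lemma stick_breaking_projection (f : V) :
  stick_breaking n%:R (proj_law f) P (proj_var f) Y.
Proof.
split.
- move=> J A JA; apply: (sb_indep sb) => -[k|k] iJ; last exact: (JA (inr k) iJ).
  have [S mS SA] := JA (inl k) iJ; exists (inner f @^-1` S) => //.
  by rewrite -[_ @^-1` _]setTI; exact: (measurable_inner f measurableT mS).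
- move=> k A mA; apply: (sb_B sb k).
  by rewrite -[_ @^-1` _]setTI; exact: (measurable_inner f measurableT mA).
- exact: (sb_Y sb).
Qed.

Let unit_coord (i : 'I_d) : V := [tuple ((i == j)%:R : measurableTypeR R) | j < d].

Let inner_unit i x : inner (unit_coord i) x = tnth x i.
Proof.
rewrite /inner (bigD1 i)//= tnth_mktuple eqxx mul1r big1 ?addr0// => j ji.
by rewrite tnth_mktuple eq_sym (negbTE ji) mul0r.
Qed.

Let mean (w : T) : V :=
  [tuple series_sum (fun k => weight Y k w * tnth (B k w) i) : measurableTypeR R | i < d].

Let tnth_mean i w : tnth (mean w) i = stick_limit (proj_var (unit_coord i)) Y w.
Proof.
rewrite tnth_mktuple /stick_limit; congr series_sum; apply/funext => k.
by rewrite /proj_var /= inner_unit.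
Qed.

Lemma measurable_mean : measurable_fun setT mean.
Proof.
apply/measurable_fun_tnthP => i.
rewrite (_ : _ \o _ = stick_limit (proj_var (unit_coord i)) Y).
  exact: (measurable_stick_limit (stick_breaking_projection (unit_coord i))).
by apply/funext => w; exact: tnth_mean.
Qed.

(** Only almost sure: where a coordinate series diverges its sum is a default value, and projecting
    the vector of sums need not give the sum of the projected series. *)
Lemma inner_mean_ae (f : V) :
  {ae P, forall w, inner f (mean w) = stick_limit (proj_var f) Y w}.
Proof.
have : {ae P, forall w, forall i : 'I_d, cvgn (fun m => stick_sum (proj_var (unit_coord i)) Y m w : R)}.
  apply: filter_forall => i.
  have [N [mN N0 sN]] := stick_convergence (stick_breaking_projection (unit_coord i)) (FT_projection (unit_coord i) alphaFT).
  by exists N; split => // w wN; apply: sN => /= -[_ h]; apply: wN.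
move=> [N [mN N0 sN]]; exists N; split => // w wN; apply: sN => /= cw; apply: wN.
apply/esym/cvg_lim => //.
rewrite (_ : series _ = fun m => \sum_(i < d) (tnth f i : R) *
    (stick_sum (proj_var (unit_coord i)) Y m w : R)); last first.
  apply/funext => m; rewrite /series /= /stick_sum /series /=.
  under [RHS]eq_bigr => i _ do rewrite big_distrr /=.
  rewrite exchange_big /=; apply: eq_bigr => k _.
  rewrite [inner f _]/inner mulr_sumr; apply: eq_bigr => i _.
  by rewrite inner_unit; ring.
rewrite /inner.
have E i : (tnth f i : R) * (stick_sum (proj_var (unit_coord i)) Y m w : R) @[m --> \oo] -->
    (tnth f i : R) * tnth (mean w) i.
  rewrite tnth_mean; apply: cvgM; first exact: cvg_cst.
  exact: cw.
rewrite (_ : (fun m => _) = \sum_(i < d) (fun m => (tnth f i : R) *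
    (stick_sum (proj_var (unit_coord i)) Y m w : R))); last first.
  by apply/funext => m; rewrite fct_sumE.
apply: (big_ind2 (fun (u : nat -> R) (l : R) => u @ \oo --> l)) => //.
  exact: cvg_cst.
by move=> u l v k; exact: cvgD.
Qed.

Lemma mu_projection (f : V) :
  eq_law (pushforward (mu P B Y) (inner f : V -> measurableTypeR R)) (mu1 P (proj_var f) Y).
Proof.
move=> A mA.
have ml := measurable_stick_limit (stick_breaking_projection f).
have mm := measurableT_comp (measurable_inner f) measurable_mean.
have m1 : measurable ((inner f \o mean) @^-1` A : set T).
  by rewrite -[_ @^-1` _]setTI; exact: mm.
have m2 : measurable (stick_limit (proj_var f) Y @^-1` A : set T).
  by rewrite -[_ @^-1` _]setTI; exact: ml.
rewrite -[LHS]/(P ((inner f \o mean) @^-1` A)) -[RHS]/(P (stick_limit (proj_var f) Y @^-1` A)).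
rewrite -[X in P X = _]setIT -[X in _ = P X]setIT -!integral_indic//.
apply: ae_eq_integral => //.
- by apply/measurable_EFinP; exact: measurable_indic.
- by apply/measurable_EFinP; exact: measurable_indic.
have [N [mN N0 sN]] := inner_mean_ae f.
exists N; split => // w wN; apply: sN => /= h; apply: wN => _.
have E (g : T -> measurableTypeR R) : \1_(g @^-1` A) w = \1_A (g w) :> R by rewrite !indicE.
by rewrite !E /= h.
Qed.

Hypothesis n0 : (0 < n)%N.

Lemma mu_invariant_cauchyP : n = 1%N \/ n = 2%N ->
  eq_law (mu P B Y) alpha <-> is_cauchy_vector alpha.
Proof.
move=> n12; split=> [inv f mf|cv].
  have := cauchy_dirac_of_invariant n0 (stick_breaking_projection f)
    (FT_projection f alphaFT) n12.
  have : eq_law (mu1 P (proj_var f) Y) (proj_law f).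
    move=> A mA; rewrite -(mu_projection f mA); apply: inv.
    by rewrite -[_ @^-1` _]setTI; exact: (measurable_inner f measurableT mA).
  by move=> h /(_ h)[]; [right|left].
(* The random mean and alpha are compared through their projections; each projected law is Cauchy or
   Dirac, hence fixed by the result on the line. *)
have := @cramer_wold R d (distribution P (pack_mfun measurable_mean)) alpha; apply.
move=> f A mA; apply: (etrans (mu_projection f mA)).
apply: (invariant_of_cauchy_dirac n0 (stick_breaking_projection f) (FT_projection f alphaFT)) => //.
by case: (cv f); [right|left].
Qed.

End Projection.


Theorem proposition6p1 (R : realType) :
  (forall (n : nat) (alpha : probability (measurableTypeR R) R)
      (dT : measure_display) (T : measurableType dT) (P : probability T R)
      (B Y : nat -> {RV P >-> measurableTypeR R}),
    (0 < n)%N -> FT1 alpha -> stick_breaking n%:R alpha P B Y ->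
    (eq_law (mu1 P B Y) alpha <->
      forall z : R[i], 0 < complex.Im z ->
        n%:R * stieltjes alpha z * stieltjes_n alpha n.-1 z
        = stieltjes_n alpha n z)
    /\ ((n = 1%N \/ n = 2%N) -> eq_law (mu1 P B Y) alpha ->
        is_cauchy alpha \/ is_dirac alpha))
  /\
  (forall (d n : nat) (alpha : probability (d.-tuple (measurableTypeR R)) R)
      (dT : measure_display) (T : measurableType dT) (P : probability T R)
      (B : nat -> {RV P >-> d.-tuple (measurableTypeR R)})
      (Y : nat -> {RV P >-> measurableTypeR R}),
    (0 < d)%N -> FT alpha -> (n = 1%N \/ n = 2%N) ->
    stick_breaking n%:R alpha P B Y ->
    (eq_law (mu P B Y) alpha <-> is_cauchy_vector alpha)).
Proof.
split=> [n alpha dT T P B Y n0 aFT sb|d n alpha dT T P B Y _ aFT n12 sb].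
  split; first exact: mu1_invariantP n0 sb aFT.
  exact: cauchy_dirac_of_invariant n0 sb aFT.
apply: (mu_invariant_cauchyP sb aFT _ n12).
by case: n12 => ->.
Qed.
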